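(* Consider an $n\times n$ input-queued switch with mean arrival rate matrix $\boldsymbol\lambda=(1-\epsilon)\boldsymbol\nu$, and suppose the scheduling algorithm lies in the class $\Pi_3$. Then the process $\mathbf q(t)$ is stable. Also, the scheduling algorithm achieves state-space collapse (SSC) and its heavy traffic behaviour is MaxWeight-like, i.e. $$\lim_{\epsilon\downarrow0}\epsilon\,\mathbb E\Big[\sum_{i,j}\bar q_{ij}\Big]=\Big(1-\frac1{2n}\Big)\|\tilde{\boldsymbol\sigma}\|^2 .$$
   Context: Switch model. Time slots are $t=0,1,2,\dots$. $\mathbf q(t)$ is the $n\times n$ queue length matrix, where $q_{ij}(t)$ is the number of packets to be transferred from input $i$ to output $j$; $\mathbf a(t)$ is the $n\times n$ matrix of numbers of arriving packets; the schedule $\mathbf s(t)$ is an element of the set $\mathcal X$ of $n\times n$ permutation matrices, picked in each slot by a (possibly randomized) scheduling algorithm. The evolution is $q_{ij}(t+1)=\max\{0,\,q_{ij}(t)+a_{ij}(t)-s_{ij}(t)\}$. $\langle\cdot,\cdot\rangle$ and $\|\cdot\|$ are the Frobenius inner product and norm on $\mathbb R^{n\times n}$. Let $\mathcal H_t=\{\mathbf q(0),\mathbf s(0),\mathbf q(1),\dots,\mathbf s(t-1),\mathbf q(t)\}$ and $\tilde{\mathcal H}_t=\{\mathbf q(0),\mathbf s(0),\mathbf q(1),\dots,\mathbf s(t-1),\mathbf q(t),\mathbf s(t)\}$; $\sigma(\tilde{\mathcal H}_t)$ is the $\sigma$-algebra generated by $\tilde{\mathcal H}_t$. Arrivals. (i)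 For each pair $(i,j)$, the $a_{ij}(t)$ are independent and identically distributed with respect to $t$; (ii) the arrival process is independent across pairs $(i,j)$; (iii) there exists $a_{\max}$ such that $a_{ij}(t)\le a_{\max}<\infty$ for all $i,j,t$; (iv) $\mathbb P(\mathbf a(t)=\mathbf 0)>0$. The mean is $\mathbb E[\mathbf a(t)]=\boldsymbol\lambda=(1-\epsilon)\boldsymbol\nu$ for some $\epsilon\in(0,1)$ (the heavy traffic parameter) and some doubly stochastic matrix $\boldsymbol\nu$ with $\nu_{\min}=\min_{ij}\nu_{ij}>0$. The entrywise variance $\boldsymbol\sigma^2=\mathrm{Var}(\mathbf a(t))$ satisfies $\boldsymbol\sigma^2\to\tilde{\boldsymbol\sigma}^2$ as $\epsilon\downarrow0$ for some $\tilde{\boldsymbol\sigma}^2$. The parameters of the arrival process may depend on $\epsilon$. Markov chain and stability. It is assumed that there is a process $X(t)$ associated with the switch that forms a Markov chain. Conditions: A.1: $X(t)$ is $\sigma(\tilde{\mathcal H}_t)$-measurable, and it is irreducible and aperiodic (for irreducibility one may take the communicating class of $X(0)$ as the state space). A.2: there is a function $g$ with $\mathbf q(t)=g(X(t))$ such that $g^{-1}(\mathcal A)$ is finite for every finite $\mathcal A\subset\mathbb Z^{n\times n}$. The switch (or $\mathbf q(t)$) is stable if $X(t)$ is positive recurrent; $\bar{\mathbf q}$ denotes the steady-state queue length matrix, i.e. the limit in distribution of $\mathbf q(t)$. Cone. $\mathcal S=\{\mathbf x\in\mathbb R^{n\times n}: x_{ij}=w_i+\tilde w_j \text{ for all } i,j,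 \text{ for some } w,\tilde w\in\mathbb R^n\}$, $\mathcal K=\mathcal S\cap\mathbb R_{+}^{n\times n}$ (the intersection with the positive orthant); $\mathbf x_{\|\mathcal K}$ is the projection of $\mathbf x$ onto $\mathcal K$ and $\mathbf x_{\perp\mathcal K}=\mathbf x-\mathbf x_{\|\mathcal K}$. SSC. A scheduling algorithm achieves SSC if the switch is stable, the corresponding Markov chain $X(t)$ satisfies A.1 and A.2, and there exists $\epsilon_0>0$ such that for $0<\epsilon\le\epsilon_0$, $\mathbb E[\|\bar{\mathbf q}_{\perp\mathcal K}\|^r]\le C_r$ for all $r\in\{1,2,\dots\}$, where $C_r$ is a constant independent of $\epsilon$. Class $\Pi_3$. A scheduling algorithm lies in $\Pi_3$ if the corresponding Markov chain $X(t)$ satisfies A.1 and A.2 and: (i) there exists $\delta>0$ such that for every $t\ge0$ the chosen schedule satisfies $\mathbb P\big(\langle\mathbf q(t),\mathbf s(t)\rangle=\max_{\mathbf s\in\mathcal X}\langle\mathbf q(t),\mathbf s\rangle\,\big|\,\mathcal H_t\big)\ge\delta$; (ii) for every $t\ge1$, the chosen schedule satisfies $\langle\mathbf q(t),\mathbf s(t)\rangle\ge\langle\mathbf q(t),\mathbf s(t-1)\rangle$; (iii) there exists a deterministic function $f$ such that $(\mathbf q(t),\mathbf s(t))=f(X(t))$. *)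

(* Defs.v *)
From mathcomp Require Import all_boot all_order all_algebra all_fingroup.
From mathcomp Require Import finmap all_classical all_reals all_analysis.

Set Implicit Arguments.
Unset Strict Implicit.
Unset Printing Implicit Defensive.

Import Order.TTheory GRing.Theory Num.Theory.
Import numFieldNormedType.Exports.

Local Open Scope classical_set_scope.
Local Open Scope ring_scope.

(** * Discrete random elements *)

Section discrete.
Context d (T : measurableType d) (R : realType) (P : probability T R).

Definition discrete_rv (V : countType) (Y : T -> V) : Prop :=
  forall v, measurable (Y @^-1` [set v]).

(** The sigma-algebra generated by [Y], the countable type [V] carrying its
    power set as sigma-algebra. *)
Definition sigma_of (V : countType) (Y : T -> V) : set (set T) :=
  preimage_set_system [set: T] Y [set: set V].

Definition independent_classes (I : choiceType) (F : I -> set (set T)) : Prop :=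
  forall (J : {fset I}) (A : I -> set T), (forall i, i \in J -> F i (A i)) ->
    P (\bigcap_(i in [set` J]) A i) = (\prod_(i <- J) P (A i))%E.

(** Elementary conditional probability; it is 0 when [P B = 0]. *)
Definition cprob (A B : set T) : R := fine (P (A `&` B)) / fine (P B).

(** The random variable P(A | Y), for a discrete [Y]. *)
Definition cprob_given (A : set T) (V : countType) (Y : T -> V) : T -> R :=
  fun w => cprob A (Y @^-1` [set Y w]).

End discrete.

(** * Markov chains on a countable state space *)

Section markov.
Context (R : realType) (E : countType) (p : E -> E -> R).

Definition stochastic : Prop :=
  (forall x y, 0 <= p x y) /\
  (forall x, \esum_(y in [set: E]) (p x y)%:E = 1%E).

Definition markov_chain d (T : measurableType d) (P : probability T R)
    (X : nat -> T -> E) : Prop :=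
  stochastic /\
  forall (t : nat) (x : nat -> E) (y : E),
    let past := [set w | forall u, (u <= t)%N -> X u w = x u] in
    (0 < P past)%E -> cprob P (X t.+1 @^-1` [set y]) past = p (x t) y.

Fixpoint nstep (k : nat) (x y : E) : \bar R :=
  if k is k'.+1 then (\esum_(z in [set: E]) ((p x z)%:E * nstep k' z y))%E
  else ((x == y)%:R)%:E.

Definition irreducible : Prop := forall x y, exists k, (0 < nstep k x y)%E.

(** The gcd of the possible return times is 1. *)
Definition aperiodic : Prop :=
  forall (x : E) (m : nat),
    (forall k, (0 < k)%N -> (0 < nstep k x x)%E -> (m %| k)%N) -> m = 1%N.

(** [first_hit k x y] is the probability that the chain started at [x] visits
    [y] for the first time, time 0 excluded, at time [k.+1]. *)
Fixpoint first_hit (k : nat) (x y : E) : \bar R :=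
  if k is k'.+1 then
    (\esum_(z in [set z | z <> y]) ((p x z)%:E * first_hit k' z y))%E
  else (p x y)%:E.

Definition positive_recurrent : Prop := forall x : E,
  (\sum_(0 <= k <oo) first_hit k x x = 1)%E /\
  (\sum_(0 <= k <oo) (k.+1%:R%:E * first_hit k x x) < +oo)%E.

End markov.

(** * Frobenius geometry and the cone *)

Section frobenius.
Context (R : realType) (n : nat).
Implicit Types x y : 'M[R]_n.

Definition frob_inner x y : R := \sum_i \sum_j x i j * y i j.
Definition frob_norm x : R := Num.sqrt (frob_inner x x).

Definition coneS : set 'M[R]_n :=
  [set x | exists w w' : 'I_n -> R, forall i j, x i j = w i + w' j].
Definition coneK : set 'M[R]_n :=
  coneS `&` [set x | forall i j, 0 <= x i j].

(** The nearest point of the closed convex set [coneK]; the default value 0 of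
    [xget] is never used, since such a point exists (and is unique). *)
Definition proj_cone x : 'M[R]_n :=
  xget 0 [set y | coneK y /\
    forall z, coneK z -> frob_norm (x - y) <= frob_norm (x - z)].
Definition perp_cone x : 'M[R]_n := x - proj_cone x.

Definition doubly_stochastic (nu : 'M[R]_n) : Prop :=
  [/\ forall i j, 0 <= nu i j,
      forall i, \sum_j nu i j = 1
    & forall j, \sum_i nu i j = 1].

Definition natmx (m : 'M[nat]_n) : 'M[R]_n := map_mx (fun k : nat => k%:R) m.

(** The default value 0 is harmless, all the weights being nonnegative. *)
Definition max_weight (q : 'M[nat]_n) : R :=
  \big[Num.max/0]_(p : 'S_n) frob_inner (natmx q) (perm_mx p).

End frobenius.
Arguments natmx R {n} m.
Arguments max_weight R {n} q.

(** * The switch *)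

(** A switch run under a scheduling algorithm, with its Markov chain [sw_X].
    In [sw_evolution], the truncated subtraction of [nat] is
    max{0, q + a - s}. *)
Record switch (R : realType) (n : nat) := Switch {
  sw_disp : measure_display;
  sw_sample : measurableType sw_disp;
  sw_prob : probability sw_sample R;
  sw_q : nat -> sw_sample -> 'M[nat]_n;
  sw_a : nat -> sw_sample -> 'M[nat]_n;
  sw_s : nat -> sw_sample -> 'M[nat]_n;
  sw_q_rv : forall t, discrete_rv (sw_q t);
  sw_a_rv : forall t, discrete_rv (sw_a t);
  sw_s_rv : forall t, discrete_rv (sw_s t);
  sw_s_perm : forall t w, is_perm_mx (sw_s t w);
  sw_evolution : forall t w i j,
    sw_q t.+1 w i j = (sw_q t w i j + sw_a t w i j - sw_s t w i j)%N;
  sw_state : countType;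
  sw_X : nat -> sw_sample -> sw_state;
  sw_X_rv : forall t, discrete_rv (sw_X t);
  sw_p : sw_state -> sw_state -> R;
  sw_markov : markov_chain sw_p sw_prob sw_X
}.

Section switch.
Context (R : realType) (n : nat) (S : switch R n).

(** The history q(0), s(0), q(1), ..., s(t-1), q(t), and the same followed by
    s(t). *)
Definition hist (t : nat) (w : sw_sample S) : seq 'M[nat]_n * seq 'M[nat]_n :=
  ([seq sw_q u w | u <- iota 0 t.+1], [seq sw_s u w | u <- iota 0 t]).
Definition hist_tilde (t : nat) (w : sw_sample S) :
    seq 'M[nat]_n * seq 'M[nat]_n :=
  ([seq sw_q u w | u <- iota 0 t.+1], [seq sw_s u w | u <- iota 0 t.+1]).

Definition arr (i j : 'I_n) (t : nat) (w : sw_sample S) : nat := sw_a t w i j.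

(** The last condition is causality: initial state and scheduling decisions up
    to time [t] do not anticipate the arrivals in slot [t]. *)
Record arrival_conditions (amax : nat) (lambda : 'M[R]_n) : Prop := {
  arr_indep_time : forall i j,
    independent_classes (sw_prob S) (fun t => sigma_of (arr i j t));
  arr_ident : forall i j t (B : set nat),
    sw_prob S (arr i j t @^-1` B) = sw_prob S (arr i j 0%N @^-1` B);
  arr_indep_pairs :
    independent_classes (sw_prob S) (fun ij : 'I_n * 'I_n =>
      <<s \bigcup_(t in [set: nat]) sigma_of (arr ij.1 ij.2 t) >>);
  arr_bounded : forall i j t w, (arr i j t w <= amax)%N;
  arr_zero : forall t,
    (0 < sw_prob S [set w | forall i j, arr i j t w = 0%N])%E;
  arr_mean : forall i j t,
    ('E_(sw_prob S)[fun w => (arr i j t w)%:R])%E = (lambda i j)%:E;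
  arr_causal : forall t A B,
    sigma_of (sw_a (s := S) t) A -> sigma_of (hist_tilde t) B ->
    sw_prob S (A `&` B) = (sw_prob S A * sw_prob S B)%E
}.

Definition condition_A1 : Prop :=
  [/\ forall t (B : set (sw_state S)),
        sigma_of (hist_tilde t) (sw_X t @^-1` B),
      irreducible (sw_p (s := S)) & aperiodic (sw_p (s := S))].

Definition condition_A2 : Prop :=
  exists g : sw_state S -> 'M[nat]_n,
    (forall t w, sw_q t w = g (sw_X t w)) /\
    (forall A : set 'M[nat]_n, finite_set A -> finite_set (g @^-1` A)).

Definition stable : Prop := positive_recurrent (sw_p (s := S)).

End switch.

Record random_matrix (R : realType) (n : nat) := RandomMatrix {
  rm_disp : measure_display;
  rm_sample : measurableType rm_disp;
  rm_prob : probability rm_sample R;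
  rm_val :> rm_sample -> 'M[nat]_n;
  rm_rv : discrete_rv rm_val
}.

(** [qbar] is a limit in distribution of q(t). Queue length matrices form a
    discrete space, on which every function is continuous. *)
Definition steady_state (R : realType) (n : nat) (S : switch R n)
    (qbar : random_matrix R n) : Prop :=
  forall f : 'M[nat]_n -> R, (exists M : R, forall v, `|f v| <= M) ->
    ('E_(sw_prob S)[fun w => f (sw_q t w)])%E @[t --> \oo]
      --> ('E_(rm_prob qbar)[fun w => f (qbar w)])%E.

(** * Properties of a scheduling algorithm *)

(** The scheduling algorithm is given through the switches [sw e] that it
    induces for each value [e] in (0,1) of the heavy traffic parameter; the
    constants [delta] and [C] below do not depend on [e]. *)
Section algorithm.
Context (R : realType) (n : nat) (sw : R -> switch R n).

Definition class_Pi3 : Prop :=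
  [/\ forall e : R, 0 < e < 1 -> condition_A1 (sw e) /\ condition_A2 (sw e),
      exists2 delta : R, 0 < delta &
        forall e : R, 0 < e < 1 -> forall t : nat,
          {ae sw_prob (sw e), forall w,
            delta <= cprob_given (sw_prob (sw e))
              [set w | frob_inner (natmx R (sw_q t w)) (natmx R (sw_s t w))
                       = max_weight R (sw_q t w)] (@hist _ _ (sw e) t) w},
      forall e : R, 0 < e < 1 -> forall (t : nat) (w : sw_sample (sw e)),
        frob_inner (natmx R (sw_q t.+1 w)) (natmx R (sw_s t.+1 w))
          >= frob_inner (natmx R (sw_q t.+1 w)) (natmx R (sw_s t w))
    & forall e : R, 0 < e < 1 ->
        exists f : sw_state (sw e) -> 'M[nat]_n * 'M[nat]_n,
          forall (t : nat) (w : sw_sample (sw e)),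
            (sw_q t w, sw_s t w) = f (sw_X t w)].

Definition achieves_SSC : Prop :=
  (forall e : R, 0 < e < 1 ->
    [/\ stable (sw e), condition_A1 (sw e) & condition_A2 (sw e)]) /\
  exists2 e0 : R, 0 < e0 & exists C : nat -> R,
    forall e : R, 0 < e < 1 -> e <= e0 ->
    forall qbar : random_matrix R n, steady_state (sw e) qbar ->
    forall r : nat, (0 < r)%N ->
      ('E_(rm_prob qbar)[fun w =>
          (frob_norm (perp_cone (natmx R (qbar w))) ^+ r)%R] <= (C r)%:E)%E.

End algorithm.

(* Main.v *)
Require Import Defs.
From HB Require Import structures.
From mathcomp Require Import all_boot all_order all_algebra all_fingroup.
From mathcomp Require Import finmap all_classical all_reals all_analysis.
From mathcomp Require Import measurable_realfun.
From mathcomp Require Import ring lra zify.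

Set Implicit Arguments.
Unset Strict Implicit.
Unset Printing Implicit Defensive.

Import Order.TTheory GRing.Theory Num.Theory.
Import numFieldNormedType.Exports.

Local Open Scope classical_set_scope.
Local Open Scope ring_scope.

(** In a state of the chain the queue and the schedule are determined, so the
    next queue takes finitely many values, one for each arrival matrix; as
    only finitely many states share a queue, every state has finitely many
    successors. The transition operator P therefore acts by finite sums on
    arbitrary real functions, and the expectation of phi in equilibrium can be
    taken to be the limit of the iterates of P on phi: no invariant measure
    and no integrability enter the analysis of the chain.

    Let D be the deficit: the maximal weight minus the weight of the schedule
    in use. D vanishes in the next slot with probability at least delta.
    Otherwise, as the new schedule is at least as good as the old one, D
    increases by at most a bounded amount. Let N be the norm of the queue, or
    its distance to the cone K. In both cases the mean change of N^2 in a slot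
    is at most - c N + 2 D + C with c > 0. For the norm, c is of the order of
    e, which gives stability for each e. For the distance to the cone, c does
    not depend on e: by linear programming duality for assignments (egervary),
    the maximal weight exceeds the weight of nu by at least the smallest entry
    of nu times the distance to K (weight_margin), which gives collapse. A
    geometric drift of exp(eta N) + A exp(theta D) follows in both cases
    (exp_drift), where A is so large that the resets of D pay for what D does
    to N.

    Irreducibility, aperiodicity and finite sublevel sets turn the drift of
    the first such function into convergence of the iterates, by the
    contraction argument of Hairer and Mattingly for Harris's theorem
    (harris), and, applied to the chain killed at a point, into positive
    recurrence (drift_positive_recurrent). The drift of the second one bounds
    all moments of the distance to K uniformly in e (collapse_moments).

    For the heavy traffic limit, let T map a matrix x to the matrix whose (i,
    j) entry is the sum of row i plus that of column j minus the total divided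
    by n. It is n times the orthogonal projection on the span S of K, and it
    sends every doubly stochastic matrix to the matrix of ones. Hence, if u is
    the unused service and q' the new queue, the mean change of <q, T q> in a
    slot is - 2 e total(q) + (2 - 1/n) total(variances) + n e^2, up to 2 <u, T
    q'> - <u, T u>. The variances have this factor because arrivals to
    different pairs are uncorrelated and the diagonal entries of T are 1 + 1 -
    1/n. Unused service occurs only at empty queues, so <u, q'> = 0 and <u, T
    q'> sees only the part of q' orthogonal to K, while total(u) has mean n e
    in equilibrium. With the bounded second moment of that part, weighted
    AM-GM makes the error O(sqrt e). In equilibrium the mean change of <q, T
    q> is zero; dividing by 2 gives the limit (heavy_traffic_bound).

    The hypotheses on the probability space enter through kernel_of_switch,
    which collects what they say about the transition probabilities. The
    limits of iterates become steady-state expectations through steady_moment,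
    and steady_state_exists assembles a limit law from the limits of the point
    masses. *)

(** * Markov operators and geometric drift *)

(** Linear, positive and preserving constants: nothing else about a transition
    operator is used in the convergence argument, which therefore needs no
    measure on the state space. *)
Record markov_op (R : realType) (E : Type) (T : (E -> R) -> E -> R) : Prop :=
  MarkovOp {
    mo_lin : forall (a b : R) f g,
      T (fun y => a * f y + b * g y) = (fun x => a * T f x + b * T g x);
    mo_ge0 : forall f, (forall y, 0 <= f y) -> forall x, 0 <= T f x;
    mo_1 : T (fun=> 1) = fun=> 1
  }.

Section markov_op.
Context (R : realType) (E : Type) (T : (E -> R) -> E -> R).
Hypothesis mT : markov_op T.

Lemma mo_cst (c : R) : T (fun=> c) = fun=> c.
Proof.
have := mo_lin mT c 0 (fun=> 1) (fun=> 1).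
rewrite (mo_1 mT) => h; rewrite -[LHS](_ : T (fun=> c * 1 + 0 * 1) = _).
  by rewrite h; apply/funext => x; rewrite mul0r addr0 mulr1.
by congr (T _); apply/funext => x; rewrite mul0r addr0 mulr1.
Qed.

Lemma mo_cstx (c : R) x : T (fun=> c) x = c.
Proof. by rewrite mo_cst. Qed.

Lemma moD f g x : T (fun y => f y + g y) x = T f x + T g x.
Proof.
have -> : (fun y => f y + g y) = (fun y => 1 * f y + 1 * g y).
  by apply/funext => y; rewrite !mul1r.
by rewrite mo_lin // !mul1r.
Qed.

Lemma moB f g x : T (fun y => f y - g y) x = T f x - T g x.
Proof.
have -> : (fun y => f y - g y) = (fun y => 1 * f y + (-1) * g y).
  by apply/funext => y; rewrite mul1r mulN1r.
by rewrite mo_lin // mul1r mulN1r.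
Qed.

Lemma moZ (c : R) f x : T (fun y => c * f y) x = c * T f x.
Proof.
have -> : (fun y => c * f y) = (fun y => c * f y + 0 * f y).
  by apply/funext => y; rewrite mul0r addr0.
by rewrite mo_lin // mul0r addr0.
Qed.

Lemma moN f x : T (fun y => - f y) x = - T f x.
Proof.
have -> : (fun y => - f y) = (fun y => (-1) * f y).
  by apply/funext => y; rewrite mulN1r.
by rewrite moZ mulN1r.
Qed.

Lemma mo_le f g x : (forall y, f y <= g y) -> T f x <= T g x.
Proof.
move=> fg; rewrite -subr_ge0 -moB; apply: mo_ge0 => // y.
by rewrite subr_ge0.
Qed.

End markov_op.

Lemma markov_op_iter (R : realType) (E : Type) (T : (E -> R) -> E -> R) t :
  markov_op T -> markov_op (iter t T).
Proof.
move=> mT; elim: t => [|t IH].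
  by split => //= f f0 x; exact: f0.
split=> [a b f g|f f0 x|]/=.
- by rewrite (mo_lin IH) (mo_lin mT).
- by apply: (mo_ge0 mT) => y; apply: (mo_ge0 IH).
- by rewrite (mo_1 IH) (mo_1 mT).
Qed.

Section drift.
Context (R : realType) (E : Type) (T : (E -> R) -> E -> R).
Hypothesis mT : markov_op T.
Variables (F : E -> R) (g K : R).
Hypotheses (g0 : 0 <= g) (g1 : g < 1) (K0 : 0 <= K).
Hypothesis F0 : forall x, 0 <= F x.
Hypothesis TF : forall x, T F x <= g * F x + K.

Lemma drift_iter t x : iter t T F x <= g ^+ t * F x + K / (1 - g).
Proof.
have g1' : 0 < 1 - g by rewrite subr_gt0.
elim: t x => [|t IH] x.
  by rewrite /= expr0 mul1r lerDl divr_ge0 // ltW.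
rewrite iterSr.
have mt := markov_op_iter t mT.
apply: le_trans (mo_le mt x TF) _.
rewrite (moD mt) (moZ mt) (mo_cst mt) exprS -mulrA.
have := ler_wpM2l g0 (IH x).
rewrite mulrDr => h.
have -> : K / (1 - g) = g * (K / (1 - g)) + K.
  by field; rewrite gt_eqF.
by rewrite addrA lerD2r.
Qed.

Lemma drift_iter_bound t x : iter t T F x <= F x + K / (1 - g).
Proof.
apply: le_trans (drift_iter t x) _; rewrite lerD2r ler_piMl //.
by rewrite exprn_ile1 // ltW.
Qed.

(** The rate g of a single step bounds every number of steps, so that one and
    the same pair of constants serves for the chain sampled every m.+1 steps,
    with m chosen later. *)
Lemma drift_iterS t x : iter t.+1 T F x <= g * F x + K / (1 - g).
Proof.
apply: le_trans (drift_iter t.+1 x) _; rewrite lerD2r ler_wpM2r //.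
by rewrite exprS ler_piMr // exprn_ile1 // ltW.
Qed.

End drift.

(** * Contraction and convergence to equilibrium *)

(** Constants for contracting the weighted Lipschitz seminorm, where S is the
    sum of the values of F at two points. The threshold Rr is so large that
    from S = Rr on the drift of F alone contracts. The weight beta is so small
    that the additive constant 2 K of the drift eats up only part of the mass
    alpha shared below the threshold. Rr must come first: the mass alpha
    available on the sublevel set is known only once Rr is. *)
Lemma contraction_constants (R : realType) (g K : R) :
  0 <= g -> g < 1 -> 0 <= K ->
  exists Rr : R, forall alpha, 0 < alpha -> alpha < 1 ->
  exists beta tau : R, [/\ 0 < beta, 0 < tau, tau < 1,
    forall S, Rr <= S ->
      2 + beta * (g * S + 2 * K) <= (1 - tau) * (2 + beta * S) &
    forall S, 0 <= S ->
      2 * (1 - alpha) + beta * (g * S + 2 * K) <= (1 - tau) * (2 + beta * S)].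
Proof.
move=> g0 g1 K0; have h : 0 < 1 - g by rewrite subr_gt0.
pose Rr := 4 * K / (1 - g) + 1.
have Rr0 : 0 < Rr by rewrite ltr_wpDl // divr_ge0 ?mulr_ge0 // ltW.
exists Rr => al al0 al1.
have K1 : 0 < 2 * K + 1 by rewrite ltr_wpDl // mulr_ge0.
pose be := al / (2 * K + 1).
have be0 : 0 < be by rewrite divr_gt0.
have beK : be * (2 * K) <= al.
  by rewrite /be mulrAC ler_pdivrMr // ler_wpM2l ?ltW // ltrDl.
have RrK S : Rr <= S -> 4 * K <= (1 - g) * S.
  move=> SR; have : 4 * K / (1 - g) <= S by rewrite (le_trans _ SR) // lerDl.
  by rewrite ler_pdivrMr // [S * _]mulrC.
clearbody be Rr.
pose tau := Num.min (Num.min ((1 - g) / 4) ((1 - g) * be * Rr / 8)) (al / 2).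
have t0 : 0 < tau.
  have p1 : 0 < (1 - g) * be * Rr by rewrite !mulr_gt0.
  by rewrite !lt_min; apply/andP; split; [apply/andP; split|]; lra.
have t1 : tau <= (1 - g) / 4 by rewrite !ge_min lexx.
have t2 : tau <= (1 - g) * be * Rr / 8 by rewrite !ge_min lexx orbT.
have t3 : tau <= al / 2 by rewrite !ge_min lexx orbT.
exists be, tau; split => //; first by lra.
- move=> S SR.
  have h1 : tau * (be * S) <= (1 - g) / 4 * (be * S).
    by rewrite ler_wpM2r // mulr_ge0 ?ltW // (lt_le_trans Rr0).
  have h2 : (1 - g) * be * Rr <= (1 - g) * be * S.
    by rewrite ler_wpM2l // mulr_ge0 ?ltW.
  have h3 : 4 * K <= (1 - g) * S.
    exact: RrK.
  have h4 : be * (4 * K) <= be * ((1 - g) * S) by rewrite ler_wpM2l // ltW.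
  lra.
- move=> S S0.
  have h1 : tau * (be * S) <= (1 - g) / 4 * (be * S).
    by rewrite ler_wpM2r // mulr_ge0 // ltW.
  have h5 : 0 <= (1 - g) * (be * S) by rewrite !mulr_ge0 // ltW.
  lra.
Qed.

Section contraction.
Context (R : realType) (E : Type) (T : (E -> R) -> E -> R).
Hypothesis mT : markov_op T.
Variables (F : E -> R) (g K Rr alpha beta tau : R) (z : E).
Hypotheses (F0 : forall x, 0 <= F x) (be0 : 0 < beta).
Hypotheses (al0 : 0 < alpha) (al1 : alpha < 1).
Hypothesis TF : forall x, T F x <= g * F x + K.
Hypothesis minor : forall x, F x <= Rr ->
  forall psi, (forall y, 0 <= psi y) -> alpha * psi z <= T psi x.
Hypothesis far : forall S, Rr <= S ->
  2 + beta * (g * S + 2 * K) <= (1 - tau) * (2 + beta * S).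
Hypothesis near : forall S, 0 <= S ->
  2 * (1 - alpha) + beta * (g * S + 2 * K) <= (1 - tau) * (2 + beta * S).

(** For c = 1, the dual form of the weighted total variation distance of
    Hairer and Mattingly; using functions rather than measures avoids
    couplings. *)
Definition weighted_lip (c : R) (phi : E -> R) :=
  forall x y, phi x - phi y <= c * (2 + beta * (F x + F y)).

(** Where F x + F y is large the drift of F gives the factor. Otherwise both
    transition laws contain the mass alpha at z, which cancels in the
    difference of T phi at x and at y, so only the mass 1 - alpha contributes
    to the constant 2. Instead of coupling the two laws, the inequality for
    phi u - phi v is integrated in u from x and then in v from y. *)
Lemma contraction1 phi : weighted_lip 1 phi -> weighted_lip (1 - tau) (T phi).
Proof.
move=> L x y.
have [Rxy|Rxy] := leP Rr (F x + F y).
  apply: le_trans _ (far Rxy).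
  (* integration in u from x, then in v from y *)
  have h v : T phi x - phi v <= 2 + beta * (T F x + F v).
    rewrite -[phi v](mo_cstx mT _ x) -(moB mT).
    have -> : 2 + beta * (T F x + F v) =
      T (fun u => (2 + beta * F v) + beta * F u) x.
      by rewrite (moD mT) (mo_cst mT) (moZ mT); ring.
    by apply: (mo_le mT) => u; have := L u v; lra.
  have h2 : T phi x - T phi y <= 2 + beta * (T F x + T F y).
    rewrite -[T phi x](mo_cstx mT _ y) -(moB mT).
    have -> : 2 + beta * (T F x + T F y) =
      T (fun u => (2 + beta * T F x) + beta * F u) y.
      by rewrite (moD mT) (mo_cst mT) (moZ mT); ring.
    by apply: (mo_le mT) => u; have := h u; lra.
  apply: le_trans h2 _; rewrite lerD2l ler_wpM2l ?(ltW be0) //.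
  by have := TF x; have := TF y; lra.
have xR : F x <= Rr by have := F0 y; lra.
have yR : F y <= Rr by have := F0 x; lra.
apply: le_trans _ (near (addr_ge0 (F0 x) (F0 y))).
have a1 : 0 < 1 - alpha by rewrite subr_gt0.
(* removing the mass alpha at z from the law from x; below, the same for the
   law from y *)
have h v : T phi x - alpha * phi z - (1 - alpha) * phi v
    <= 2 * (1 - alpha) + beta * (T F x + (1 - alpha) * F v).
  have pos u : 0 <= 2 + beta * (F u + F v) - (phi u - phi v).
    by rewrite subr_ge0; have := L u v; lra.
  have := minor xR pos.
  have -> : T (fun u => 2 + beta * (F u + F v) - (phi u - phi v)) x =
    2 + beta * (T F x + F v) - (T phi x - phi v).
    rewrite !(moB mT, moD mT, moZ mT, moN mT) !(mo_cst mT).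
    ring.
  move=> hh.
  have : 0 <= alpha * (beta * F z) by rewrite !mulr_ge0 // ltW.
  lra.
have h2 : (1 - alpha) * (T phi x - T phi y)
    <= (1 - alpha) * (2 * (1 - alpha) + beta * (T F x + T F y)).
  have pos v : 0 <= 2 * (1 - alpha) + beta * (T F x + (1 - alpha) * F v)
      - (T phi x - alpha * phi z - (1 - alpha) * phi v).
    by rewrite subr_ge0; have := h v; lra.
  have := minor yR pos.
  have -> : T (fun v => 2 * (1 - alpha) + beta * (T F x + (1 - alpha) * F v)
      - (T phi x - alpha * phi z - (1 - alpha) * phi v)) y =
    2 * (1 - alpha) + beta * (T F x + (1 - alpha) * T F y)
      - (T phi x - alpha * phi z - (1 - alpha) * T phi y).
    by rewrite !(moB mT, moD mT, moZ mT, moN mT) !(mo_cst mT).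
  move=> hh.
  have p1 : 0 <= alpha * ((1 - alpha) * (beta * F z)).
    by rewrite !mulr_ge0 // ltW.
  have p2 : 0 <= alpha * (beta * T F x).
    by rewrite mulr_ge0 ?(ltW al0) // mulr_ge0 ?(ltW be0) // (mo_ge0 mT).
  lra.
rewrite ler_pM2l // in h2.
apply: le_trans h2 _; rewrite lerD2l ler_wpM2l ?(ltW be0) //.
by have := TF x; have := TF y; lra.
Qed.

Lemma contraction c phi : 0 < c -> weighted_lip c phi ->
  weighted_lip ((1 - tau) * c) (T phi).
Proof.
move=> c0 L.
have L1 : weighted_lip 1 (fun y => c^-1 * phi y).
  by move=> x y; rewrite -mulrBr mul1r ler_pdivrMl // L.
move=> x y; have h := contraction1 L1.
have := h x y; rewrite !(moZ mT) -mulrBr ler_pdivrMl // => /le_trans -> //.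
by rewrite mulrA [c * _]mulrC.
Qed.

End contraction.

Section harris.
Context (R : realType) (E : Type) (P : (E -> R) -> E -> R).
Hypothesis mP : markov_op P.
Variables (F : E -> R) (g K : R).
Hypotheses (g0 : 0 <= g) (g1 : g < 1) (K0 : 0 <= K).
Hypothesis F0 : forall x, 0 <= F x.
Hypothesis PF : forall x, P F x <= g * F x + K.
Hypothesis minor : forall Rr, exists m z (alpha : R), [/\ 0 < alpha, alpha < 1 &
  forall x, F x <= Rr -> forall psi, (forall y, 0 <= psi y) ->
    alpha * psi z <= iter m.+1 P psi x].

(** The seminorm contracts along the multiples of m.+1. The difference of
    iterates j apart is an average, over j steps, of differences of the
    earlier iterate, and F grows boundedly under averaging, so the iterates
    form a Cauchy sequence at every point; the seminorm tends to 0, so the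
    limit does not depend on the point. *)
Theorem harris (c : R) phi : (forall x, `|phi x| <= c * (1 + F x)) ->
  exists l : R, forall x, iter t P phi x @[t --> \oo] --> l.
Proof.
move=> phiF.
have g1' : 0 < 1 - g by rewrite subr_gt0.
pose K' := K / (1 - g).
have K'0 : 0 <= K' by rewrite divr_ge0 // ltW.
have [Rr hRr] := contraction_constants g0 g1 K'0.
have [m [z [al [al0 al1 min]]]] := minor Rr.
have [be [tau [be0 t0 t1 far near]]] := hRr _ al0 al1.
pose T := iter m.+1 P.
have mT : markov_op T by exact: markov_op_iter.
have TF x : T F x <= g * F x + K' by exact: drift_iterS.
(* the growth bound c (1 + F) compared with the weight 2 + be F; the summand
   1 makes c0 positive *)
pose c0 := `|c| * (1 + be^-1) + 1.
have c00 : 0 < c0.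
  by rewrite ltr_wpDl // mulr_ge0 // addr_ge0 // invr_ge0 ltW.
have be' : 0 < be^-1 by rewrite invr_gt0.
have L0 : weighted_lip F be c0 phi.
  move=> x y.
  have hc : c <= `|c| by exact: ler_norm.
  have hx : `|phi x| <= `|c| * (1 + F x).
    by apply: le_trans (phiF x) _; rewrite ler_wpM2r // addr_ge0.
  have hy : `|phi y| <= `|c| * (1 + F y).
    by apply: le_trans (phiF y) _; rewrite ler_wpM2r // addr_ge0.
  have h1 : phi x - phi y <= `|c| * (2 + (F x + F y)).
    have := ler_norm (phi x); have := ler_norm (- phi y).
    by rewrite normrN; lra.
  apply: le_trans h1 _; set S := F x + F y.
  have S0 : 0 <= S by rewrite addr_ge0.
  rewrite /c0.
  have -> : (`|c| * (1 + be^-1) + 1) * (2 + be * S) =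
    `|c| * (2 + S) + (`|c| * (be * S) + `|c| * be^-1 * 2 + (2 + be * S)).
    by field; rewrite gt_eqF.
  by rewrite lerDl !addr_ge0 // !mulr_ge0 // ltW.
pose rho := 1 - tau.
have rho0 : 0 < rho by rewrite subr_gt0.
have rho1 : rho < 1 by rewrite /rho ltrBlDr ltrDl.
have Lk k : weighted_lip F be (rho ^+ k * c0) (iter (k * m.+1) P phi).
  elim: k => [|k IH]; first by rewrite expr0 mul1r.
  rewrite mulSn iterD exprS -mulrA.
  apply: (contraction mT F0 be0 al0 al1 TF min far near) => //.
  by rewrite mulr_gt0 // exprn_gt0.
(* bounds the weight 2 + be (F y + F x) averaged over y, any number of steps
   after x *)
pose H x := 2 + be * (F x + K' + F x).
have H0 x : 0 < H x by rewrite ltr_wpDr // mulr_ge0 ?(ltW be0) // !addr_ge0.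
have diff k j x :
  `|iter (j + k * m.+1) P phi x - iter (k * m.+1) P phi x|
    <= rho ^+ k * c0 * H x.
  rewrite iterD; set a := iter (k * m.+1) P phi.
  have mj := markov_op_iter j mP.
  have Hj : 2 + be * (iter j P F x + F x) <= H x.
    rewrite lerD2l ler_wpM2l ?(ltW be0) // lerD2r.
    exact: drift_iter_bound.
  have rc : 0 <= rho ^+ k * c0 by rewrite mulr_ge0 ?exprn_ge0 // ltW.
  have Hj2 : rho ^+ k * c0 * (2 + be * (iter j P F x + F x))
    <= rho ^+ k * c0 * H x by rewrite ler_wpM2l.
  rewrite ler_norml; apply/andP; split.
    rewrite lerNl opprB; apply: le_trans Hj2.
    rewrite -[a x](mo_cstx mj _ x) -(moB mj).
    have -> : rho ^+ k * c0 * (2 + be * (iter j P F x + F x)) =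
      iter j P (fun u => rho ^+ k * c0 * (2 + be * F x)
        + rho ^+ k * c0 * be * F u) x.
      by rewrite (moD mj) (mo_cst mj) (moZ mj); ring.
    by apply: (mo_le mj) => u; have := Lk k x u; rewrite -/a; lra.
  apply: le_trans Hj2.
  rewrite -[a x](mo_cstx mj _ x) -(moB mj).
  have -> : rho ^+ k * c0 * (2 + be * (iter j P F x + F x)) =
    iter j P (fun u => rho ^+ k * c0 * (2 + be * F x)
      + rho ^+ k * c0 * be * F u) x.
    by rewrite (moD mj) (mo_cst mj) (moZ mj); ring.
  by apply: (mo_le mj) => u; have := Lk k u x; rewrite -/a; lra.
have geo (A e : R) : 0 < e -> exists k, rho ^+ k * A < e.
  move=> e0.
  have : rho ^+ k * A @[k --> \oo] --> 0 * A.
    apply: cvgM; last exact: cvg_cst.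
    by apply: cvg_expr; rewrite ger0_norm // ltW.
  rewrite mul0r => /cvgr_lt h; have [N _ hN] := h _ e0.
  by exists N; apply: hN => /=.
have cv x : cvg (iter t P phi x @[t --> \oo]).
  apply: cauchy_cvg; apply: cauchy_exP => e e0.
  have [k hk] := geo (c0 * H x) e e0.
  exists (iter (k * m.+1) P phi x).
  exists (k * m.+1)%N => // s /= ms.
  rewrite /ball /= -(subnK ms) distrC.
  by apply: le_lt_trans (diff k _ x) _; rewrite -mulrA.
have [z0 _] : exists z0 : E, True by exists z.
exists (lim (iter t P phi z0 @[t --> \oo])) => x.
have -> : lim (iter t P phi z0 @[t --> \oo])
  = lim (iter t P phi x @[t --> \oo]).
  apply/eqP; rewrite -subr_eq0 -normr_le0; apply/ler_addgt0Pr => e e0.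
  rewrite add0r.
  have -> : lim (iter t P phi z0 @[t --> \oo]) -
      lim (iter t P phi x @[t --> \oo]) =
      lim ((iter t P phi z0 - iter t P phi x) @[t --> \oo]).
    by apply/esym/cvg_lim => //; apply: cvgB; exact: cv.
  have e3 : 0 < e / 3 by rewrite divr_gt0.
  have [k1 hk1] := geo (c0 * H x) _ e3.
  have [k2 hk2] := geo (c0 * H z0) _ e3.
  have [k3 hk3] := geo (c0 * (2 + be * (F z0 + F x))) _ e3.
  pose k := maxn k1 (maxn k2 k3).
  have up (A : R) k' : 0 <= A -> (k' <= k)%N -> rho ^+ k' * A < e / 3 ->
      rho ^+ k * A < e / 3.
    move=> A0 kk; apply: le_lt_trans; rewrite ler_wpM2r //.
    by rewrite ler_wiXn2l // ltW.
  have h1 := up _ k1 _ _ hk1.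
  have h2 := up _ k2 _ _ hk2.
  have h3 := up _ k3 _ _ hk3.
  rewrite -lim_norm; last by apply: is_cvgB; exact: cv.
  apply: limr_le; first by apply: is_cvg_norm; apply: is_cvgB; exact: cv.
  exists (k * m.+1)%N => // s /= ms.
  rewrite -(subnK ms).
  have d1 := diff k (s - k * m.+1)%N x.
  have d2 := diff k (s - k * m.+1)%N z0.
  have d3 := Lk k x z0.
  have d4 := Lk k z0 x.
  move: d1 d2; set a := iter (_ + _) P phi; set b := iter _ P phi in d3 d4 *.
  move=> d1 d2.
  have {}h1 : rho ^+ k * (c0 * H x) < e / 3.
    by apply: h1; rewrite ?leq_maxl // mulr_ge0 // ltW.
  have {}h2 : rho ^+ k * (c0 * H z0) < e / 3.
    by apply: h2; rewrite ?mulr_ge0 // ?ltW // /k maxnCA leq_maxl.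
  have {}h3 : rho ^+ k * (c0 * (2 + be * (F z0 + F x))) < e / 3.
    apply: h3; first by rewrite mulr_ge0 ?addr_ge0 ?mulr_ge0 ?addr_ge0 // ltW.
    by rewrite /k maxnA leq_maxr.
  rewrite -!mulrA in d1 d2 d3 d4.
  rewrite (addrC (F x)) in d3.
  move: d1 d2; rewrite !ler_norml => /andP[d1 d1'] /andP[d2 d2'].
  apply/andP; split; lra.
exact: cv.
Qed.

End harris.

(** * Kernels with finitely many successors *)

(** The explicit finite list of successors makes the transition operator a
    finite sum, defined on all functions without any growth or integrability
    condition. *)
Record finsupp_kernel (R : realType) (E : countType) := FinsuppKernel {
  fk_p :> E -> E -> R;
  fk_succ : E -> seq E;
  fk_uniq : forall x, uniq (fk_succ x);
  fk_ge0 : forall x y, 0 <= fk_p x y;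
  fk_supp : forall x y, fk_p x y != 0 -> y \in fk_succ x;
  fk_sum1 : forall x, \sum_(y <- fk_succ x) fk_p x y = 1
}.

Section step.
Context (R : realType) (E : countType) (k : finsupp_kernel R E).

Definition step (phi : E -> R) : E -> R :=
  fun x => \sum_(y <- fk_succ k x) k x y * phi y.

Lemma step_markov : markov_op step.
Proof.
split=> [a b f g|f f0 x|].
- apply/funext => x; rewrite /step !big_distrr -big_split /=.
  by apply: eq_bigr => y _; ring.
- by apply: sumr_ge0 => y _; rewrite mulr_ge0 // fk_ge0.
- apply/funext => x; rewrite -[RHS](fk_sum1 k x).
  by apply: eq_bigr => y _; rewrite mulr1.
Qed.

(** Inequalities such as bounds on the jumps hold only along transitions of
    positive probability. *)
Lemma step_le_supp f g x : (forall y, 0 < k x y -> f y <= g y) ->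
  step f x <= step g x.
Proof.
move=> fg; apply: ler_sum => y _.
have := fk_ge0 k x y; rewrite le_eqVlt => /predU1P[<-|pxy].
  by rewrite !mul0r.
by rewrite ler_pM2l // fg.
Qed.

End step.

(** * From quadratic to exponential drift *)

Lemma expR_quadratic (R : realType) (z : R) :
  z <= 1 / 2 -> expR z <= 1 + z + 2 * z ^+ 2.
Proof.
move=> z2; have z1 : 0 < 1 - z by lra.
have h : 1 - z <= expR (- z) by exact: expR_ge1Dx.
rewrite -[z in leLHS]opprK expRN.
apply: (@le_trans _ _ (1 - z)^-1).
  by rewrite lef_pV2 // posrE expR_gt0.
rewrite -[leLHS]mul1r ler_pdivrMr //.
have : 0 <= z ^+ 2 * (1 - 2 * z) by rewrite mulr_ge0 ?sqr_ge0 //; lra.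
lra.
Qed.

(** While N is bounded the claim is trivial. If D is above a fixed fraction of
    N, then exp (eta N) is dominated by exp (theta D), as theta is the right
    multiple of eta. Otherwise N^2 has negative drift, and a second order
    expansion gives exp (eta N) a factor below 1 for small eta. The function
    exp (theta D) contracts because D is reset with probability at least delta
    and theta times its growth is small; weighted by A, this pays for the
    second case. The constants are fixed before the kernel, so they are
    uniform over all chains with the same bounds. *)
Lemma exp_drift (R : realType) (C1 c C C3 delta : R)
    (C10 : 0 < C1) (c0 : 0 < c) (C0 : 0 <= C) (C30 : 0 < C3)
    (d0 : 0 < delta) (d1 : delta <= 1) : exists eta theta A g K : R,
  [/\ 0 < eta, 0 < theta, 0 <= A, 0 <= g < 1 & 0 <= K] /\
  forall (E : countType) (k : finsupp_kernel R E) (N D : E -> R),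
  (forall x, 0 <= N x) -> (forall x, 0 <= D x) ->
  (forall x y, 0 < k x y -> `|N y - N x| <= C1) ->
  (forall x, step k (fun y => N y ^+ 2) x <= N x ^+ 2 - c * N x + 2 * D x + C) ->
  (forall x y, 0 < k x y -> D y <= D x + C3) ->
  (forall x, delta <= step k (fun y => (D y == 0)%:R) x) ->
  let F y := expR (eta * N y) + A * expR (theta * D y) in
  forall x, step k F x <= g * F x + K.
Proof.
have [eta [eta0 e1 e2 e3 e4]] : exists eta : R, [/\ 0 < eta,
    eta * C1 <= 1 / 2, 16 * (eta * C1 ^+ 2) <= c, eta * c <= 4
    & 8 * eta / c * C3 <= delta / 4].
  (* the four bounds: validity of the quadratic expansion on a jump; the
     second order term is at most half of the first order gain; the rate
     stays in [0, 1); the growth of theta D is small against delta *)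
  pose b1 := (2 * C1)^-1; pose b2 := c / (16 * C1 ^+ 2).
  pose b3 := 4 / c; pose b4 := delta * c / (32 * C3).
  exists (Num.min (Num.min b1 b2) (Num.min b3 b4)).
  set eta := Num.min _ _.
  have h1 : eta <= b1 by rewrite !ge_min lexx.
  have h2 : eta <= b2 by rewrite !ge_min lexx orbT.
  have h3 : eta <= b3 by rewrite !ge_min lexx !orbT.
  have h4 : eta <= b4 by rewrite !ge_min lexx !orbT.
  have C12 : 0 < C1 ^+ 2 by rewrite exprn_gt0.
  have eta0 : 0 < eta.
    rewrite !lt_min invr_gt0 !divr_gt0 ?mulr_gt0 //.
  clearbody eta; split => //.
  - by move: h1; rewrite /b1 -[leRHS]mul1r ler_pdivlMr ?mulr_gt0 //; lra.
  - by move: h2; rewrite /b2 ler_pdivlMr ?mulr_gt0 //; lra.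
  - by move: h3; rewrite /b3 ler_pdivlMr.
  - move: h4; rewrite /b4 ler_pdivlMr ?mulr_gt0 // => h4.
    by rewrite mulrAC ler_pdivrMr //; lra.
(* chosen so that D > c / 8 * N implies theta D > eta N *)
pose theta := 8 * eta / c.
have th0 : 0 < theta by rewrite divr_gt0 // mulr_gt0.
(* above D0 the constant C is at most c / 4 * N *)
pose D0 := 4 * C / c + 1.
have D00 : 0 < D0 by rewrite ltr_wpDl // divr_ge0 ?mulr_ge0 // ltW.
(* half of the contraction A * (delta / 2) of the second exponential absorbs
   the error exp (eta C1) of the first *)
pose A := 4 * expR (eta * C1) / delta.
have A0 : 0 < A by rewrite divr_gt0 // mulr_gt0 // expR_gt0.
pose g1 : R := 1 - eta * c / 8.
pose g2 : R := 1 - delta / 4.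
pose g : R := Num.max g1 g2.
exists eta, theta, A, g, (expR (eta * (D0 + C1)) + A).
have gE1 : g1 <= g by rewrite le_max lexx.
have gE2 : g2 <= g by rewrite le_max lexx orbT.
have ec0 : 0 < eta * c by rewrite mulr_gt0.
split.
  split => //; first exact: ltW.
    have g20 : 0 <= 1 - delta / 4 by lra.
    have g11 : 1 - eta * c / 8 < 1 by lra.
    have g21 : 1 - delta / 4 < 1 by lra.
    rewrite gt_max; apply/andP; split; first exact: le_trans gE2.
    by apply/andP; split.
  by rewrite addr_ge0 ?expR_ge0 // ltW.
move=> E k N D N0 DD0 NJ NV DJ Dd F x.
have mk := step_markov k.
have hN : step k (fun y => expR (eta * N y)) x <=
    g1 * expR (eta * N x) + expR (eta * (D0 + C1))
      + expR (eta * C1) * expR (theta * D x).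
  have p1 : 0 <= g1 * expR (eta * N x).
    by rewrite mulr_ge0 ?expR_ge0 // /g1; lra.
  have p2 : 0 <= expR (eta * (D0 + C1)) by exact: expR_ge0.
  have p3 : 0 <= expR (eta * C1) * expR (theta * D x).
    by rewrite mulr_ge0 // expR_ge0.
  have up : step k (fun y => expR (eta * N y)) x <= expR (eta * (N x + C1)).
    rewrite -(mo_cstx mk (expR (eta * (N x + C1))) x).
    apply: step_le_supp => y /NJ; rewrite ler_norml => /andP[_ h].
    by rewrite ler_expR ler_wpM2l ?(ltW eta0) //; lra.
  have [ND|ND] := ltP (N x) D0.
    have : step k (fun y => expR (eta * N y)) x <= expR (eta * (D0 + C1)).
      apply: le_trans up _; rewrite ler_expR ler_wpM2l ?(ltW eta0) //; lra.
    lra.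
  have [DN|DN] := ltP (c / 8 * N x) (D x).
    have : step k (fun y => expR (eta * N y)) x
        <= expR (eta * C1) * expR (theta * D x).
      apply: le_trans up _; rewrite -expRD ler_expR mulrDr addrC lerD2l.
      rewrite /theta [8 * eta]mulrC -!mulrA ler_wpM2l ?(ltW eta0) //.
      have -> : N x = 8 * (c^-1 * (c / 8 * N x)) by field; rewrite gt_eqF.
      rewrite ler_wpM2l // ler_wpM2l //; first by rewrite invr_ge0 ltW.
      exact: ltW.
    lra.
  have Nx0 : 0 < N x by apply: lt_le_trans ND.
  suff : step k (fun y => expR (eta * N y)) x <= g1 * expR (eta * N x) by lra.
  (* N y - N x is at most (N y^2 - N x^2) / (2 N x), which is linear in the
     quantity whose drift is known *)
  pose Q y := 1 + eta * ((N y ^+ 2 - N x ^+ 2) / (2 * N x))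
     + 2 * (eta * C1) ^+ 2.
  have : step k (fun y => expR (eta * N y)) x <=
      step k (fun y => expR (eta * N x) * Q y) x.
    apply: step_le_supp => y /NJ; rewrite ler_norml => /andP[h1 h2].
    have -> : eta * N y = eta * N x + eta * (N y - N x) by ring.
    rewrite expRD ler_wpM2l ?expR_ge0 //.
    apply: le_trans (expR_quadratic _) _.
      by apply: le_trans e1; rewrite ler_wpM2l ?(ltW eta0).
    rewrite /Q; apply: lerD.
      rewrite lerD2l ler_wpM2l ?(ltW eta0) // ler_pdivlMr ?mulr_gt0 //.
      by have := sqr_ge0 (N y - N x); lra.
    rewrite ler_wpM2l // !exprMn ler_wpM2l ?sqr_ge0 //.
    rewrite -ler_sqrt ?exprn_ge0 ?(ltW C10) // !sqrtr_sqr.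
    by rewrite (ger0_norm (ltW C10)) ler_norml; apply/andP; split; lra.
  move=> /le_trans; apply.
  rewrite (moZ mk) mulrC ler_wpM2r ?expR_ge0 //.
  have -> : step k Q x = 1 + 2 * (eta * C1) ^+ 2
      + eta / (2 * N x) * (step k (fun y => N y ^+ 2) x - N x ^+ 2).
    rewrite -[X in _ - X](mo_cstx mk _ x) -(moB mk) -(moZ mk).
    rewrite -[X in X + _](mo_cstx mk _ x) -(moD mk).
    by congr (step k _ _); apply/funext => y; rewrite /Q; field; rewrite gt_eqF.
  have h1 : step k (fun y => N y ^+ 2) x - N x ^+ 2 <= - (c / 2) * N x.
    have := NV x.
    have : 4 * C <= c * N x.
      have : 4 * C / c <= N x by apply: le_trans ND; rewrite lerDl.
      by rewrite ler_pdivrMr // [N x * _]mulrC.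
    lra.
  have h2 : eta / (2 * N x) * (step k (fun y => N y ^+ 2) x - N x ^+ 2)
      <= - (eta * c / 4).
    have -> : - (eta * c / 4) = eta / (2 * N x) * (- (c / 2) * N x).
      by field; rewrite gt_eqF.
    by rewrite ler_wpM2l // divr_ge0 ?mulr_ge0 ?(ltW eta0).
  have h3 : 2 * (eta * C1) ^+ 2 <= eta * c / 8.
    have : eta * (16 * (eta * C1 ^+ 2)) <= eta * c by rewrite (ler_wpM2l (ltW eta0)).
    by rewrite exprMn; lra.
  by rewrite /g1; lra.
have hD : step k (fun y => expR (theta * D y)) x
    <= 1 + (1 - delta / 2) * expR (theta * D x).
  have : step k (fun y => expR (theta * D y)) x <=
      step k (fun y => 1 + expR (theta * (D x + C3)) * (1 - (D y == 0)%:R)) x.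
    apply: step_le_supp => y /DJ h.
    case: eqP => [->|_].
      by rewrite mulr0 expR0 subrr mulr0 addr0.
    rewrite subr0 mulr1 ler_wpDl // ler_expR ler_wpM2l ?(ltW th0) //.
  move=> /le_trans; apply.
  rewrite (moD mk) (moZ mk) (moB mk) !(mo_cstx mk) lerD2l.
  (* so that (1 + delta / 2) (1 - delta) <= 1 - delta / 2 is the contraction
     factor *)
  have e5 : expR (theta * C3) <= 1 + delta / 2.
    have t1 : theta * C3 <= 1 / 2 by apply: le_trans e4 _; lra.
    have t0 : 0 <= theta * C3 by rewrite mulr_ge0 ?ltW.
    apply: le_trans (expR_quadratic t1) _.
    have : theta * C3 * (theta * C3) <= theta * C3 * (1 / 2).
      by rewrite ler_wpM2l.
    by rewrite -/theta in e4; rewrite expr2; lra.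
  rewrite [theta * (_ + _)]mulrDr expRD -mulrA mulrC ler_wpM2r ?expR_ge0 //.
  apply: (@le_trans _ _ ((1 + delta / 2) * (1 - delta))).
    apply: le_trans (ler_wpM2r _ e5); last by lra.
    by rewrite ler_wpM2l ?expR_ge0 // lerD2l lerN2 Dd.
  have : 0 <= delta * delta by rewrite mulr_ge0 ?ltW.
  lra.
rewrite /F (moD mk) (moZ mk).
have hD' := ler_wpM2l (ltW A0) hD.
have eA : expR (eta * C1) = A * (delta / 4).
  by rewrite /A; field; rewrite gt_eqF.
have q1 := ler_wpM2r (expR_ge0 (eta * N x)) gE1.
have q2 : g2 * (A * expR (theta * D x)) <= g * (A * expR (theta * D x)).
  by rewrite ler_wpM2r // mulr_ge0 ?expR_ge0 // ltW.
rewrite /g2 in q2.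
rewrite eA in hN.
lra.
Qed.

(** * The chain killed at a point *)

Lemma esum_seq (R : realType) (T : choiceType) (r : seq T) (f : T -> \bar R) :
  uniq r -> (forall i, (0 <= f i)%E) -> (forall i, i \notin r -> f i = 0%E) ->
  (\esum_(i in [set: T]) f i = \sum_(i <- r) f i)%E.
Proof.
move=> ur f0 fr; rewrite (esumID [set` r]) // !setTI.
rewrite [X in (_ + X)%E]esum1 => [|i /= /negP]; last exact: fr.
by rewrite adde0 esum_fset // -?fsbig_seq //; exact: finite_seq.
Qed.

Section taboo.
Context (R : realType) (E : countType) (k : finsupp_kernel R E).

Lemma step_esum (A : set E) (phi : E -> R) x : (forall y, 0 <= phi y) ->
  (\esum_(y in A) ((k x y)%:E * (phi y)%:E) =
   ((step k) (fun y => if y \in A then phi y else 0) x)%:E)%E.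
Proof.
move=> phi0; rewrite esum_mkcond (esum_seq (fk_uniq k x)).
- rewrite /step -sumEFin; apply: eq_bigr => y _.
  by case: ifPn; rewrite ?mulr0 ?EFinM.
- by move=> y; case: ifP; rewrite // -EFinM lee_fin mulr_ge0 // fk_ge0.
- move=> y; case: ifP => // _ yx.
  have [->|/fk_supp] := eqVneq (k x y) 0; first by rewrite mul0e.
  by rewrite (negPf yx).
Qed.

Definition point_ind (y : E) : E -> R := fun z => (z == y)%:R.

Lemma nstepE t x y : nstep k t x y = (iter t (step k) (point_ind y) x)%:E.
Proof.
elim: t x => [//|t IH] x /=.
under eq_esum do rewrite IH.
rewrite step_esum; last first.
  by move=> z; apply: (mo_ge0 (markov_op_iter t (step_markov k))) => u; rewrite ler0n.
by congr (step _ _ _)%:E; apply/funext => z; rewrite in_setT.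
Qed.

Lemma iter_point_ind_ge0 t y x : 0 <= iter t (step k) (point_ind y) x.
Proof.
by apply: (mo_ge0 (markov_op_iter t (step_markov k))) => u; rewrite ler0n.
Qed.

Lemma iter_ge_point_ind t z x psi : (forall y, 0 <= psi y) ->
  psi z * iter t (step k) (point_ind z) x <= iter t (step k) psi x.
Proof.
move=> psi0; have mt := markov_op_iter t (step_markov k).
rewrite -(moZ mt); apply: (mo_le mt) => y.
by rewrite /point_ind; case: eqP => [->|_]; rewrite ?mulr1 ?mulr0.
Qed.

Lemma iter_point_ind_comp s t x y z :
  iter s (step k) (point_ind y) x * iter t (step k) (point_ind z) y <=
  iter (s + t) (step k) (point_ind z) x.
Proof.
by rewrite iterD mulrC; apply: iter_ge_point_ind => u; exact: iter_point_ind_ge0.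
Qed.

(** The transition operator of the chain killed on entering z: its iterates on
    1 are the probabilities of not having met z yet. *)
Definition taboo (z : E) (phi : E -> R) : E -> R :=
  (step k) (fun y => if y == z then 0 else phi y).

Variable z : E.

Lemma taboo_lin a b f g x :
  taboo z (fun y => a * f y + b * g y) x = a * taboo z f x + b * taboo z g x.
Proof.
rewrite /taboo; have -> : (fun y => if y == z then 0 else a * f y + b * g y) =
    (fun y => a * (if y == z then 0 else f y) + b * (if y == z then 0 else g y)).
  by apply/funext => y; case: ifP => // _; rewrite !mulr0 addr0.
by rewrite (mo_lin (step_markov k)).
Qed.

Lemma tabooD f g x : taboo z (fun y => f y + g y) x = taboo z f x + taboo z g x.
Proof.
rewrite -[taboo z f x]mul1r -[taboo z g x]mul1r -taboo_lin.
by congr (taboo _ _ _); apply/funext => y; rewrite !mul1r.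
Qed.

Lemma tabooZ a f x : taboo z (fun y => a * f y) x = a * taboo z f x.
Proof.
rewrite -[RHS]addr0 -[X in _ + X](mul0r (taboo z f x)) -taboo_lin.
by congr (taboo _ _ _); apply/funext => y; rewrite mul0r addr0.
Qed.

Lemma taboo_le f g x : (forall y, f y <= g y) -> taboo z f x <= taboo z g x.
Proof.
by move=> fg; apply: (mo_le (step_markov k)) => y; case: ifP.
Qed.

Lemma taboo_ge0 f x : (forall y, 0 <= f y) -> 0 <= taboo z f x.
Proof.
by move=> f0; apply: (mo_ge0 (step_markov k)) => y; case: ifP.
Qed.

Lemma taboo_le_step f x : (forall y, 0 <= f y) -> taboo z f x <= (step k) f x.
Proof.
by move=> f0; apply: (mo_le (step_markov k)) => y; case: ifP.
Qed.

Lemma iter_taboo_lin t a b f g x :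
  iter t (taboo z) (fun y => a * f y + b * g y) x =
  a * iter t (taboo z) f x + b * iter t (taboo z) g x.
Proof.
elim: t x => [//|t IH] x /=.
by rewrite -taboo_lin; congr (taboo _ _ _); apply/funext.
Qed.

Lemma iter_taboo_ge0 t f x : (forall y, 0 <= f y) ->
  0 <= iter t (taboo z) f x.
Proof.
by move=> f0; elim: t x => [//|t IH] x /=; apply: taboo_ge0.
Qed.

Lemma iter_taboo_le_step t f x : (forall y, 0 <= f y) ->
  iter t (taboo z) f x <= iter t (step k) f x.
Proof.
move=> f0; elim: t x => [//|t IH] x /=.
apply: le_trans (taboo_le x IH) _; apply: taboo_le_step => y.
exact: (mo_ge0 (markov_op_iter t (step_markov k))).
Qed.

(** To avoid z during t.+1 steps one must in particular not be at z at the
    end; this turns a lower bound for reaching z at one prescribed time into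
    an upper bound for survival. *)
Lemma iter_taboo_miss t x :
  iter t.+1 (taboo z) (fun=> 1) x <= 1 - iter t.+1 (step k) (point_ind z) x.
Proof.
have mt j := markov_op_iter j (step_markov k).
elim: t x => [|t IH] x.
  rewrite /= -[X in X - _](mo_cstx (step_markov k) _ x) -(moB (step_markov k)).
  apply: (mo_le (step_markov k)) => y.
  by rewrite /point_ind; case: eqP => _; rewrite ?subrr ?subr0.
rewrite iterS [iter t.+2 (step k) _]iterS.
rewrite -[X in X - _](mo_cstx (step_markov k) _ x) -(moB (step_markov k)).
apply: le_trans (taboo_le x IH) _; apply: taboo_le_step => y.
rewrite subr_ge0 -[X in _ <= X](mo_cstx (mt t.+1) _ y).
by apply: (mo_le (mt t.+1)) => u; rewrite /point_ind; case: eqP; rewrite ?ler01.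
Qed.

(** A first visit survives the killing until the step that enters z. *)
Lemma first_hitE t x :
  first_hit k t x z = (iter t (taboo z) (fun y => k y z) x)%:E.
Proof.
elim: t x => [//|t IH] x /=.
under eq_esum do rewrite IH.
rewrite step_esum; last by move=> y; apply: iter_taboo_ge0 => u; exact: fk_ge0.
congr (step _ _ _)%:E; apply/funext => y.
case: eqP => yz; first by rewrite memNset //= => /(_ yz).
by rewrite mem_set.
Qed.

Lemma taboo1 x : k x z = 1 - taboo z (fun=> 1) x.
Proof.
rewrite -[X in X - _](mo_cstx (step_markov k) _ x) -(moB (step_markov k)).
rewrite (_ : (fun y => _) = point_ind z); last first.
  by apply/funext => y; rewrite /point_ind; case: eqP => _; rewrite ?subrr ?subr0.
rewrite /step; have [zx|zx] := boolP (z \in fk_succ k x).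
  rewrite (bigD1_seq z) ?fk_uniq //= /point_ind eqxx mulr1 big1 ?addr0 //.
  by move=> y /negPf ->; rewrite mulr0.
rewrite big1_seq => [|y /= yx].
  by apply/eqP; apply: contraNT zx => /fk_supp.
rewrite /point_ind; case: eqP => [yz|]; last by rewrite mulr0.
by rewrite -yz yx in zx.
Qed.

End taboo.

(** * Positive recurrence *)

Section recurrence.
Context (R : realType) (E : countType) (k : finsupp_kernel R E).
Variables (F : E -> R) (g K : R).
Hypotheses (g0 : 0 <= g) (g1 : g < 1) (K0 : 0 <= K).
Hypothesis F0 : forall x, 0 <= F x.
Hypothesis PF : forall x, step k F x <= g * F x + K.
Hypothesis reach : forall z Rr, exists m (alpha : R), 0 < alpha /\
  forall x, F x <= Rr -> alpha <= iter m.+1 (step k) (point_ind R z) x.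

(** The killed operator contracts W = 1 + beta F over m.+1 steps: for large F
    by the drift, for small F because the chain is at z after m.+1 steps with
    probability at least alpha. Then U, the sum of the first m.+1 iterates of
    W, decreases by at least tau W, hence by at least tau, at each step, so U
    / tau bounds the expected number of steps before z is met. *)
Lemma survival_bound z : exists U : E -> R, forall n x,
  \sum_(j < n) iter j (taboo k z) (fun=> 1) x <= U x.
Proof.
have g1' : 0 < 1 - g by rewrite subr_gt0.
pose K' := K / (1 - g).
have K'0 : 0 <= K' by rewrite divr_ge0 // ltW.
have [Rr hRr] := contraction_constants g0 g1 K'0.
have [m [al' [al'0 hreach']]] := reach z Rr.
pose al := Num.min al' (1 / 2).
have al0 : 0 < al by rewrite lt_min al'0; apply/andP; split => //; lra.
have al1 : al < 1 by rewrite gt_min; apply/orP; right; lra.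
have hreach x : F x <= Rr -> al <= iter m.+1 (step k) (point_ind R z) x.
  by move=> /hreach'; apply: le_trans; rewrite ge_min lexx.
have [be [tau [be0 t0 t1 far near]]] := hRr _ al0 al1.
pose Q := taboo k z.
(* the factor 1 gives W the shape of a linear combination of two functions *)
pose W x := 1 * 1 + be * F x.
have W1 x : 1 <= W x by rewrite /W mul1r lerDl mulr_ge0 // ltW.
have QW x : iter m.+1 Q W x <= (1 - tau) * W x.
  rewrite /W iter_taboo_lin mul1r.
  have h1 : iter m.+1 Q F x <= g * F x + K'.
    apply: le_trans (@iter_taboo_le_step R E k z m.+1 F x F0) _.
    exact: (drift_iterS (step_markov k) g0 g1 K0 F0 PF).
  have h2 := ler_wpM2l (ltW be0) h1.
  have h3 := iter_taboo_miss k z m x.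
  (* the constants concern sums F x + F y; here y = x *)
  have [Fx|Fx] := leP Rr (2 * F x).
    have h4 := far _ Fx.
    have h5 : 0 <= iter m.+1 (step k) (point_ind R z) x by exact: iter_point_ind_ge0.
    rewrite -/Q in h3; lra.
  have Fx0 := F0 x.
  have h4 := near _ (mulr_ge0 (ler0n _ 2) Fx0).
  have h5 : al <= iter m.+1 (step k) (point_ind R z) x by apply: hreach; lra.
  rewrite -/Q in h3; lra.
pose U n x := \sum_(r < n) iter r Q W x.
have QU n x : Q (U n) x = U n x - W x + iter n Q W x.
  elim: n => [|n IH].
    have -> : U 0%N = fun y => 0 * W y.
      by apply/funext => y; rewrite /U big_ord0 mul0r.
    by rewrite /Q tabooZ /= !mul0r sub0r addNr.
  have -> : U n.+1 = fun y => U n y + iter n Q W y.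
    by apply/funext => y; rewrite /U big_ord_recr.
  rewrite /Q tabooD -/Q IH /=; ring.
have W0 x : 0 <= W x by apply: le_trans (W1 x); exact: ler01.
exists (fun x => tau^-1 * U m.+1 x) => n x.
elim: n x => [|n IH] x.
  rewrite big_ord0 mulr_ge0 ?invr_ge0 ?(ltW t0) //.
  by apply: sumr_ge0 => r _; exact: iter_taboo_ge0.
rewrite big_ord_recl /=.
have -> : \sum_(i < n) iter (bump 0 i) (taboo k z) (fun=> 1) x =
   taboo k z (fun y => \sum_(i < n) iter i (taboo k z) (fun=> 1) y) x.
  elim: n {IH} => [|n IH].
    rewrite big_ord0.
    have -> : (fun y => \sum_(i < 0) iter i (taboo k z) (fun=> 1 : R) y) =
        (fun y => 0 * (0 : R)).
      by apply/funext => y; rewrite big_ord0 mul0r.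
    by rewrite tabooZ mul0r.
  rewrite big_ord_recr /= IH -tabooD; congr (taboo _ _ _ _).
  by apply/funext => y; rewrite big_ord_recr.
apply: le_trans (lerD (lexx _) (taboo_le k z x IH)) _.
rewrite tabooZ -/Q QU.
have h1 := QW x; have h2 := W1 x.
rewrite -(ler_pM2l t0) mulrDr mulr1 !mulrA divff ?gt_eqF // !mul1r.
have : tau * 1 <= tau * W x by rewrite ler_wpM2l ?(ltW t0).
lra.
Qed.

(** With h j the probability of not returning within j steps, a first return
    at time j.+1 has probability h j - h j.+1. Summability of h gives h --> 0,
    that is a certain return, and summation by parts bounds the mean return
    time by the sum of h. *)
Theorem drift_positive_recurrent : positive_recurrent k.
Proof.
move=> z; have [U hU] := survival_bound z.
pose h j := iter j (taboo k z) (fun=> 1) z.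
have fhE j : first_hit k j z z = (h j - h j.+1)%:E.
  rewrite first_hitE; congr (_)%:E.
  have -> : (fun y => k y z) = (fun y => 1 * 1 + (-1) * taboo k z (fun=> 1) y).
    by apply/funext => y; rewrite taboo1; ring.
  by rewrite iter_taboo_lin -iterSr /h; ring.
have h0 j : 0 <= h j by apply: iter_taboo_ge0 => _; exact: ler01.
have fh0 j : 0 <= h j - h j.+1.
  by rewrite -lee_fin -fhE first_hitE lee_fin; apply: iter_taboo_ge0 => y; exact: fk_ge0.
have hS n : \sum_(0 <= j < n) h j <= U z by rewrite big_mkord; exact: hU.
have hcv : h n @[n --> \oo] --> 0.
  apply: cvg_series_cvg_0; apply: nondecreasing_is_cvgn.
    apply/nondecreasing_seqP => n.
    by rewrite /series /= big_nat_recr //= lerDl.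
  by exists (U z) => _ [n _ <-]; rewrite /series /=.
have tele n : \sum_(0 <= j < n) j.+1%:R * (h j - h j.+1) =
     \sum_(0 <= j < n) h j - n%:R * h n.
  elim: n => [|n IH]; first by rewrite !big_geq // mul0r subrr.
  rewrite !big_nat_recr //= IH -!(natr1 n); ring.
split.
- have -> : (fun n => \sum_(0 <= j < n) first_hit k j z z)%E =
     (fun n => (1 - h n)%:E).
    apply/funext => n; under eq_bigr do rewrite fhE.
    rewrite sumEFin; congr (_)%:E.
    elim: n => [|n IH]; first by rewrite big_geq // /h /= subrr.
    by rewrite big_nat_recr //= IH; ring.
  apply/cvg_lim => //; apply/cvg_EFin; first by near=> n.
  rewrite -[X in _ --> X]subr0.
  by apply: cvgB => //; exact: cvg_cst.
- apply: (@le_lt_trans _ _ (U z)%:E); last exact: ltry.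
  apply: lime_le.
    apply: is_cvg_nneseries => n _ _; rewrite fhE -EFinM lee_fin.
    by rewrite mulr_ge0.
  near=> n.
  under eq_bigr do rewrite fhE -EFinM.
  rewrite sumEFin lee_fin.
  rewrite tele.
  by rewrite lerBlDr; apply: le_trans (hS n) _; rewrite lerDl mulr_ge0.
Unshelve. all: by end_near. Qed.

End recurrence.

(** * Aperiodicity *)

(** The smallest positive difference d of two elements divides every element,
    since a remainder modulo d would be a smaller such difference; so d = 1,
    and S contains two consecutive numbers a and a + 1, which generate
    everything from a * a on. *)
Lemma numerical_semigroup (S : nat -> Prop) :
  S 0%N -> (forall a b, S a -> S b -> S (a + b)%N) ->
  (forall m, (forall k, (0 < k)%N -> S k -> (m %| k)%N) -> m = 1%N) ->
  exists L, forall l, (L <= l)%N -> S l.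
Proof.
move=> S0 SD S1.
have SM c a : S a -> S (c * a)%N.
  by move=> Sa; elim: c => [//|c IH]; rewrite mulSn; exact: SD.
(* the positive differences of two elements *)
pose gap d := `[< (0 < d)%N /\ exists2 a, S a & S (a + d)%N >].
have exgap : exists d, gap d.
  have [k k0 Sk] : exists2 k, (0 < k)%N & S k.
    apply: contrapT => h.
    suff : 2 = 1%N by [].
    by apply: S1 => k k0 Sk; exfalso; apply: h; exists k.
  by exists k; apply/asboolP; split => //; exists 0%N.
case: (ex_minnP exgap) => d /asboolP[d0 [a Sa Sad]] dmin.
have dd : d = 1%N.
  apply: S1 => k k0 Sk; rewrite /dvdn; apply/eqP/eqP; apply/negPn/negP => r0.
  have rd : (k %% d < d)%N by rewrite ltn_mod.
  have : gap (k %% d)%N.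
    apply/asboolP; split; first by rewrite lt0n.
    exists (k %/ d * (a + d))%N; first exact: SM.
    rewrite mulnDr -addnA -divn_eq; apply: SD => //; exact: SM.
  by move=> /dmin; rewrite leqNgt rd.
rewrite {}dd in Sad.
exists (a * a)%N => l al.
case: (posnP a) => [a0|a0].
  by rewrite -[l]muln1; apply: SM; rewrite a0 in Sad.
have va : (l %% a < a)%N by rewrite ltn_mod.
have ua : (a <= l %/ a)%N by rewrite leq_divRL.
have -> : l = ((l %/ a - l %% a) * a + (l %% a) * (a + 1))%N.
  rewrite {1}(divn_eq l a); move: (l %/ a)%N (l %% a)%N va ua => u v va ua.
  rewrite mulnDr muln1 addnA -mulnDl subnK //.
  by apply: leq_trans ua; exact: ltnW.
by apply: SD; exact: SM.
Qed.

Section reach.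
Context (R : realType) (E : countType) (k : finsupp_kernel R E).
Hypotheses (irr : irreducible k) (aper : aperiodic k).

(** The possible return times to z form a numerical semigroup. *)
Lemma eventually_positive (C : seq E) (z : E) : exists M, forall m, (M <= m)%N ->
  forall x, x \in C -> 0 < iter m (step k) (point_ind R z) x.
Proof.
have [L hL] : exists L, forall l, (L <= l)%N -> 0 < iter l (step k) (point_ind R z) z.
  apply: numerical_semigroup.
  - by rewrite /= /point_ind eqxx ltr01.
  - move=> a b ha hb; apply: lt_le_trans (iter_point_ind_comp k a b z z z).
    exact: mulr_gt0.
  - move=> m hm; apply: (aper (x := z)) => j j0.
    by rewrite nstepE lte_fin; exact: hm.
elim: C => [|x C [M hM]]; first by exists 0%N.
have [j hj] := irr x z; rewrite nstepE lte_fin in hj.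
exists (maxn M (j + L)) => m; rewrite geq_max => /andP[Mm jm] y.
rewrite inE => /predU1P[->|]; last exact: hM.
have jm' : (j <= m)%N by apply: leq_trans jm; rewrite leq_addr.
rewrite -(subnKC jm'); apply: lt_le_trans (iter_point_ind_comp k j (m - j) x z z).
by rewrite mulr_gt0 // hL // leq_subRL.
Qed.

(** A common time and a positive lower bound exist because the sublevel sets
    are finite. *)
Lemma sublevel_reach (F : E -> R) :
  (forall r, finite_set [set x | F x <= r]) ->
  forall z r, exists m (alpha : R), 0 < alpha /\
    forall x, F x <= r -> alpha <= iter m.+1 (step k) (point_ind R z) x.
Proof.
move=> Ffin z r.
have /finite_seqP[C hC] := Ffin r.
have [M hM] := eventually_positive C z.
exists M.
have [al [al0 hal]] : exists al : R, 0 < al /\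
    forall x, x \in C -> al <= iter M.+1 (step k) (point_ind R z) x.
  have : forall x, x \in C -> 0 < iter M.+1 (step k) (point_ind R z) x by exact: hM.
  elim: C {hC hM} => [|x C IH] pos; first by exists 1; split.
  have [y yC|al [al0 hal]] := IH _; first by rewrite pos // inE yC orbT.
  exists (Num.min al (iter M.+1 (step k) (point_ind R z) x)); split.
    by rewrite lt_min al0 pos // mem_head.
  move=> y; rewrite inE => /predU1P[->|/hal]; first by rewrite ge_min lexx orbT.
  by apply: le_trans; rewrite ge_min lexx.
exists al; split => // x Fx; apply: hal.
have : [set x | F x <= r] x by [].
by rewrite hC.
Qed.

End reach.

(** * Frobenius geometry *)

Section frobenius.
Context (R : realType) (n : nat).
Implicit Types x y z : 'M[R]_n.

Lemma frob_innerC x y : frob_inner x y = frob_inner y x.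
Proof.
by apply: eq_bigr => i _; apply: eq_bigr => j _; rewrite mulrC.
Qed.

Lemma frob_inner_lin a b x y z :
  frob_inner (a *: x + b *: y) z = a * frob_inner x z + b * frob_inner y z.
Proof.
rewrite /frob_inner !big_distrr -big_split /=; apply: eq_bigr => i _.
rewrite !big_distrr -big_split /=; apply: eq_bigr => j _.
by rewrite !mxE; ring.
Qed.

Lemma frob_innerDl x y z :
  frob_inner (x + y) z = frob_inner x z + frob_inner y z.
Proof. by rewrite -[x]scale1r -[y]scale1r frob_inner_lin !mul1r !scale1r. Qed.

Lemma frob_innerZl a x z : frob_inner (a *: x) z = a * frob_inner x z.
Proof.
by rewrite -[a *: x]addr0 -(scale0r x) frob_inner_lin mul0r addr0.
Qed.

Lemma frob_innerBl x y z :
  frob_inner (x - y) z = frob_inner x z - frob_inner y z.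
Proof. by rewrite frob_innerDl -scaleN1r frob_innerZl mulN1r. Qed.

Lemma frob_innerDr x y z :
  frob_inner z (x + y) = frob_inner z x + frob_inner z y.
Proof. by rewrite frob_innerC frob_innerDl !(frob_innerC z). Qed.

Lemma frob_innerBr x y z :
  frob_inner z (x - y) = frob_inner z x - frob_inner z y.
Proof. by rewrite frob_innerC frob_innerBl !(frob_innerC z). Qed.

Lemma frob_innerZr a x z : frob_inner z (a *: x) = a * frob_inner z x.
Proof. by rewrite frob_innerC frob_innerZl (frob_innerC z). Qed.

Lemma frob_inner_ge0 x y : (forall i j, 0 <= x i j) -> (forall i j, 0 <= y i j) ->
  0 <= frob_inner x y.
Proof.
by move=> x0 y0; do 2 (apply: sumr_ge0 => ? _); rewrite mulr_ge0.
Qed.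

Lemma frob_inner_self_ge0 x : 0 <= frob_inner x x.
Proof. by do 2 (apply: sumr_ge0 => ? _); rewrite -expr2 sqr_ge0. Qed.

Lemma frob_norm_ge0 x : 0 <= frob_norm x.
Proof. exact: sqrtr_ge0. Qed.

Lemma frob_norm_sqr x : frob_norm x ^+ 2 = frob_inner x x.
Proof. by rewrite sqr_sqrtr // frob_inner_self_ge0. Qed.

Lemma frob_norm_entry x i j : `|x i j| <= frob_norm x.
Proof.
rewrite -sqrtr_sqr ler_sqrt ?frob_inner_self_ge0 //.
rewrite /frob_inner (bigD1 i) //= (bigD1 j) //= -expr2 -addrA lerDl.
rewrite addr_ge0 //; first by apply: sumr_ge0 => ? _; rewrite -expr2 sqr_ge0.
by do 2 (apply: sumr_ge0 => ? _); rewrite -expr2 sqr_ge0.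
Qed.

Lemma frob_norm_le x b : 0 <= b -> (forall i j, `|x i j| <= b) ->
  frob_norm x <= n%:R * b.
Proof.
move=> b0 xb; rewrite -[leRHS]ger0_norm ?mulr_ge0 // -sqrtr_sqr.
rewrite ler_sqrt ?sqr_ge0 //.
have -> : (n%:R * b) ^+ 2 = \sum_(i < n) \sum_(j < n) b ^+ 2.
  rewrite !sumr_const card_ord -[RHS]mulr_natr -[X in _ = X * _]mulr_natr.
  by ring.
apply: ler_sum => i _; apply: ler_sum => j _.
by rewrite -expr2 -real_normK ?num_real // lerXn2r // nnegrE.
Qed.

Lemma frob_norm_eq0 x : frob_norm x = 0 -> x = 0.
Proof.
move=> x0; apply/matrixP => i j; rewrite mxE; apply/eqP.
by rewrite -normr_le0 -x0 frob_norm_entry.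
Qed.

Lemma frob_inner0l y : frob_inner 0 y = 0.
Proof. by rewrite -(scale0r 0) frob_innerZl mul0r. Qed.

Lemma frob_cauchy_schwarz x y : frob_inner x y <= frob_norm x * frob_norm y.
Proof.
have [->|x0] := eqVneq x 0.
  by rewrite frob_inner0l mulr_ge0 // frob_norm_ge0.
have [->|y0] := eqVneq y 0.
  by rewrite frob_innerC frob_inner0l mulr_ge0 // frob_norm_ge0.
have nx : 0 < frob_norm x.
  by rewrite lt_neqAle frob_norm_ge0 andbT eq_sym; apply: contraNneq x0 => /frob_norm_eq0 ->.
have ny : 0 < frob_norm y.
  by rewrite lt_neqAle frob_norm_ge0 andbT eq_sym; apply: contraNneq y0 => /frob_norm_eq0 ->.
have := frob_inner_self_ge0 (frob_norm y *: x - frob_norm x *: y).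
rewrite !(frob_innerBl, frob_innerBr, frob_innerZl, frob_innerZr).
rewrite -!frob_norm_sqr (frob_innerC y x) => h.
rewrite -(ler_pM2l (mulr_gt0 nx ny)); lra.
Qed.

Lemma frob_normD x y : frob_norm (x + y) <= frob_norm x + frob_norm y.
Proof.
rewrite -[leRHS]ger0_norm ?addr_ge0 ?frob_norm_ge0 // -sqrtr_sqr.
rewrite ler_sqrt ?sqr_ge0 // frob_innerDl !frob_innerDr -!frob_norm_sqr.
by have := frob_cauchy_schwarz x y; rewrite (frob_innerC y x); lra.
Qed.

Lemma frob_normN x : frob_norm (- x) = frob_norm x.
Proof.
rewrite /frob_norm; congr Num.sqrt.
by apply: eq_bigr => i _; apply: eq_bigr => j _; rewrite !mxE mulrNN.
Qed.

End frobenius.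

(** * The projection onto the cone *)

Section cone.
Context (R : realType) (n : nat).
Implicit Types x y z : 'M[R]_n.

(** The cone as the image of the orthant of row and column potentials;
    finitely many parameters make compactness available. *)
Definition cone_point (v : 'rV[R]_(n + n)) : 'M[R]_n :=
  \matrix_(i, j) (v ord0 (lshift n i) + v ord0 (rshift n j)).

(** Potentials are determined up to a constant shifted from rows to columns;
    shifting by the smallest row potential makes both nonnegative. *)
Lemma cone_pointP y : (0 < n)%N -> coneK y ->
  exists2 v, y = cone_point v & forall k, 0 <= v ord0 k.
Proof.
move=> n0 [[w [w' yE]] y0].
have [i0 _ wmin] := @arg_minP _ _ _ (Ordinal n0) xpredT w isT.
exists (\row_(k < n + n) (match fintype.split k with
  | inl i => w i - w i0 | inr j => w i0 + w' j end)).
  apply/matrixP => i j; rewrite !mxE.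
  rewrite (unsplitK (inl i)) (unsplitK (inr j)) yE; ring.
move=> k; rewrite mxE; case: (fintype.split k) => i.
  by rewrite subr_ge0 wmin.
by rewrite -yE.
Qed.

Lemma coneK0 : coneK (0 : 'M[R]_n).
Proof.
split=> [|i j]; last by rewrite mxE.
by exists (fun=> 0), (fun=> 0) => i j; rewrite mxE addr0.
Qed.

(** A nearest point exists. The squared distance is continuous in the
    potentials and attains its minimum on a compact box. Outside the box some
    entry exceeds twice the norm of x, and such a point is farther from x than
    the apex of the cone, which lies in the box. *)
Lemma proj_coneP x : (0 < n)%N -> coneK (proj_cone x) /\
  forall z, coneK z -> frob_norm (x - proj_cone x) <= frob_norm (x - z).
Proof.
move=> n0.
suff [y Ky] : exists y, coneK y /\
    forall z, coneK z -> frob_norm (x - y) <= frob_norm (x - z).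
  by rewrite /proj_cone; case: xgetP => [z _ []|/(_ y)].
pose B := 2 * frob_norm x.
have B0 : 0 <= B by rewrite mulr_ge0 // frob_norm_ge0.
pose A : set 'rV[R]_(n + n) := [set v | forall k, `[0, B]%classic (v ord0 k)].
have A0 : A 0 by move=> k /=; rewrite mxE in_itv /= lexx.
have cA : compact A.
  by apply: (@rV_compact _ _ (fun=> `[0, B]%classic)) => k; exact: segment_compact.
pose f v := \sum_i \sum_j (x i j - cone_point v i j) ^+ 2.
have cf : continuous f.
  apply: continuous_big => [|i _]; first exact: add_continuous.
  apply: continuous_big => [|j _ v]; first exact: add_continuous.
  have cc (k : 'I_(n + n)) : {for v, continuous (fun u : 'rV[R]_(n + n) => u ord0 k)}.
    exact: (@coord_continuous _ _ _ ord0 k v).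
  have -> : (fun u : 'rV[R]_(n + n) => (x i j - cone_point u i j) ^+ 2) =
      (fun u => (x i j - (u ord0 (lshift n i) + u ord0 (rshift n j)))
        * (x i j - (u ord0 (lshift n i) + u ord0 (rshift n j)))).
    by apply/funext => u; rewrite mxE expr2.
  have c1 : {for v, continuous (fun u : 'rV[R]_(n + n) =>
      x i j - (u ord0 (lshift n i) + u ord0 (rshift n j)))}.
    by apply: continuousB; [exact: cst_continuous|exact: continuousD].
  exact: (continuousM c1 c1).
have [v /set_mem Av vmin] := @EVT_min_rV R _ f A (ex_intro _ 0 A0) cA
  (continuous_subspaceT cf).
have fE u : f u = frob_norm (x - cone_point u) ^+ 2.
  rewrite frob_norm_sqr; apply: eq_bigr => i _; apply: eq_bigr => j _.
  by rewrite !mxE expr2.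
exists (cone_point v); split.
  split=> [|i j /=].
    exists (fun i => v ord0 (lshift n i)), (fun j => v ord0 (rshift n j)).
    by move=> i j; rewrite mxE.
  rewrite mxE addr_ge0 //.
    by have /= := Av (lshift n i); rewrite in_itv /= => /andP[].
  by have /= := Av (rshift n j); rewrite in_itv /= => /andP[].
move=> z /(cone_pointP n0)[u -> u0].
have norm_le a b : frob_norm (x - cone_point a) ^+ 2 <=
    frob_norm (x - cone_point b) ^+ 2 ->
    frob_norm (x - cone_point a) <= frob_norm (x - cone_point b).
  by rewrite ler_sqr // nnegrE frob_norm_ge0.
have [Au|/existsNP[k Buk]] := pselect (A u).
  by apply: norm_le; rewrite -!fE; apply: vmin; rewrite inE.
have {}Buk : B < u ord0 k.
  rewrite ltNge; apply/negP => h; apply: Buk.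
  by rewrite /= in_itv /= u0.
apply: (@le_trans _ _ (frob_norm x)).
  have c0 : cone_point 0 = 0 by apply/matrixP => i j; rewrite !mxE addr0.
  rewrite -{2}[x]subr0 -c0; apply: norm_le; rewrite -!fE; apply: vmin.
  by rewrite inE.
have [i [j uij]] : exists i j, B < cone_point u i j.
  case: (split_ordP k) Buk => i -> Bu; exists i, i; rewrite mxE.
    by apply: lt_le_trans Bu _; rewrite lerDl.
  by apply: lt_le_trans Bu _; rewrite lerDr.
have := frob_norm_entry (x - cone_point u) i j.
have := frob_norm_entry x i j.
have -> : (x - cone_point u) i j = x i j - cone_point u i j by rewrite !mxE.
move=> h1 h2.
have := ler_norm (x i j); have := ler_norm (- (x i j - cone_point u i j)).
rewrite normrN; rewrite /B in uij; lra.
Qed.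

End cone.

Section distance.
Context (R : realType) (n : nat) (n0 : (0 < n)%N).
Implicit Types x y z : 'M[R]_n.

Lemma coneK_proj x : coneK (proj_cone x).
Proof. by have [] := proj_coneP x n0. Qed.

Lemma perp_cone_le x z : coneK z -> frob_norm (perp_cone x) <= frob_norm (x - z).
Proof. by have [_] := proj_coneP x n0; apply. Qed.

(** The distance to K is 1-Lipschitz, whence bounded jumps of the distance
    from bounded jumps of the queue. *)
Lemma perp_cone_lip x y :
  frob_norm (perp_cone x) <= frob_norm (perp_cone y) + frob_norm (x - y).
Proof.
apply: le_trans (perp_cone_le x (coneK_proj y)) _.
have -> : x - proj_cone y = perp_cone y + (x - y).
  by apply/matrixP => i j; rewrite !mxE; ring.
exact: frob_normD.
Qed.

End distance.

(** * Duality for assignments *)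

Section egervary.
Context (R : realType) (n : nat).
Implicit Types (q : 'M[R]_n) (s : 'S_n).

Lemma frob_inner_perm q s : frob_inner q (perm_mx s) = \sum_i q i (s i).
Proof.
apply: eq_bigr => i _; rewrite (bigD1 (s i)) //= big1 => [|j ji].
  by rewrite !mxE eqxx mulr1 addr0.
by rewrite !mxE eq_sym (negPf ji) mulr0.
Qed.

Variables (q : 'M[R]_n) (s : 'S_n).
Hypothesis opt : forall s', \sum_i q i (s' i) <= \sum_i q i (s i).

(** The change in weight when row i takes over the column that the optimal
    assignment s gives to row k; longest walks for these gains yield the dual
    potentials. *)
Definition swap_gain (i k : 'I_n) : R := q i (s k) - q k (s k).

Fixpoint walk_gain (i : 'I_n) (p : seq 'I_n) : R :=
  if p is k :: p' then swap_gain i k + walk_gain k p' else 0.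

Lemma walk_gain_cat i p p' :
  walk_gain i (p ++ p') = walk_gain i p + walk_gain (last i p) p'.
Proof.
by elim: p i => [|k p IH] i /=; rewrite ?add0r // IH addrA.
Qed.

Lemma walk_gain_next y0 y p : uniq (y :: p) ->
  \sum_(x <- y :: p) swap_gain x (next_at x y0 y p) =
  walk_gain y p + swap_gain (last y p) y0.
Proof.
elim: p y => [|y' p IH] y.
  by move=> _; rewrite big_seq1 /= eqxx add0r.
move=> /andP[yp up]; rewrite big_cons /= eqxx -[RHS]addrA -(IH y') //; congr (_ + _).
rewrite [LHS]big_seq [RHS]big_seq; apply: eq_bigr => x xp.
by case: eqP => // yx; rewrite -yx xp in yp.
Qed.

(** Rotating the columns along a cycle of rows composes s with a permutation,
    and s is optimal. *)
Lemma cycle_gain_le0 i p : uniq (i :: p) ->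
  walk_gain i p + swap_gain (last i p) i <= 0.
Proof.
move=> up; rewrite -walk_gain_next //; set c := i :: p.
have inj_next : injective (next c) := can_inj (prev_next up).
pose t := perm inj_next.
have -> : \sum_(x <- c) swap_gain x (next_at x i i p) =
    \sum_x swap_gain x (t x).
  rewrite big_uniq // [RHS](bigID (mem c)) /= [X in _ = _ + X]big1.
    by rewrite addr0; apply: eq_bigr => x _; rewrite permE.
  move=> x xc; rewrite permE next_nth (negPf xc) /swap_gain.
  by rewrite subrr.
have -> : \sum_x swap_gain x (t x) =
    \sum_x q x ((t * s)%g x) - \sum_x q x (s x).
  rewrite [X in _ = _ - X](reindex_perm t) -sumrB.
  by apply: eq_bigr => x _; rewrite permM.
by rewrite subr_le0.
Qed.

(** The largest gain of a walk from i without repeated rows; the empty walk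
    accounts for the default value 0. Such walks have less than n steps, so
    the maximum is over a finite type. *)
Definition potential (i : 'I_n) : R :=
  \big[Num.max/0]_(p : n.-bseq 'I_n | uniq (i :: p)) walk_gain i p.

Lemma walk_gain_le i (p : seq 'I_n) : uniq (i :: p) -> walk_gain i p <= potential i.
Proof.
move=> up.
have sp : (size p <= n)%N.
  have := card_uniqP up; rewrite /= => h.
  by have := max_card (mem (i :: p)); rewrite h card_ord => /ltnW.
by apply: (@le_bigmax_cond _ _ _ _ (Bseq sp)).
Qed.

(** If the extended walk returns to i, cutting off the closed part, whose gain
    is at most 0, leaves a simple walk with at least the same gain. *)
Lemma walk_gain_cons_le i k p : uniq (k :: p) ->
  swap_gain i k + walk_gain k p <= potential i.
Proof.
move=> up; have [ip|ip] := boolP (i \in k :: p); last first.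
  by apply: (@walk_gain_le i (k :: p)); rewrite cons_uniq ip.
have -> : swap_gain i k + walk_gain k p = walk_gain i (k :: p) by [].
have [p1 [p2 E]] : exists p1 p2, k :: p = p1 ++ i :: p2.
  by case/splitPr: ip => p1 p2; exists p1, p2.
rewrite {}E in up *; rewrite walk_gain_cat /=.
have up2 : uniq (i :: p2) by move: up; rewrite cat_uniq => /and3P[].
have up1 : uniq (i :: p1).
  move: up; rewrite cat_uniq /= => /and3P[-> /norP[-> _] _].
  by [].
have := cycle_gain_le0 up1; have := walk_gain_le up2.
lra.
Qed.

Lemma potential_le i k : swap_gain i k + potential k <= potential i.
Proof.
rewrite -lerBrDl; apply: bigmax_le => [|p up].
  rewrite lerBrDl; exact: (@walk_gain_cons_le i k [::]).
by rewrite lerBrDl walk_gain_cons_le.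
Qed.

(** The potentials of the rows, and for each column what its optimal row
    lacks. *)
Lemma dual_cover : exists w w' : 'I_n -> R,
  (forall i j, q i j <= w i + w' j) /\
  \sum_i w i + \sum_j w' j = \sum_i q i (s i).
Proof.
pose w' j := q ((s^-1)%g j) j - potential ((s^-1)%g j).
exists potential, w'; split.
  move=> i j; have := potential_le i ((s^-1)%g j).
  by rewrite /swap_gain permKV /w'; lra.
rewrite [X in _ + X](reindex_perm s) -big_split /=.
by apply: eq_bigr => i _; rewrite /w' permK; ring.
Qed.

End egervary.

(** Strong duality for the assignment problem: a maximal assignment together
    with an optimal cover by row and column potentials. *)
Lemma egervary (R : realType) (n : nat) (q : 'M[R]_n) :
  exists (s : 'S_n) (w w' : 'I_n -> R), [/\
    forall s' : 'S_n, \sum_i q i (s' i) <= \sum_i q i (s i),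
    forall i j, q i j <= w i + w' j &
    \sum_i w i + \sum_j w' j = \sum_i q i (s i)].
Proof.
have [s _ opt] := @arg_maxP _ _ _ (1%g : 'S_n) xpredT
  (fun s : 'S_n => \sum_i q i (s i)) isT.
have opt' (s' : 'S_n) : \sum_i q i (s' i) <= \sum_i q i (s i) by exact: opt.
have [w [w' [c e]]] := dual_cover opt'.
by exists s, w, w'.
Qed.

(** * One slot of the switch *)

Lemma natmxE (R : realType) n (q : 'M[nat]_n) i j : natmx R q i j = (q i j)%:R.
Proof. by rewrite mxE. Qed.

Lemma natmx_ge0 (R : realType) n (q : 'M[nat]_n) i j : 0 <= natmx R q i j.
Proof. by rewrite mxE. Qed.

Section schedules.
Context (R : realType) (n : nat).
Implicit Types (q a s : 'M[nat]_n) (y nu : 'M[R]_n).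

Lemma natmx_perm (p : 'S_n) : natmx R (perm_mx p) = perm_mx p.
Proof. by apply/matrixP => i j; rewrite !mxE; case: eqP. Qed.

Lemma schedule_le1 s i j : is_perm_mx s -> (s i j <= 1)%N.
Proof. by move=> /is_perm_mxP[p ->]; rewrite !mxE; case: eqP. Qed.

Lemma frob_inner_schedule q s : is_perm_mx s ->
  exists p : 'S_n, forall x : 'M[R]_n,
    frob_inner x (natmx R s) = \sum_i x i (p i).
Proof.
by move=> /is_perm_mxP[p ->]; exists p => x; rewrite natmx_perm frob_inner_perm.
Qed.

Lemma perm_doubly_stochastic s : is_perm_mx s -> doubly_stochastic (natmx R s).
Proof.
move=> /is_perm_mxP[p ->]; rewrite natmx_perm; split=> [i j|i|j].
- by rewrite !mxE ler0n.
- rewrite (bigD1 (p i)) //= !mxE eqxx big1 ?addr0 // => j ji.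
  by rewrite !mxE eq_sym (negPf ji).
- rewrite (bigD1 ((p^-1)%g j)) //= !mxE permKV eqxx big1 ?addr0 // => i ij.
  rewrite !mxE; case: eqP => // pij.
  by rewrite -pij permK eqxx in ij.
Qed.

Lemma max_weight_ge q (p : 'S_n) :
  \sum_i (q i (p i))%:R <= max_weight R q.
Proof.
have -> : \sum_i (q i (p i))%:R = frob_inner (natmx R q) (perm_mx p).
  by rewrite frob_inner_perm; apply: eq_bigr => i _; rewrite mxE.
exact: (@le_bigmax _ _ _ 0 (fun p : 'S_n => frob_inner (natmx R q) (perm_mx p)) p).
Qed.

Lemma max_weight_le q b : 0 <= b ->
  (forall p : 'S_n, \sum_i (q i (p i))%:R <= b) -> max_weight R q <= b.
Proof.
move=> b0 h; apply: bigmax_le => // p _; rewrite frob_inner_perm.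
by under eq_bigr do rewrite mxE; exact: h.
Qed.

(** The deficit of a schedule with respect to MaxWeight. *)
Definition gap q s : R := max_weight R q - frob_inner (natmx R q) (natmx R s).

Lemma gap_ge0 q s : is_perm_mx s -> 0 <= gap q s.
Proof.
move=> /(frob_inner_schedule q)[p hp]; rewrite /gap hp subr_ge0.
by under eq_bigr do rewrite mxE; exact: max_weight_ge.
Qed.

(** Pairing with an element of S reads off only the row and column sums. *)
Lemma inner_coneS_ds (x y z : 'M[R]_n) : coneS x ->
  doubly_stochastic y -> doubly_stochastic z -> frob_inner x y = frob_inner x z.
Proof.
move=> [w [w' xE]].
have h (u : 'M[R]_n) : doubly_stochastic u ->
    frob_inner x u = \sum_i w i + \sum_j w' j.
  move=> [_ r c]; rewrite /frob_inner.
  under eq_bigr => i _ do under eq_bigr do rewrite xE mulrDl.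
  under eq_bigr => i _ do rewrite big_split -mulr_sumr r mulr1 /=.
  rewrite big_split /= exchange_big /=; congr (_ + _).
  by apply: eq_bigr => j _; rewrite -mulr_sumr c mulr1.
by move=> /h -> /h ->.
Qed.

(** Let y be the cover given by an optimal dual solution. It lies in K,
    dominates q, and its weight under nu is the maximal weight. So the
    difference of the weights is <y - q, nu>, which is at least m times the
    sum of the entries of the nonnegative matrix y - q, hence at least m times
    its norm; and this norm is at least the distance from q to K. *)
Lemma weight_margin q nu (m : R) : doubly_stochastic nu -> 0 < m ->
  (forall i j, m <= nu i j) -> (0 < n)%N ->
  m * frob_norm (perp_cone (natmx R q)) <=
    max_weight R q - frob_inner (natmx R q) nu.
Proof.
move=> nuds m0 mnu n0.
have [s [w [w' [_ cov tot]]]] := egervary (natmx R q).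
pose y : 'M[R]_n := \matrix_(i, j) (w i + w' j).
have Sy : coneS y by exists w, w' => i j; rewrite mxE.
have Ky : coneK y.
  by split => // i j; rewrite mxE; apply: le_trans (cov i j); exact: natmx_ge0.
have d0 := perp_cone_le n0 (natmx R q) Ky.
have yq : frob_inner y nu = \sum_i natmx R q i (s i).
  have dss : doubly_stochastic (natmx R (perm_mx s : 'M[nat]_n)).
    by apply: perm_doubly_stochastic; apply/is_perm_mxP; exists s.
  rewrite -tot (inner_coneS_ds Sy nuds dss) natmx_perm frob_inner_perm.
  under eq_bigr do rewrite mxE.
  rewrite big_split /=; congr (_ + _).
  by rewrite [RHS](reindex_perm s).
have yM : frob_inner y nu <= max_weight R q.
  by rewrite yq; under eq_bigr do rewrite mxE; exact: max_weight_ge.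
apply: (@le_trans _ _ (frob_inner (y - natmx R q) nu)); last first.
  by rewrite frob_innerBl lerD2r.
set x := y - natmx R q.
have x0 i j : 0 <= x i j by rewrite !mxE subr_ge0 -natmxE cov.
have dx : frob_norm (perp_cone (natmx R q)) <= frob_norm x.
  by rewrite -(frob_normN x) opprB.
apply: le_trans (ler_wpM2l (ltW m0) dx) _.
have [->|nx0] := eqVneq (frob_norm x) 0.
  by rewrite mulr0 frob_inner_ge0 //; case: nuds.
have nx : 0 < frob_norm x by rewrite lt_neqAle eq_sym nx0 frob_norm_ge0.
rewrite -(ler_pM2l nx).
have -> : frob_norm x * (m * frob_norm x) = \sum_i \sum_j m * (x i j * x i j).
  rewrite mulrCA -expr2 frob_norm_sqr /frob_inner big_distrr /=.
  by apply: eq_bigr => i _; rewrite big_distrr.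
rewrite /frob_inner big_distrr /=; apply: ler_sum => i _.
rewrite big_distrr /=; apply: ler_sum => j _.
have h1 : x i j <= frob_norm x.
  by apply: le_trans (frob_norm_entry x i j); exact: ler_norm.
have -> : m * (x i j * x i j) = (m * x i j) * x i j by ring.
have -> : frob_norm x * (x i j * nu i j) = (nu i j * x i j) * frob_norm x by ring.
apply: ler_pM => //; first by rewrite mulr_ge0 // ltW.
by rewrite ler_wpM2r.
Qed.

Definition next_queue q a s : 'M[nat]_n := \matrix_(i, j) (q i j + a i j - s i j)%N.

Section step.
Variables (amax : nat) (q a s : 'M[nat]_n).
Hypotheses (a_le : forall i j, (a i j <= amax)%N) (s_perm : is_perm_mx s).
Local Notation q' := (next_queue q a s).

Lemma next_queue_dist i j : `|(q' i j)%:R - (q i j)%:R| <= amax.+1%:R :> R.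
Proof.
have s1 := schedule_le1 i j s_perm; have aM := a_le i j.
have h1 : (q i j <= q' i j + amax.+1)%N by rewrite mxE; lia.
have h2 : (q' i j <= q i j + amax.+1)%N by rewrite mxE; lia.
move: h1 h2; rewrite -!(ler_nat R) !natrD => h1 h2.
by rewrite ler_norml; apply/andP; split; lra.
Qed.

Lemma next_queue_norm :
  frob_norm (natmx R q' - natmx R q) <= n%:R * amax.+1%:R.
Proof.
apply: frob_norm_le => // i j.
have -> : (natmx R q' - natmx R q) i j = (q' i j)%:R - (q i j)%:R by rewrite !mxE.
exact: next_queue_dist.
Qed.

(** Where the truncation is inactive this is the expansion of a square. It is
    active only where q and a vanish and s = 1, and there the untruncated
    value - 1 would lie farther from the nonnegative target y than 0 does. *)
Lemma next_queue_drift y : (forall i j, 0 <= y i j) ->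
  frob_norm (natmx R q' - y) ^+ 2 <= frob_norm (natmx R q - y) ^+ 2
    + 2 * frob_inner (natmx R q - y) (natmx R a - natmx R s)
    + (n%:R * amax.+1%:R) ^+ 2.
Proof.
move=> y0; rewrite !frob_norm_sqr.
have -> : (n%:R * amax.+1%:R) ^+ 2 = \sum_(i < n) \sum_(j < n) amax.+1%:R ^+ 2 :> R.
  rewrite !sumr_const card_ord -[RHS]mulr_natr -[X in _ = X * _]mulr_natr.
  by ring.
rewrite /frob_inner big_distrr -!big_split /=; apply: ler_sum => i _.
rewrite big_distrr -!big_split /=; apply: ler_sum => j _.
have -> : (natmx R q' - y) i j = (q' i j)%:R - y i j by rewrite !mxE.
have -> : (natmx R q - y) i j = (q i j)%:R - y i j by rewrite !mxE.
have -> : (natmx R a - natmx R s) i j = (a i j)%:R - (s i j)%:R by rewrite !mxE.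
rewrite [q' i j]mxE.
have s1 := schedule_le1 i j s_perm; have := y0 i j.
have := a_le i j.
move: (q i j) (a i j) (s i j) (y i j) s1 => Q A s0 Y s1 AM Y0.
have M0 : 0 <= amax%:R :> R by [].
have A0 : 0 <= A%:R :> R by [].
have AM' : A%:R <= amax%:R :> R by rewrite ler_nat.
rewrite -natr1.
have [h|h] := leqP s0 (Q + A).
  rewrite natrB // natrD.
  have s0' : 0 <= s0%:R :> R by [].
  have s1' : s0%:R <= 1 :> R by rewrite -[leRHS]/(1%:R) ler_nat.
  suff : (A%:R - s0%:R) ^+ 2 <= (amax%:R + 1 : R) ^+ 2.
    rewrite !expr2; lra.
  rewrite -ler_sqrt ?sqr_ge0 // !sqrtr_sqr.
  rewrite (@ger0_norm _ (amax%:R + 1)) ?addr_ge0 // ler_norml.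
  by apply/andP; split; lra.
have -> : Q = 0%N by lia.
have -> : A = 0%N by lia.
have -> : s0 = 1%N by lia.
rewrite sub0n !mulr0n !sub0r mulr1n.
have : 0 <= (amax%:R + 1 : R) ^+ 2 by rewrite sqr_ge0.
rewrite !expr2; nra.
Qed.

Let cstE (c : R) : n%:R * c = \sum_(i < n) c.
Proof. by rewrite sumr_const card_ord mulr_natl. Qed.

Lemma next_queue_inner s2 : is_perm_mx s2 ->
  frob_inner (natmx R q) (natmx R s2) - n%:R * amax.+1%:R
  <= frob_inner (natmx R q') (natmx R s2).
Proof.
move=> /(frob_inner_schedule q)[p hp]; rewrite !hp.
rewrite cstE -sumrB; apply: ler_sum => i _.
rewrite !natmxE; have := next_queue_dist i (p i).
by rewrite ler_norml => /andP[h1 h2]; lra.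
Qed.

Lemma next_queue_max_weight :
  max_weight R q' <= max_weight R q + n%:R * amax.+1%:R.
Proof.
have M0 : 0 <= max_weight R q.
  by rewrite /max_weight; apply: bigmax_ge_id.
apply: max_weight_le => [|p]; first by rewrite addr_ge0 // mulr_ge0.
apply: le_trans (lerD (max_weight_ge q p) (lexx _)).
rewrite cstE -big_split; apply: ler_sum => i _ /=.
have := next_queue_dist i (p i).
by rewrite ler_norml => /andP[h1 h2]; lra.
Qed.

(** The old schedule loses a bounded weight when the queue is updated, the
    maximal weight gains a bounded amount, and the new schedule is at least as
    good as the old one for the new queue. *)
Lemma next_queue_gap s' :
  frob_inner (natmx R q') (natmx R s) <= frob_inner (natmx R q') (natmx R s') ->
  gap q' s' <= gap q s + 2 * (n%:R * amax.+1%:R).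
Proof.
rewrite /gap => h; have := next_queue_max_weight; have := next_queue_inner s_perm.
lra.
Qed.

End step.

End schedules.

(** * Drift of the queue norm and of the distance to the cone *)

(** Arrivals bounded by amax, so that their law is a weight function on a
    finite type. *)
Definition natm n amax (a : 'M['I_amax.+1]_n) : 'M[nat]_n := map_mx (@nat_of_ord _) a.

(** What the analysis in equilibrium needs to know of a switch with mean
    arrivals (1 - e) nu, entrywise variances v and reset probability delta.
    The value of the chain at time t determines queue and schedule, sk_q and
    sk_s; sk_mu is the law of the arrivals in one slot. In sk_moment2,
    distinct entries are uncorrelated. By sk_memory the schedule is never
    worse than the previous one, and sk_max is the chance of a MaxWeight
    schedule, averaged over the next state. *)
Record switch_kernel (R : realType) (n amax : nat) (nu v : 'M[R]_n) (e delta : R)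
    (E : countType) := SwitchKernel {
  sk_kernel :> finsupp_kernel R E;
  sk_q : E -> 'M[nat]_n;
  sk_s : E -> 'M[nat]_n;
  sk_mu : 'M['I_amax.+1]_n -> R;
  sk_irr : irreducible sk_kernel;
  sk_aper : aperiodic sk_kernel;
  sk_perm : forall x, is_perm_mx (sk_s x);
  sk_fin : forall A, finite_set A -> finite_set (sk_q @^-1` A);
  sk_mu_ge0 : forall a, 0 <= sk_mu a;
  sk_mu_sum : \sum_a sk_mu a = 1;
  sk_mean : forall i j, \sum_a sk_mu a * (natm a i j)%:R = (1 - e) * nu i j;
  sk_moment2 : forall i j i' j', \sum_a sk_mu a * ((natm a i j)%:R * (natm a i' j')%:R) =
    ((1 - e) * nu i j) * ((1 - e) * nu i' j')
      + (if (i == i') && (j == j') then v i j else 0);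
  sk_step : forall (phi : 'M[nat]_n -> R) x,
    step sk_kernel (fun y => phi (sk_q y)) x =
    \sum_a sk_mu a * phi (next_queue (sk_q x) (natm a) (sk_s x));
  sk_memory : forall x y, 0 < sk_kernel x y ->
    frob_inner (natmx R (sk_q y)) (natmx R (sk_s x)) <=
    frob_inner (natmx R (sk_q y)) (natmx R (sk_s y));
  sk_max : forall x,
    delta <= step sk_kernel (fun y => (gap R (sk_q y) (sk_s y) == 0)%:R) x
}.

Section switch_drift.
Context (R : realType) (n amax : nat) (nu v : 'M[R]_n) (e delta : R)
  (E : countType) (k : switch_kernel amax nu v e delta E).

Local Notation q x := (natmx R (sk_q k x)).
Local Notation s x := (natmx R (sk_s k x)).
Local Notation mu := (sk_mu k).
Local Notation gapx x := (gap R (sk_q k x) (sk_s k x)).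

Lemma natm_le (a : 'M['I_amax.+1]_n) i j : (natm a i j <= amax)%N.
Proof. by rewrite mxE -ltnS. Qed.

(** sk_step determines the law of the next queue, hence its support. *)
Lemma sk_succ x y : 0 < k x y ->
  exists a : 'M['I_amax.+1]_n, sk_q k y = next_queue (sk_q k x) (natm a) (sk_s k x).
Proof.
move=> kxy; apply: contrapT => h.
(* the indicator of the queues that no arrival leads to has mean 0 after one
   step *)
pose phi m : R := `[< ~ exists a : 'M['I_amax.+1]_n,
  m = next_queue (sk_q k x) (natm a) (sk_s k x) >]%:R.
have := sk_step k phi x; rewrite [RHS]big1; last first.
  move=> a _; rewrite /phi asboolF ?mulr0 //; apply; by exists a.
move=> E0; have : 0 < k x y * phi (sk_q k y) by rewrite /phi asboolT // mulr1.
apply/negP; rewrite -leNgt -E0 /step (bigD1_seq y) ?fk_uniq //=; last first.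
  by apply: fk_supp; rewrite gt_eqF.
by rewrite lerDl; apply: sumr_ge0 => z _; rewrite mulr_ge0 ?fk_ge0 // ler0n.
Qed.

Lemma queue_jump x y : 0 < k x y ->
  frob_norm (q y - q x) <= n%:R * amax.+1%:R.
Proof.
by move=> /sk_succ[a ->]; apply: next_queue_norm;
  [exact: natm_le|exact: sk_perm].
Qed.

Lemma gap_jump x y : 0 < k x y -> gapx y <= gapx x + 2 * (n%:R * amax.+1%:R).
Proof.
move=> kxy; have h := sk_memory kxy; have [a E'] := sk_succ kxy.
move: h; rewrite E' => h.
by apply: (next_queue_gap (natm_le a)) => //; exact: sk_perm.
Qed.

Lemma mean_inner (y : 'M[R]_n) :
  \sum_a mu a * frob_inner y (natmx R (natm a)) = (1 - e) * frob_inner y nu.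
Proof.
rewrite /frob_inner; under eq_bigr do rewrite big_distrr /=.
rewrite exchange_big big_distrr /=; apply: eq_bigr => i _.
under eq_bigr do rewrite big_distrr /=.
rewrite exchange_big big_distrr /=; apply: eq_bigr => j _.
rewrite [RHS]mulrCA -(sk_mean k) big_distrr /=; apply: eq_bigr => a _.
by rewrite [natmx _ _ i j]natmxE mulrCA.
Qed.

(** Pairing y with the schedule or with nu gives the same value, as both are
    doubly stochastic and y lies in K; what remains of the drift splits into
    the loss of the schedule against nu and the spare capacity e. *)
Lemma quadratic_drift x (y : 'M[R]_n) : (0 < n)%N -> doubly_stochastic nu -> coneK y ->
  \sum_a mu a * frob_norm
     (natmx R (next_queue (sk_q k x) (natm a) (sk_s k x)) - y) ^+ 2 <=
  frob_norm (q x - y) ^+ 2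
    + 2 * (frob_inner (q x) nu - frob_inner (q x) (s x)
           - e * frob_inner (q x - y) nu)
    + (n%:R * amax.+1%:R) ^+ 2.
Proof.
move=> n0 nuds [Sy Ky]; have sp := sk_perm k x.
have yE : frob_inner y nu = frob_inner y (s x).
  by apply: inner_coneS_ds => //; exact: perm_doubly_stochastic.
set B := (n%:R * amax.+1%:R) ^+ 2.
apply: (@le_trans _ _ (\sum_a mu a * (frob_norm (q x - y) ^+ 2 + B
   - 2 * frob_inner (q x - y) (s x) + 2 * frob_inner (q x - y) (natmx R (natm a))))).
  apply: ler_sum => a _; rewrite ler_wpM2l ?sk_mu_ge0 //.
  apply: le_trans (next_queue_drift (sk_q k x) (natm_le a) sp Ky) _.
  by rewrite frob_innerBr /B; lra.
under eq_bigr do rewrite mulrDr.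
rewrite big_split /= -mulr_suml sk_mu_sum mul1r.
under [X in _ + X]eq_bigr do rewrite mulrCA.
rewrite -mulr_sumr mean_inner !frob_innerBl yE; lra.
Qed.

(** Take y = 0. The schedule loses at most its gap against nu, and the spare
    capacity yields e <q, nu>, which is of the order of e times the norm of q. *)
Lemma queue_norm_drift x (m : R) : (0 < n)%N -> doubly_stochastic nu ->
  0 < m -> (forall i j, m <= nu i j) -> 0 <= e ->
  step k (fun y => frob_norm (q y) ^+ 2) x <=
  frob_norm (q x) ^+ 2 - 2 * e * m * frob_norm (q x) + 2 * gapx x
    + (n%:R * amax.+1%:R) ^+ 2.
Proof.
move=> n0 nuds m0 mnu e0.
rewrite (sk_step k (fun u => frob_norm (natmx R u) ^+ 2)).
have := quadratic_drift x n0 nuds (coneK0 R n).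
under eq_bigr do rewrite subr0.
rewrite subr0 => /le_trans; apply.
have h1 := weight_margin (sk_q k x) nuds m0 mnu n0.
have h2 : 0 <= m * frob_norm (perp_cone (q x)).
  by rewrite mulr_ge0 ?(ltW m0) // frob_norm_ge0.
have h3 : m * frob_norm (q x) <= frob_inner (q x) nu.
  have [->|x0] := eqVneq (frob_norm (q x)) 0.
    by rewrite mulr0 frob_inner_ge0 // => i j; [exact: natmx_ge0|case: nuds].
  have nx : 0 < frob_norm (q x) by rewrite lt_neqAle eq_sym x0 frob_norm_ge0.
  rewrite -(ler_pM2l nx) mulrCA -expr2 frob_norm_sqr /frob_inner !big_distrr /=.
  apply: ler_sum => i _; rewrite !big_distrr; apply: ler_sum => j _ /=.
  have -> : m * (q x i j * q x i j) = (m * q x i j) * q x i j by ring.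
  have -> : frob_norm (q x) * (q x i j * nu i j) =
      (nu i j * q x i j) * frob_norm (q x) by ring.
  have q0 : 0 <= q x i j by exact: natmx_ge0.
  apply: ler_pM => //; first by rewrite mulr_ge0 // ltW.
    by rewrite ler_wpM2r.
  by apply: le_trans (frob_norm_entry _ i j); exact: ler_norm.
have h4 := ler_wpM2l e0 h3.
rewrite /gap; lra.
Qed.

(** Take for y the projection of the present queue, which is an element of K
    from which the next queue is at least as far as from its own projection.
    The negative term is the margin of the maximal weight over nu, so it does
    not degenerate as e tends to 0. *)
Lemma perp_norm_drift x (m : R) : (0 < n)%N -> doubly_stochastic nu ->
  0 < m -> (forall i j, m <= nu i j) -> 0 <= e -> e * frob_norm nu <= m / 2 ->
  step k (fun y => frob_norm (perp_cone (q y)) ^+ 2) x <=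
  frob_norm (perp_cone (q x)) ^+ 2 - m * frob_norm (perp_cone (q x)) + 2 * gapx x
    + (n%:R * amax.+1%:R) ^+ 2.
Proof.
move=> n0 nuds m0 mnu e0 em.
rewrite (sk_step k (fun u => frob_norm (perp_cone (natmx R u)) ^+ 2)).
have Ky := coneK_proj n0 (q x).
have [y yE Ky'] : exists2 y, perp_cone (q x) = q x - y & coneK y.
  by exists (proj_cone (q x)).
clear Ky; rename Ky' into Ky.
apply: (@le_trans _ _ (\sum_a mu a * frob_norm
     (natmx R (next_queue (sk_q k x) (natm a) (sk_s k x)) - y) ^+ 2)).
  apply: ler_sum => a _; apply: ler_wpM2l; first exact: sk_mu_ge0.
  by apply: lerXn2r; rewrite ?nnegrE ?frob_norm_ge0 //; exact: perp_cone_le.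
apply: le_trans (quadratic_drift x n0 nuds Ky) _.
rewrite -yE.
have h1 := weight_margin (sk_q k x) nuds m0 mnu n0.
have h2 := frob_cauchy_schwarz (- perp_cone (q x)) nu.
rewrite frob_normN -scaleN1r frob_innerZl in h2.
have h3 := ler_wpM2l e0 h2.
have h4 := ler_wpM2l (frob_norm_ge0 (perp_cone (q x))) em.
rewrite /gap; lra.
Qed.

End switch_drift.

Lemma doubly_stochastic_min (R : realType) n (nu : 'M[R]_n) :
  (forall i j, 0 < nu i j) -> exists2 m, 0 < m & forall i j, m <= nu i j.
Proof.
move=> nu0; exists (\big[Num.min/1]_(ij : 'I_n * 'I_n) nu ij.1 ij.2).
  by apply: lt_bigmin => // -[i j] _; exact: nu0.
by move=> i j; rewrite (bigminD1 (i, j)) // ge_min lexx.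
Qed.

Lemma dist_le_of_lip (R : realDomainType) (a b c B : R) :
  a <= b + c -> b <= a + c -> c <= B -> `|a - b| <= B.
Proof. by rewrite ler_norml => h1 h2 h3; apply/andP; split; lra. Qed.

(** * Exponential Lyapunov functions for the switch *)

Section exponential.
Context (R : realType) (n amax : nat) (nu : 'M[R]_n) (delta : R).
Hypotheses (n0 : (0 < n)%N) (nuds : doubly_stochastic nu).
Hypotheses (nu0 : forall i j, 0 < nu i j).
Hypotheses (d0 : 0 < delta) (d1 : delta <= 1).

Let B0 : 0 < n%:R * amax.+1%:R :> R.
Proof. by rewrite mulr_gt0 ?ltr0n. Qed.

(** The constants depend on e through the drift rate of the norm. *)
Lemma stability_drift (e : R) : 0 < e -> exists eta theta A g K : R,
  [/\ 0 < eta, 0 < theta, 0 <= A, 0 <= g < 1 & 0 <= K] /\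
  forall v E (k : switch_kernel amax nu v e delta E),
  let F x := expR (eta * frob_norm (natmx R (sk_q k x)))
    + A * expR (theta * gap R (sk_q k x) (sk_s k x)) in
  forall x, step k F x <= g * F x + K.
Proof.
move=> e0; have [m m0 mnu] := doubly_stochastic_min nu0.
have c0 : 0 < 2 * e * m by rewrite !mulr_gt0.
have C0 : 0 <= (n%:R * amax.+1%:R) ^+ 2 :> R by rewrite sqr_ge0.
have C3 : 0 < 2 * (n%:R * amax.+1%:R) :> R by rewrite mulr_gt0 ?B0.
have [eta [th [A [g [K [H hF]]]]]] := exp_drift B0 c0 C0 C3 d0 d1.
exists eta, th, A, g, K; split => // v E k.
apply: hF.
- by move=> x; exact: frob_norm_ge0.
- by move=> x; apply: gap_ge0; exact: sk_perm.
- move=> x y kxy; have h1 := queue_jump kxy.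
  have h2 := frob_normD (natmx R (sk_q k x)) (natmx R (sk_q k y) - natmx R (sk_q k x)).
  have h3 := frob_normD (natmx R (sk_q k y)) (- (natmx R (sk_q k y) - natmx R (sk_q k x))).
  rewrite frob_normN opprB addrC subrK in h3; rewrite addrC subrK in h2.
  exact: dist_le_of_lip h2 h3 h1.
- by move=> x; apply: queue_norm_drift => //; exact: ltW.
- by move=> x y; exact: gap_jump.
- by move=> x; exact: sk_max.
Qed.

(** The constants are chosen before e: the drift rate of the distance to K is
    the smallest entry of nu, for all e below a threshold. *)
Lemma collapse_drift : exists e0 : R, 0 < e0 /\ exists eta theta A g K : R,
  [/\ 0 < eta, 0 < theta, 0 <= A, 0 <= g < 1 & 0 <= K] /\
  forall e, 0 < e -> e <= e0 ->
  forall v E (k : switch_kernel amax nu v e delta E),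
  let F x := expR (eta * frob_norm (perp_cone (natmx R (sk_q k x))))
    + A * expR (theta * gap R (sk_q k x) (sk_s k x)) in
  forall x, step k F x <= g * F x + K.
Proof.
have [m m0 mnu] := doubly_stochastic_min nu0.
have nn : 0 < frob_norm nu.
  apply: lt_le_trans (frob_norm_entry nu (Ordinal n0) (Ordinal n0)).
  by apply: lt_le_trans (ler_norm _); exact: nu0.
(* below this e, the spare capacity changes the margin by at most one half *)
exists (m / 2 / frob_norm nu); split; first by rewrite !divr_gt0.
have C0 : 0 <= (n%:R * amax.+1%:R) ^+ 2 :> R by rewrite sqr_ge0.
have C3 : 0 < 2 * (n%:R * amax.+1%:R) :> R by rewrite mulr_gt0 ?B0.
have [eta [th [A [g [K [H hF]]]]]] := exp_drift B0 m0 C0 C3 d0 d1.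
exists eta, th, A, g, K; split => // e e0 ee v E k.
apply: hF.
- by move=> x; exact: frob_norm_ge0.
- by move=> x; apply: gap_ge0; exact: sk_perm.
- move=> x y kxy; have h1 := queue_jump kxy.
  have h2 := perp_cone_lip n0 (natmx R (sk_q k y)) (natmx R (sk_q k x)).
  have h3 := perp_cone_lip n0 (natmx R (sk_q k x)) (natmx R (sk_q k y)).
  rewrite -(frob_normN (_ - natmx R (sk_q k y))) opprB in h3.
  exact: dist_le_of_lip h2 h3 h1.
- move=> x; apply: perp_norm_drift => //; first exact: ltW.
  by rewrite -ler_pdivlMr.
- by move=> x y; exact: gap_jump.
- by move=> x; exact: sk_max.
Qed.

End exponential.

(** * Row sums, column sums and the span of the cone *)

Lemma mulr_ord_const (R : realType) n (c : R) : n%:R * c = \sum_(i < n) c.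
Proof. by rewrite sumr_const card_ord mulr_natl. Qed.

Section lines.
Context (R : realType) (n : nat).
Implicit Types x y z : 'M[R]_n.

Definition mx_total x : R := \sum_i \sum_j x i j.

(** The orthogonal projection onto S multiplied by n, which keeps it free of
    divisions except in the last term. *)
Definition line_form x : 'M[R]_n :=
  \matrix_(i, j) (\sum_j' x i j' + \sum_i' x i' j - mx_total x / n%:R).

Lemma mx_total_lin a b x y : mx_total (a *: x + b *: y) = a * mx_total x + b * mx_total y.
Proof.
rewrite /mx_total !big_distrr -big_split /=; apply: eq_bigr => i _.
rewrite !big_distrr -big_split /=; apply: eq_bigr => j _.
by rewrite !mxE.
Qed.

Lemma line_form_lin a b x y :
  line_form (a *: x + b *: y) = a *: line_form x + b *: line_form y.
Proof.
apply/matrixP => i j; rewrite [LHS]mxE mx_total_lin !mxE.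
under eq_bigr do rewrite !mxE.
under [X in _ + X - _]eq_bigr do rewrite !mxE.
rewrite !big_split -!mulr_sumr /=; ring.
Qed.

Lemma line_formD x y : line_form (x + y) = line_form x + line_form y.
Proof. by rewrite -{1}[x]scale1r -{1}[y]scale1r line_form_lin !scale1r. Qed.

Lemma line_formB x y : line_form (x - y) = line_form x - line_form y.
Proof.
by rewrite -{1}[x]scale1r -{1}scaleN1r line_form_lin scale1r scaleN1r.
Qed.

Lemma line_form_sym x y : frob_inner x (line_form y) = frob_inner y (line_form x).
Proof.
have h u w : frob_inner u (line_form w) =
    \sum_i (\sum_j u i j) * (\sum_j w i j)
    + \sum_j (\sum_i u i j) * (\sum_i w i j) - mx_total u * mx_total w / n%:R.
  rewrite /frob_inner.
  transitivity (\sum_i \sum_j (u i j * \sum_j' w i j')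
     + \sum_i \sum_j (u i j * \sum_i' w i' j)
     - \sum_i \sum_j u i j * (mx_total w / n%:R)).
    rewrite -big_split -sumrB /=; apply: eq_bigr => i _.
    rewrite -big_split -sumrB /=; apply: eq_bigr => j _.
    by rewrite mxE; ring.
  congr (_ + _ - _).
  - by apply: eq_bigr => i _; rewrite mulr_suml.
  - by rewrite exchange_big /=; apply: eq_bigr => i _; rewrite mulr_suml.
  - rewrite -mulrA; move: (mx_total w / _) => c.
    rewrite /mx_total mulr_suml; apply: eq_bigr => i _.
    by rewrite mulr_suml.
rewrite !h; congr (_ + _ - _).
- by apply: eq_bigr => i _; rewrite mulrC.
- by apply: eq_bigr => i _; rewrite mulrC.
- by rewrite [mx_total x * _]mulrC.
Qed.

Hypothesis n0 : (0 < n)%N.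
Let nn0 : n%:R != 0 :> R. Proof. by rewrite pnatr_eq0 -lt0n. Qed.

Lemma line_form_coneS y : coneS y -> line_form y = n%:R *: y.
Proof.
move=> [w [w' yE]]; apply/matrixP => i j; rewrite !mxE /mx_total.
under eq_bigr do rewrite yE.
under [X in _ + X - _]eq_bigr do rewrite yE.
under [X in _ - X / _]eq_bigr => i' _.
  under eq_bigr do rewrite yE.
  rewrite big_split /= sumr_const card_ord -mulr_natl; over.
rewrite !big_split /= !sumr_const !card_ord -mulr_sumr.
rewrite -(mulr_natl (w i)) -(mulr_natl (w' j)) -(mulr_natl (\sum_i _)) yE.
by field.
Qed.

(** All doubly stochastic matrices have the same projection onto S, the
    constant one. This is why the arrival direction nu disappears from the
    limit. *)
Lemma line_form_ds y : doubly_stochastic y -> line_form y = const_mx 1.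
Proof.
move=> [_ r c]; apply/matrixP => i j; rewrite !mxE r c /mx_total.
under eq_bigr do rewrite r.
by rewrite sumr_const card_ord -[X in X / _]mulr_natl mulr1 divff // addrK.
Qed.

Lemma inner_const1 x : frob_inner x (const_mx 1) = mx_total x.
Proof.
by apply: eq_bigr => i _; apply: eq_bigr => j _; rewrite mxE mulr1.
Qed.

Lemma mx_total_ds y : doubly_stochastic y -> mx_total y = n%:R.
Proof.
move=> [_ r c]; rewrite /mx_total; under eq_bigr do rewrite r.
by rewrite sumr_const card_ord.
Qed.

Lemma row_le x i : `|\sum_j x i j| <= n%:R * frob_norm x.
Proof.
apply: le_trans (ler_norm_sum _ _ _) _.
rewrite mulr_ord_const.
by apply: ler_sum => j _; exact: frob_norm_entry.
Qed.

Lemma col_le x j : `|\sum_i x i j| <= n%:R * frob_norm x.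
Proof.
apply: le_trans (ler_norm_sum _ _ _) _.
rewrite mulr_ord_const.
by apply: ler_sum => i _; exact: frob_norm_entry.
Qed.

Lemma mx_total_le x : `|mx_total x| <= n%:R * (n%:R * frob_norm x).
Proof.
apply: le_trans (ler_norm_sum _ _ _) _.
rewrite mulr_ord_const.
by apply: ler_sum => i _; exact: row_le.
Qed.

(** The difference of line_form and n times the identity is a bounded
    operator. As it vanishes on S, it measures how far x is from S. *)
Lemma line_form_defect x i j :
  `|(line_form x - n%:R *: x) i j| <= 4 * n%:R * frob_norm x.
Proof.
have -> : (line_form x - n%:R *: x) i j =
    \sum_j' x i j' + \sum_i' x i' j - mx_total x / n%:R - n%:R * x i j.
  by rewrite !mxE.
have h1 := row_le x i; have h2 := col_le x j.
have h3 : `|mx_total x / n%:R| <= n%:R * frob_norm x.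
  rewrite normrM normfV (ger0_norm (ler0n _ _)) ler_pdivrMr ?ltr0n //.
  by rewrite [leRHS]mulrC mx_total_le.
have h4 : `|n%:R * x i j| <= n%:R * frob_norm x.
  by rewrite normrM (ger0_norm (ler0n _ _)) ler_wpM2l // frob_norm_entry.
apply: le_trans (ler_normB _ _) _.
apply: le_trans (lerD (ler_normB _ _) (lexx _)) _.
apply: le_trans (lerD (lerD (ler_normD _ _) (lexx _)) (lexx _)) _.
lra.
Qed.

Lemma inner_abs_le (u x : 'M[R]_n) (b : R) : (forall i j, 0 <= u i j) ->
  (forall i j, `|x i j| <= b) -> `|frob_inner u x| <= mx_total u * b.
Proof.
move=> u0 xb; rewrite /mx_total mulr_suml.
apply: le_trans (ler_norm_sum _ _ _) _; apply: ler_sum => i _.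
rewrite mulr_suml; apply: le_trans (ler_norm_sum _ _ _) _.
apply: ler_sum => j _; rewrite normrM (ger0_norm (u0 i j)).
by rewrite ler_wpM2l.
Qed.

Lemma line_form_pos_le (u : 'M[R]_n) i j : (forall i j, 0 <= u i j) ->
  `|line_form u i j| <= 3 * mx_total u.
Proof.
move=> u0; rewrite mxE.
have r i' : 0 <= \sum_j' u i' j' by apply: sumr_ge0.
have c j' : 0 <= \sum_i' u i' j' by apply: sumr_ge0.
have t0 : 0 <= mx_total u by apply: sumr_ge0.
have h1 : \sum_j' u i j' <= mx_total u.
  by rewrite /mx_total [leRHS](bigD1 i) //= lerDl sumr_ge0.
have h2 : \sum_i' u i' j <= mx_total u.
  by rewrite /mx_total exchange_big [leRHS](bigD1 j) //= lerDl sumr_ge0.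
have h3 : mx_total u / n%:R <= mx_total u.
  by rewrite ler_pdivrMr ?ltr0n // ler_peMr // ler1n.
have h4 : 0 <= mx_total u / n%:R by rewrite divr_ge0.
have := r i; have := c j.
by rewrite ler_norml => c1 r1; apply/andP; split; lra.
Qed.

End lines.

Section line_quad.
Context (R : realType) (n : nat).
Implicit Types x y b u : 'M[R]_n.

Definition line_quad x : R := frob_inner x (line_form x).

Lemma line_quadD x y : line_quad (x + y) =
  line_quad x + 2 * frob_inner y (line_form x) + line_quad y.
Proof.
rewrite /line_quad line_formD frob_innerDl !frob_innerDr (line_form_sym x y).
by ring.
Qed.

Lemma line_quadB x y : line_quad (x - y) =
  line_quad x - 2 * frob_inner y (line_form x) + line_quad y.
Proof.
rewrite /line_quad line_formB frob_innerBl !frob_innerBr (line_form_sym x y).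
by ring.
Qed.

(** Expanding around the state after the reflection u rather than before it
    leaves u paired with the new queue, to which it is orthogonal. *)
Lemma line_quad_reflected x b u :
  line_quad (x + b + u) - line_quad x - 2 * frob_inner b (line_form x) - line_quad b =
  2 * frob_inner u (line_form (x + b + u)) - line_quad u.
Proof.
have := line_quadD x b; have := line_quadB (x + b + u) u; rewrite addrK => -> h.
lra.
Qed.

End line_quad.

(** * The effect of unused service *)

(** The weight r balances a small total t against a bounded second moment of
    d: in equilibrium t is of order e, so r = sqrt e makes both terms of order
    sqrt e. *)
Lemma am_gm_weighted (R : realType) (t d r M : R) : 0 < r -> 0 <= t -> t <= M ->
  2 * (t * d) <= r * d ^+ 2 + M / r * t.
Proof.
move=> r0 t0 tM.
have h : 0 <= (r * d - t) ^+ 2 by exact: sqr_ge0.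
have h2 : t * t <= M * t by rewrite ler_wpM2r.
rewrite -(ler_pM2l r0).
have -> : r * (r * d ^+ 2 + M / r * t) = r * r * d ^+ 2 + M * t.
  by field; rewrite gt_eqF.
rewrite !expr2 in h *; lra.
Qed.

Section reflection.
Context (R : realType) (n : nat) (amax : nat) (q a s : 'M[nat]_n).
Hypotheses (n0 : (0 < n)%N) (s_perm : is_perm_mx s).
Let q' := next_queue q a s.
Let b := natmx R a - natmx R s.
Let u := natmx R q' - natmx R q - b.

Lemma unused_ge0 i j : 0 <= u i j.
Proof.
have s1 := schedule_le1 i j s_perm.
rewrite /u /b /q'.
have -> : (natmx R (next_queue q a s) - natmx R q - (natmx R a - natmx R s)) i j =
  (next_queue q a s i j + s i j)%:R - (q i j + a i j)%:R.
  by rewrite !mxE !natrD; ring.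
by rewrite subr_ge0 ler_nat mxE; lia.
Qed.

Lemma unused_le_schedule i j : u i j <= (s i j)%:R.
Proof.
have s1 := schedule_le1 i j s_perm.
rewrite /u /b /q'.
have -> : (natmx R (next_queue q a s) - natmx R q - (natmx R a - natmx R s)) i j =
  (next_queue q a s i j + s i j)%:R - (q i j + a i j)%:R.
  by rewrite !mxE !natrD; ring.
by rewrite lerBlDr -natrD ler_nat mxE; lia.
Qed.

(** Service is wasted only on queues that are empty afterwards. *)
Lemma unused_inner : frob_inner u (natmx R q') = 0.
Proof.
rewrite /frob_inner big1 // => i _; rewrite big1 // => j _.
have s1 := schedule_le1 i j s_perm.
rewrite natmxE; have [->|] := eqVneq (q' i j) 0%N; first by rewrite mulr0.
rewrite /q' mxE => h.
suff -> : u i j = 0 by rewrite mul0r.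
rewrite /u /b /q' !mxE natrB ?natrD; first by ring.
by lia.
Qed.

Lemma mx_total_schedule : mx_total (natmx R s) = n%:R.
Proof. by apply: mx_total_ds; exact: perm_doubly_stochastic. Qed.

Lemma mx_total_unused : mx_total u =
  mx_total (natmx R q') - mx_total (natmx R q) - mx_total (natmx R a) + n%:R.
Proof.
have tB (x y : 'M[R]_n) : mx_total (x - y) = mx_total x - mx_total y.
  by rewrite -{1}[x]scale1r -{1}scaleN1r mx_total_lin mul1r mulN1r.
by rewrite /u /b !tB mx_total_schedule; ring.
Qed.

Lemma mx_total_unused_ge0 : 0 <= mx_total u.
Proof. by do 2 (apply: sumr_ge0 => ? _); exact: unused_ge0. Qed.

Lemma mx_total_unused_le : mx_total u <= n%:R.
Proof.
rewrite -mx_total_schedule; do 2 (apply: ler_sum => ? _).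
by rewrite [leRHS]natmxE; exact: unused_le_schedule.
Qed.

(** The remainder is 2 <u, T q'> - <u, T u>. In the first term the part of q'
    in K contributes n <u, q'_K> = - n <u, q'_perp>, because <u, q'> = 0, so
    that only q'_perp is left; in the second, u is bounded by the schedule. *)
Lemma line_quad_defect (r : R) : 0 < r ->
  `|line_quad (natmx R q') - line_quad (natmx R q)
    - 2 * frob_inner b (line_form (natmx R q)) - line_quad b| <=
  4 * n%:R * r * frob_norm (perp_cone (natmx R q')) ^+ 2
   + (4 * n%:R * n%:R / r + 3 * n%:R) * mx_total u.
Proof.
move=> r0.
have q'E : natmx R q' = natmx R q + b + u.
  rewrite /u; move: (natmx R q') (natmx R q) b => z1 z2 z3.
  by apply/matrixP => i j; rewrite !mxE; ring.
rewrite {1}q'E line_quad_reflected -q'E.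
have Ky := coneK_proj n0 (natmx R q').
pose d := frob_norm (perp_cone (natmx R q')).
have h1 : `|frob_inner u (line_form (natmx R q'))| <= mx_total u * (4 * n%:R * d).
  have -> : frob_inner u (line_form (natmx R q')) =
      frob_inner u (line_form (perp_cone (natmx R q')) - n%:R *: perp_cone (natmx R q')).
    have e1 : natmx R q' = perp_cone (natmx R q') + proj_cone (natmx R q').
      by rewrite /perp_cone subrK.
    rewrite {1}e1 line_formD (line_form_coneS n0 Ky.1).
    have -> : proj_cone (natmx R q') = natmx R q' - perp_cone (natmx R q').
      by rewrite /perp_cone subKr.
    rewrite scalerBr !(frob_innerDr, frob_innerBr, frob_innerZr) unused_inner.
    by ring.
  apply: inner_abs_le; first exact: unused_ge0.
  by move=> i j; exact: line_form_defect.
have h2 : `|line_quad u| <= 3 * n%:R * mx_total u.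
  apply: le_trans (inner_abs_le unused_ge0 (fun i j => line_form_pos_le n0 i j unused_ge0)) _.
  rewrite mulrCA -mulrA ler_wpM2l // ler_wpM2r ?mx_total_unused_ge0 //.
  exact: mx_total_unused_le.
have h3 := am_gm_weighted d r0 mx_total_unused_ge0 mx_total_unused_le.
rewrite -/d.
have n4 : 0 <= 4 * n%:R :> R by rewrite mulr_ge0.
have h4 := ler_wpM2l n4 h3.
apply: le_trans (ler_normB _ _) _; rewrite normrM (ger0_norm (ler0n R 2)).
have h5 := ler_wpM2l (ler0n R 2) h1.
apply: le_trans (lerD h5 h2) _.
clearbody d; move: (mx_total u) h4 => t h4; lra.
Qed.

End reflection.

(** * The drift of the quadratic form *)

Lemma sum_if_eq (R : nmodType) (I : finType) (i : I) (c : R) :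
  \sum_j (if i == j then c else 0) = c.
Proof. by rewrite -big_mkcond (big_pred1 i) // => j /=; rewrite eq_sym. Qed.

Section heavy_traffic_step.
Context (R : realType) (n amax : nat) (nu v : 'M[R]_n) (e delta : R)
  (E : countType) (k : switch_kernel amax nu v e delta E).
Hypotheses (n0 : (0 < n)%N) (nuds : doubly_stochastic nu).

Local Notation q x := (natmx R (sk_q k x)).
Local Notation s x := (natmx R (sk_s k x)).
Local Notation mu := (sk_mu k).

Lemma mean_mx_total : \sum_a mu a * mx_total (natmx R (natm a)) = (1 - e) * n%:R.
Proof.
rewrite -(mx_total_ds nuds) -inner_const1 frob_innerC -(mean_inner k).
by apply: eq_bigr => a _; rewrite -inner_const1 frob_innerC.
Qed.

(** The mean part is the form at (1 - e) nu. As distinct entries are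
    uncorrelated, each variance enters with the diagonal coefficient of
    line_form, which is 1 + 1 - 1/n. *)
Lemma mean_line_quad_arrivals : \sum_a mu a * line_quad (natmx R (natm a)) =
  (1 - e) ^+ 2 * n%:R + (2 - n%:R^-1) * mx_total v.
Proof.
have nn0 : n%:R != 0 :> R by rewrite pnatr_eq0 -lt0n.
pose l : 'M[R]_n := (1 - e) *: nu.
have lE i j : l i j = (1 - e) * nu i j by rewrite mxE.
have M i j i' j' := sk_moment2 k i j i' j'.
have fl : line_quad l = (1 - e) ^+ 2 * n%:R.
  have lfl : line_form l = (1 - e) *: line_form nu.
    by rewrite -[l]addr0 -(scale0r nu) line_form_lin scale0r addr0.
  rewrite /line_quad lfl frob_innerZl frob_innerZr (line_form_ds n0 nuds).
  by rewrite inner_const1 (mx_total_ds nuds) mulrA -expr2.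
rewrite -fl /line_quad /frob_inner.
under eq_bigr do rewrite big_distrr /=.
rewrite exchange_big /mx_total mulr_sumr -big_split /=; apply: eq_bigr => i _.
under eq_bigr do rewrite big_distrr /=.
rewrite exchange_big mulr_sumr -big_split /=; apply: eq_bigr => j _.
have a1 : \sum_a mu a * (natmx R (natm a) i j * \sum_j' natmx R (natm a) i j') =
    l i j * \sum_j' l i j' + v i j.
  transitivity (\sum_j' \sum_a mu a * ((natm a i j)%:R * (natm a i j')%:R)).
    rewrite exchange_big; apply: eq_bigr => a _ /=.
    rewrite natmxE -!big_distrr /=; congr (_ * (_ * _)).
    by apply: eq_bigr => j' _; rewrite natmxE.
  under eq_bigr do rewrite M eqxx /=.
  rewrite big_split -big_distrr /= sum_if_eq lE; congr (_ * _ + _).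
  by apply: eq_bigr => j' _; rewrite lE.
have a2 : \sum_a mu a * (natmx R (natm a) i j * \sum_i' natmx R (natm a) i' j) =
    l i j * \sum_i' l i' j + v i j.
  transitivity (\sum_i' \sum_a mu a * ((natm a i j)%:R * (natm a i' j)%:R)).
    rewrite exchange_big; apply: eq_bigr => a _ /=.
    rewrite natmxE -!big_distrr /=; congr (_ * (_ * _)).
    by apply: eq_bigr => i' _; rewrite natmxE.
  under eq_bigr do rewrite M eqxx andbT.
  rewrite big_split -big_distrr /= sum_if_eq lE; congr (_ * _ + _).
  by apply: eq_bigr => i' _; rewrite lE.
have a3 : \sum_a mu a * (natmx R (natm a) i j * mx_total (natmx R (natm a))) =
    l i j * mx_total l + v i j.
  transitivity (\sum_i' \sum_j' \sum_a mu a * ((natm a i j)%:R * (natm a i' j')%:R)).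
    under [RHS]eq_bigr do rewrite exchange_big /=.
    rewrite [RHS]exchange_big; apply: eq_bigr => a _ /=.
    rewrite natmxE /mx_total !big_distrr /=; apply: eq_bigr => i' _.
    rewrite !big_distrr /=; apply: eq_bigr => j' _.
    by rewrite natmxE.
  under eq_bigr => i' _.
    under eq_bigr do rewrite M.
    rewrite big_split -big_distrr /=; over.
  rewrite big_split /= -big_distrr /=; congr (_ + _).
    rewrite lE; congr (_ * _); apply: eq_bigr => i' _.
    by apply: eq_bigr => j' _; rewrite lE.
  rewrite (bigD1 i) //= [X in _ + X]big1 ?addr0 => [|i' /negPf ii'].
    by rewrite eqxx sum_if_eq.
  by rewrite big1 // => j' _; rewrite eq_sym ii'.
transitivity (
  \sum_a mu a * (natmx R (natm a) i j * \sum_j' natmx R (natm a) i j')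
  + \sum_a mu a * (natmx R (natm a) i j * \sum_i' natmx R (natm a) i' j)
  - (\sum_a mu a * (natmx R (natm a) i j * mx_total (natmx R (natm a)))) / n%:R).
  rewrite mulr_suml -big_split -sumrB /=; apply: eq_bigr => a _.
  by rewrite [line_form _ i j]mxE; ring.
rewrite a1 a2 a3 [line_form _ i j]mxE; field.
exact: nn0.
Qed.

(** The drift of the form up to the error of the reflection. The linear term
    pairs line_form of the queue with arrivals minus schedule, that is the
    queue with the difference of two multiples of the constant matrix, which
    gives - e times the total. *)
Lemma heavy_traffic_step x (r : R) : 0 < r ->
  `|step k (fun y => line_quad (q y)) x - line_quad (q x) + 2 * e * mx_total (q x)
     - ((2 - n%:R^-1) * mx_total v + n%:R * e ^+ 2)| <=
  4 * n%:R * r * step k (fun y => frob_norm (perp_cone (q y)) ^+ 2) x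
  + (4 * n%:R * n%:R / r + 3 * n%:R) *
    (step k (fun y => mx_total (q y)) x - mx_total (q x) + n%:R * e).
Proof.
move=> r0; have sp := sk_perm k x; have sds := perm_doubly_stochastic R sp.
rewrite (sk_step k (fun m => line_quad (natmx R m))).
rewrite (sk_step k (fun m => frob_norm (perp_cone (natmx R m)) ^+ 2)).
rewrite (sk_step k (fun m => mx_total (natmx R m))).
pose q' (a : 'M['I_amax.+1]_n) := natmx R (next_queue (sk_q k x) (natm a) (sk_s k x)).
pose b (a : 'M['I_amax.+1]_n) := natmx R (natm a) - s x.
have tB (y z : 'M[R]_n) : mx_total (y - z) = mx_total y - mx_total z.
  by rewrite -{1}[y]scale1r -{1}scaleN1r mx_total_lin mul1r mulN1r.
have c1 (c : R) : \sum_a mu a * c = c by rewrite -mulr_suml sk_mu_sum mul1r.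
have E1 : \sum_a mu a * (line_quad (q' a) - line_quad (q x)
    - 2 * frob_inner (b a) (line_form (q x)) - line_quad (b a)) =
  \sum_a mu a * line_quad (q' a) - line_quad (q x) + 2 * e * mx_total (q x)
     - ((2 - n%:R^-1) * mx_total v + n%:R * e ^+ 2).
  have e1 : \sum_a mu a * frob_inner (b a) (line_form (q x)) = - e * mx_total (q x).
    transitivity (\sum_a mu a * frob_inner (line_form (q x)) (natmx R (natm a))
      - \sum_a mu a * frob_inner (line_form (q x)) (s x)).
      rewrite -sumrB; apply: eq_bigr => a _.
      by rewrite frob_innerC frob_innerBr mulrBr.
    rewrite c1 mean_inner !(frob_innerC (line_form _)).
    rewrite !(line_form_sym _ (q x)) !line_form_ds // inner_const1; ring.
  have e2 : \sum_a mu a * line_quad (b a) = n%:R * e ^+ 2 + (2 - n%:R^-1) * mx_total v.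
    transitivity (\sum_a mu a * line_quad (natmx R (natm a))
       - 2 * (\sum_a mu a * mx_total (natmx R (natm a))) + \sum_a mu a * n%:R).
      rewrite mulr_sumr -sumrB -big_split /=; apply: eq_bigr => a _.
      rewrite line_quadB line_form_sym (line_form_ds n0 sds) inner_const1.
      rewrite [line_quad (s x)]/line_quad (line_form_ds n0 sds) inner_const1 (mx_total_ds sds).
      by ring.
    by rewrite c1 mean_mx_total mean_line_quad_arrivals; ring.
  transitivity (\sum_a mu a * line_quad (q' a) - \sum_a mu a * line_quad (q x)
    - 2 * (\sum_a mu a * frob_inner (b a) (line_form (q x))) - \sum_a mu a * line_quad (b a)).
    rewrite mulr_sumr -!sumrB; apply: eq_bigr => a _.
    by ring.
  by rewrite c1 e1 e2; ring.
rewrite -E1.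
apply: le_trans (ler_norm_sum _ _ _) _.
have E2 : 4 * n%:R * r * (\sum_a mu a * frob_norm (perp_cone (q' a)) ^+ 2)
  + (4 * n%:R * n%:R / r + 3 * n%:R) *
    (\sum_a mu a * mx_total (q' a) - mx_total (q x) + n%:R * e) =
  \sum_a mu a * (4 * n%:R * r * frob_norm (perp_cone (q' a)) ^+ 2
   + (4 * n%:R * n%:R / r + 3 * n%:R) *
     (mx_total (q' a) - mx_total (q x) - mx_total (natmx R (natm a)) + n%:R)).
  have -> : \sum_a mu a * mx_total (q' a) - mx_total (q x) + n%:R * e =
    \sum_a mu a * mx_total (q' a) - \sum_a mu a * mx_total (q x)
     - \sum_a mu a * mx_total (natmx R (natm a)) + \sum_a mu a * n%:R.
    by rewrite !c1 mean_mx_total; ring.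
  rewrite -!sumrB -big_split /= !mulr_sumr -big_split /=; apply: eq_bigr => a _.
  set c := 4 * n%:R * n%:R / r + _; by ring.
rewrite E2; apply: ler_sum => a _.
rewrite normrM (ger0_norm (sk_mu_ge0 k a)); apply: ler_wpM2l; first exact: sk_mu_ge0.
have := line_quad_defect (sk_q k x) (natm a) n0 sp r0.
by rewrite mx_total_unused.
Qed.

End heavy_traffic_step.

(** * The switch in equilibrium *)

Lemma expr_le_exp (R : realType) (r : nat) (eta x : R) : (0 < r)%N -> 0 < eta ->
  0 <= x -> x ^+ r <= (r%:R / eta) ^+ r * expR (eta * x).
Proof.
move=> r0 eta0 x0.
have rr : 0 < r%:R :> R by rewrite ltr0n.
have h : x <= r%:R / eta * expR (eta * x / r%:R).
  rewrite -ler_pdivrMl ?divr_gt0 // invf_div.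
  apply: le_trans (expR_ge1Dx _).
  have -> : eta / r%:R * x = eta * x / r%:R by rewrite mulrAC.
  by rewrite lerDr.
apply: (@le_trans _ _ ((r%:R / eta * expR (eta * x / r%:R)) ^+ r)).
  apply: lerXn2r => //; rewrite nnegrE //.
  by rewrite mulr_ge0 ?expR_ge0 // divr_ge0 // ltW.
rewrite exprMn -expRM_natr.
have -> // : eta * x / r%:R * r%:R = eta * x by field; rewrite gt_eqF.
Qed.

Lemma finite_bounded_natmx (R : realType) n (r : R) :
  finite_set [set m : 'M[nat]_n | frob_norm (natmx R m) <= r].
Proof.
have [N hN] : exists N : nat, r < N%:R.
  exists (Num.truncn r).+1; exact: truncnS_gt.
apply: (@sub_finite_set _ _ ((fun a : 'M['I_N.+1]_n => natm a) @` setT)).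
  move=> m /= mr; exists (\matrix_(i, j) inord (m i j)) => //.
  apply/matrixP => i j; rewrite !mxE inordK // ltnS.
  rewrite -(ler_nat R); apply: le_trans (ltW hN); apply: le_trans mr.
  apply: le_trans (frob_norm_entry _ i j).
  by rewrite natmxE ger0_norm.
by apply: finite_image; exact: finite_finset.
Qed.

(** l is the expectation of phi in equilibrium, expressed without an invariant
    measure, so that it makes sense for unbounded phi as well. *)
Definition attracts (R : realType) (E : countType) (k : finsupp_kernel R E)
    (phi : E -> R) (l : R) : Prop :=
  forall x, iter t (step k) phi x @[t --> \oo] --> l.

Section attracts.
Context (R : realType) (E : countType) (k : finsupp_kernel R E) (x0 : E).

Lemma attracts_le phi psi l l' : attracts k phi l -> attracts k psi l' ->
  (forall x, phi x <= psi x) -> l <= l'.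
Proof.
move=> h h' le; apply: (ler_cvg_to (h x0) (h' x0)); near=> t.
exact: (mo_le (markov_op_iter t (step_markov k))).
Unshelve. all: by end_near. Qed.

Lemma attracts_lin a b phi psi l l' : attracts k phi l -> attracts k psi l' ->
  attracts k (fun x => a * phi x + b * psi x) (a * l + b * l').
Proof.
move=> h h' x.
under eq_fun => t do rewrite (mo_lin (markov_op_iter t (step_markov k))).
by apply: cvgD; apply: cvgMl_tmp.
Qed.

Lemma attracts_cst c : attracts k (fun=> c) c.
Proof.
move=> x; under eq_fun => t do rewrite (mo_cstx (markov_op_iter t (step_markov k))).
exact: cvg_cst.
Qed.

(** Invariance of the equilibrium under a step of the chain; with it, drift
    inequalities become identities between limits. *)
Lemma attracts_step phi l : attracts k phi l -> attracts k (step k phi) l.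
Proof.
move=> h x; under eq_fun => t do rewrite -iterSr.
have := h x; rewrite -(cvg_shiftS (fun t => iter t (step k) phi x)).
by apply: cvg_trans; apply: near_eq_cvg; near=> t; rewrite /=.
Unshelve. all: by end_near. Qed.

(** The bound K / (1 - g) forgets the initial value of F, so it inherits the
    uniformity of the drift constants. *)
Lemma attracts_drift_le phi l F c g K : attracts k phi l ->
  0 <= c -> 0 <= g -> g < 1 -> (forall x, phi x <= c * F x) ->
  (forall x, step k F x <= g * F x + K) -> (forall x, 0 <= F x) -> 0 <= K ->
  l <= c * (K / (1 - g)).
Proof.
move=> h c0 g0 g1 phiF PF F0 K0.
have h2 : c * (g ^+ t * F x0 + K / (1 - g)) @[t --> \oo] --> c * (0 * F x0 + K / (1 - g)).
  apply: cvgMl_tmp; apply: cvgD; last exact: cvg_cst.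
  by apply: cvgMr_tmp; apply: cvg_expr; rewrite ger0_norm.
rewrite mul0r add0r in h2.
apply: (ler_cvg_to (h x0) h2); near=> t.
have mt := markov_op_iter t (step_markov k).
apply: le_trans (mo_le mt x0 phiF) _; rewrite (moZ mt) ler_wpM2l //.
exact: (drift_iter (step_markov k) g0 g1 K0 PF).
Unshelve. all: by end_near. Qed.

End attracts.

Section equilibrium.
Context (R : realType) (n amax : nat) (nu : 'M[R]_n) (delta : R).
Hypotheses (n0 : (0 < n)%N) (nuds : doubly_stochastic nu).
Hypotheses (nu0 : forall i j, 0 < nu i j).
Hypotheses (d0 : 0 < delta) (d1 : delta <= 1).

(** Functions of polynomial growth in the queue norm are dominated by the
    exponential Lyapunov function, whose sublevel sets are finite because only
    finitely many states share a queue. *)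
Theorem equilibrium (e : R) (v : 'M[R]_n) (E : countType)
    (k : switch_kernel amax nu v e delta E) (x0 : E) : 0 < e ->
  positive_recurrent k /\
  forall (phi : E -> R) (c : R) (r : nat),
    (forall x, `|phi x| <= c * (1 + frob_norm (natmx R (sk_q k x))) ^+ r) ->
    exists l, attracts k phi l.
Proof.
move=> e0.
have [eta [th [A [g [K [[eta0 th0 A0 /andP[g0 g1] K0] hF]]]]]] :=
  stability_drift amax n0 nuds nu0 d0 d1 e0.
have {}hF := hF v E k.
set F := (fun x => expR _ + _) in hF.
have F0 x : 0 <= F x by rewrite /F addr_ge0 ?mulr_ge0 ?expR_ge0.
have FN x : expR (eta * frob_norm (natmx R (sk_q k x))) <= F x.
  by rewrite /F lerDl mulr_ge0 ?expR_ge0.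
have Ffin r : finite_set [set x | F x <= r].
  apply: (@sub_finite_set _ _ (sk_q k @^-1` [set m | frob_norm (natmx R m) <= r / eta])).
    move=> x /= Fr; rewrite ler_pdivlMr //.
    have := expR_ge1Dx (eta * frob_norm (natmx R (sk_q k x))).
    by have := FN x; rewrite [_ * eta]mulrC; lra.
  by apply: sk_fin; exact: finite_bounded_natmx.
have reach := sublevel_reach (@sk_irr _ _ _ _ _ _ _ _ k) (@sk_aper _ _ _ _ _ _ _ _ k) Ffin.
split; first exact: (drift_positive_recurrent g0 g1 K0 F0 hF reach).
move=> phi c r phic.
have minor Rr : exists m z (alpha : R), [/\ 0 < alpha, alpha < 1 &
    forall x, F x <= Rr -> forall psi, (forall y, 0 <= psi y) ->
      alpha * psi z <= iter m.+1 (step k) psi x].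
  have [m [al [al0 hal]]] := reach x0 Rr.
  exists m, x0, (Num.min al (1 / 2)); split.
  - by rewrite lt_min al0; apply/andP; split => //; lra.
  - by rewrite gt_min; apply/orP; right; lra.
  move=> x Fx psi psi0.
  apply: le_trans (iter_ge_point_ind k m.+1 x0 x psi0).
  rewrite mulrC ler_wpM2l //.
  by apply: le_trans (hal x Fx); rewrite ge_min lexx.
have [C hC] : exists C, forall x : R, 0 <= x -> (1 + x) ^+ r <= C * expR (eta * x).
  case: (r) => [|r1].
    exists 1 => x x0'; rewrite expr0 mul1r -expR0 ler_expR.
    by rewrite mulr_ge0 // ltW.
  exists ((r1.+1%:R / eta) ^+ r1.+1 * expR eta) => x x0'.
  have := @expr_le_exp R r1.+1 eta (1 + x) isT eta0.
  rewrite mulrDr mulr1 expRD mulrA; apply; lra.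
apply: (harris (step_markov k) g0 g1 K0 F0 hF minor (c := `|c| * `|C|)).
move=> x; apply: le_trans (phic x) _.
set z := frob_norm _.
have z0 : 0 <= z by exact: frob_norm_ge0.
have h1 : 0 <= (1 + z) ^+ r by rewrite exprn_ge0 // addr_ge0.
apply: (@le_trans _ _ (`|c| * (1 + z) ^+ r)).
  by rewrite ler_wpM2r // ler_norm.
rewrite -mulrA ler_wpM2l //; apply: le_trans (hC _ z0) _.
apply: (@le_trans _ _ (`|C| * expR (eta * z))).
  by rewrite ler_wpM2r ?expR_ge0 // ler_norm.
rewrite ler_wpM2l //; apply: le_trans (FN x) _; lra.
Qed.

(** A power is dominated by an exponential, and the Lyapunov function of the
    collapse has constants independent of e. *)
Theorem collapse_moments : exists e0 : R, 0 < e0 /\ exists C : nat -> R,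
  forall e v E (k : switch_kernel amax nu v e delta E) (x0 : E),
    0 < e -> e <= e0 -> forall r l, (0 < r)%N ->
    attracts k (fun x => frob_norm (perp_cone (natmx R (sk_q k x))) ^+ r) l ->
    l <= C r.
Proof.
have [e0 [e00 [eta [th [A [g [K [[eta0 th0 A0 /andP[g0 g1] K0] hF]]]]]]]] :=
  collapse_drift amax n0 nuds nu0 d0 d1.
exists e0; split => //.
exists (fun r => (r%:R / eta) ^+ r * (K / (1 - g))) => e v E k x0 e1 ee0 r l r0 hl.
have {}hF := hF e e1 ee0 v E k.
set F := (fun x => expR _ + _) in hF.
have F0 x : 0 <= F x by rewrite /F addr_ge0 ?mulr_ge0 ?expR_ge0.
have c0 : 0 <= (r%:R / eta) ^+ r by rewrite exprn_ge0 // divr_ge0 // ltW.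
apply: (attracts_drift_le x0 hl c0 g0 g1 _ hF F0 K0) => x.
apply: le_trans (expr_le_exp r0 eta0 (frob_norm_ge0 _)) _.
by apply: ler_wpM2l => //; rewrite /F lerDl mulr_ge0 ?expR_ge0.
Qed.

(** In equilibrium the form and the total have zero drift, so that of the
    one-slot estimate only the constants, the total and the second moment of
    the distance to K remain. *)
Theorem heavy_traffic_bound (e : R) (v : 'M[R]_n) (E : countType)
    (k : switch_kernel amax nu v e delta E) (x0 : E) (l D r : R) :
  0 < e -> 0 < r ->
  attracts k (fun x => mx_total (natmx R (sk_q k x))) l ->
  attracts k (fun x => frob_norm (perp_cone (natmx R (sk_q k x))) ^+ 2) D ->
  `|2 * e * l - ((2 - n%:R^-1) * mx_total v + n%:R * e ^+ 2)| <=
  4 * n%:R * r * D + (4 * n%:R * n%:R / r + 3 * n%:R) * (n%:R * e).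
Proof.
move=> e0 r0 hl hD.
pose V x := line_quad (natmx R (sk_q k x)).
pose S x := mx_total (natmx R (sk_q k x)).
pose d2 x := frob_norm (perp_cone (natmx R (sk_q k x))) ^+ 2.
have [_ conv] := equilibrium k x0 e0.
have [lV hV] : exists lV, attracts k V lV.
  apply: (conv V (3 * (n%:R * n%:R) ^+ 2) 2%N) => x.
  have q0 i j : 0 <= natmx R (sk_q k x) i j by exact: natmx_ge0.
  apply: le_trans (inner_abs_le q0 (fun i j => line_form_pos_le n0 i j q0)) _.
  set z := frob_norm _; have z0 : 0 <= z by exact: frob_norm_ge0.
  have t1 := le_trans (ler_norm _) (mx_total_le (natmx R (sk_q k x))).
  have t0 : 0 <= mx_total (natmx R (sk_q k x)) by do 2 apply: sumr_ge0 => ? _.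
  rewrite -/z in t1; move: (mx_total _) t0 t1 => t t0 t1.
  have t2 : t * t <= (n%:R * (n%:R * z)) * (n%:R * (n%:R * z)).
    by rewrite ler_pM.
  have z2 : z * z <= (1 + z) ^+ 2 by rewrite expr2; lra.
  have c0 : 0 <= 3 * (n%:R * n%:R) ^+ 2 :> R by rewrite mulr_ge0 // sqr_ge0.
  have := ler_wpM2l c0 z2; rewrite !expr2; lra.
pose ce := (2 - n%:R^-1) * mx_total v + n%:R * e ^+ 2.
pose ka := 4 * n%:R * n%:R / r + 3 * n%:R.
have st x := heavy_traffic_step k n0 nuds x r0.
pose X x := 1 * (1 * step k V x + (-1) * V x) + 1 * (2 * e * S x + (-1) * ce).
pose Y x := 4 * n%:R * r * step k d2 x
  + ka * (1 * (1 * step k S x + (-1) * S x) + 1 * (n%:R * e)).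
have hX : attracts k X (1 * (1 * lV + (-1) * lV) + 1 * (2 * e * l + (-1) * ce)).
  apply: attracts_lin; apply: attracts_lin => //; first exact: attracts_step.
  exact: attracts_cst.
have hY : attracts k Y (4 * n%:R * r * D + ka * (1 * (1 * l + (-1) * l) + 1 * (n%:R * e))).
  apply: attracts_lin; first exact: attracts_step.
  apply: attracts_lin; last exact: attracts_cst.
  by apply: attracts_lin => //; exact: attracts_step.
have XY x : - Y x <= X x <= Y x.
  have := st x; rewrite ler_norml -/ce -/ka.
  rewrite -[step k (fun y => line_quad _) x]/(step k V x) -[line_quad _]/(V x).
  rewrite -[step k (fun y => mx_total _) x]/(step k S x) -[mx_total (natmx R _)]/(S x).
  rewrite -[step k (fun y => _ ^+ 2) x]/(step k d2 x).
  rewrite /X /Y; move: (step k V x) (V x) (step k S x) (S x) (step k d2 x) => a1 a2 a3 a4 a5.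
  by move=> /andP[h1 h2]; apply/andP; split; lra.
have h1 : 1 * (1 * lV + (-1) * lV) + 1 * (2 * e * l + (-1) * ce) <=
    4 * n%:R * r * D + ka * (1 * (1 * l + (-1) * l) + 1 * (n%:R * e)).
  by apply: (attracts_le x0 hX hY) => x; have /andP[] := XY x.
have hY' := attracts_lin (a := -1) (b := 0) hY (attracts_cst k (c := 0)).
have XY' x : (-1) * Y x + 0 * 0 <= X x.
  by have /andP[h _] := XY x; rewrite mul0r addr0 mulN1r.
have h2 := attracts_le x0 hY' hX XY'.
rewrite -/ce -/ka ler_norml; clearbody ka ce; apply/andP; split; lra.
Qed.

End equilibrium.

(** * Discrete random elements *)

Section discrete.
Context d (T : measurableType d) (R : realType) (P : probability T R).
Context (V : countType) (Y : T -> V).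
Hypothesis dY : discrete_rv Y.

Lemma discrete_measurable (A : set V) : measurable (Y @^-1` A).
Proof.
have -> : Y @^-1` A = \bigcup_v (Y @^-1` (A `&` [set v])).
  by apply/seteqP; split=> [w Aw|w [v _ []]//]; exists (Y w).
apply: countable_bigcupT_measurable => [|v]; first exact: countableP.
have [Av|Av] := pselect (A v).
  have -> : A `&` [set v] = [set v].
    by apply/seteqP; split=> [u []//|u ->].
  exact: dY.
have -> : A `&` [set v] = set0.
  by apply/seteqP; split=> // u [Au uv]; rewrite uv in Au.
by rewrite preimage_set0.
Qed.

(** The values of Y indexed by natural numbers, which lets countable
    additivity be used for a series. *)
Definition atom (n : nat) : set T := [set w | choice.pickle (Y w) = n].

Lemma atom_measurable n : measurable (atom n).
Proof. exact: (discrete_measurable [set v | choice.pickle v = n]). Qed.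

Lemma atom_trivIset B : trivIset setT (fun n => B `&` atom n).
Proof.
apply/trivIsetP => i j _ _ ij; apply/seteqP; split=> // w [[_ wi] [_ wj]].
by rewrite /atom /= in wi wj; rewrite -wi -wj eqxx in ij.
Qed.

Lemma bigcup_atom B : \bigcup_n (B `&` atom n) = B.
Proof. by apply/seteqP; split=> [w [n _ []]//|w Bw]; exists (choice.pickle (Y w)). Qed.

Lemma atomE n : (exists v, atom n = Y @^-1` [set v]) \/ atom n = set0.
Proof.
have [[w wn]|h] := pselect (exists w, atom n w); [left|right].
  exists (Y w); apply/seteqP; split=> u /=; rewrite /atom /= in wn *.
    by move=> un; apply: (pcan_inj choice.pickleK); rewrite un wn.
  by move=> ->.
by apply/seteqP; split=> // w wn; apply: h; exists w.
Qed.

Lemma measure_atoms B : measurable B ->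
  (P B = \sum_(0 <= n <oo) P (B `&` atom n))%E.
Proof.
move=> mB; rewrite -{1}(bigcup_atom B) measure_semi_bigcup //.
- by move=> n; apply: measurableI => //; exact: atom_measurable.
- exact: atom_trivIset.
- by rewrite bigcup_atom.
Qed.

(** A proportionality between measures that holds on every value of Y holds in
    total. It is used with Y the past of the chain, to pass from conditioning
    on the whole past to conditioning on the present. *)
Lemma discrete_scale (c : R) B B' : measurable B -> measurable B' -> 0 <= c ->
  (forall v, P (B `&` Y @^-1` [set v]) = (c%:E * P (B' `&` Y @^-1` [set v]))%E) ->
  P B = (c%:E * P B')%E.
Proof.
move=> mB mB' c0 h; rewrite (measure_atoms mB) (measure_atoms mB').
rewrite -nneseriesZl //; apply: eq_eseriesr => n _.
by have [[v ->]|->] := atomE n; rewrite ?h // !setI0 !measure0 mule0.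
Qed.

Lemma discrete_scale_le (c : R) B B' : measurable B -> measurable B' -> 0 <= c ->
  (forall v, c%:E * P (B' `&` Y @^-1` [set v]) <= P (B `&` Y @^-1` [set v]))%E ->
  (c%:E * P B' <= P B)%E.
Proof.
move=> mB mB' c0 h; rewrite (measure_atoms mB) (measure_atoms mB').
rewrite -nneseriesZl //; apply: lee_nneseries => n _.
  by rewrite mule_ge0.
by have [[v ->]|->] := atomE n; rewrite ?h // !setI0 !measure0 mule0.
Qed.

Lemma discrete_measurable_fun (phi : V -> R) B :
  measurable_fun B (fun w => phi (Y w)).
Proof.
move=> mB A mA; apply: measurableI => //.
exact: (discrete_measurable (phi @^-1` A)).
Qed.

Lemma integral_atoms (f : T -> \bar R) : measurable_fun [set: T] f ->
  (forall w, 0 <= f w)%E ->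
  (\int[P]_w f w = \sum_(0 <= n <oo) \int[P]_(w in atom n) f w)%E.
Proof.
move=> mf f0.
have cup : \bigcup_n atom n = setT.
  by rewrite -[RHS]bigcup_atom; apply: eq_bigcupr => n _; rewrite setTI.
rewrite -[in LHS]cup ge0_integral_bigcup //.
- exact: atom_measurable.
- by rewrite cup.
- have := atom_trivIset (B := [set: T]).
  by rewrite (_ : (fun n => _) = atom) //; apply/funext => n; rewrite setTI.
Qed.

Lemma eq_integral_discrete (f g : T -> \bar R) : measurable_fun [set: T] f ->
  measurable_fun [set: T] g -> (forall w, 0 <= f w)%E -> (forall w, 0 <= g w)%E ->
  (forall v, \int[P]_(w in Y @^-1` [set v]) f w =
             \int[P]_(w in Y @^-1` [set v]) g w)%E ->
  (\int[P]_w f w = \int[P]_w g w)%E.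
Proof.
move=> mf mg f0 g0 h; rewrite !integral_atoms //; apply: eq_eseriesr => n _.
by have [[v ->]|->] := atomE n; rewrite ?h // !integral_set0.
Qed.

Lemma integral_discrete_fin (r : seq V) (phi : V -> R) B : measurable B ->
  uniq r -> (forall v, 0 <= phi v) ->
  (forall v, v \notin r -> P (B `&` Y @^-1` [set v]) = 0%E) ->
  (\int[P]_(w in B) (phi (Y w))%:E =
   \sum_(v <- r) (phi v)%:E * P (B `&` Y @^-1` [set v]))%E.
Proof.
move=> mB ur phi0 Pr.
pose g w : \bar R := (\sum_(v <- r) (phi v)%:E * (\1_(Y @^-1` [set v]) w)%:E)%E.
have m1 v : measurable_fun B
    (fun w => ((phi v)%:E * (\1_(Y @^-1` [set v]) w)%:E)%E).
  apply/measurable_EFinP; apply: measurable_funM => //.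
have mg : measurable_fun B g by exact: emeasurable_sum.
have g0 w : (0 <= g w)%E.
  by apply: sume_ge0 => v _; rewrite -EFinM lee_fin mulr_ge0.
have mphi : measurable_fun B (fun w => (phi (Y w))%:E).
  by apply/measurable_EFinP; exact: discrete_measurable_fun.
transitivity (\int[P]_(w in B) g w)%E.
  apply: ge0_ae_eq_integral => //.
    by move=> w _; rewrite lee_fin.
  exists (B `&` Y @^-1` [set v | v \notin r]); split.
  - by apply: measurableI => //; exact: discrete_measurable.
  - have mN : measurable (B `&` Y @^-1` [set v | v \notin r]).
      by apply: measurableI => //; exact: discrete_measurable.
    suff : P (B `&` Y @^-1` [set v | v \notin r]) = 0%E by [].
    rewrite (@discrete_scale 0 _ set0) ?mul0e // => v.
    rewrite mul0e; have [vr|vr] := boolP (v \in r).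
      rewrite (_ : _ `&` _ = set0) ?measure0 //.
      by apply/seteqP; split=> // w [[_ /= h] hv]; rewrite hv vr in h.
    apply/eqP; rewrite eq_le measure_ge0 andbT -(Pr v vr).
    apply: le_measure; rewrite ?inE; try exact: measurableI.
    by move=> w [[]].
  - move=> w /= /not_implyP[Bw h]; split => //; apply/negP => Yr; apply: h.
    rewrite /g (bigD1_seq (Y w)) //= indicE mem_set // mule1.
    rewrite big1 ?adde0 // => v vY.
    rewrite indicE memNset ?mule0 //= => Yv.
    by rewrite Yv eqxx in vY.
rewrite ge0_integral_sum //; last first.
  by move=> v w _; rewrite -EFinM lee_fin mulr_ge0.
apply: eq_bigr => v _.
rewrite ge0_integralZl_EFin //.
- by rewrite integral_indic // setIC.
- exact/measurable_EFinP.
Qed.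

End discrete.

Section discrete_constructions.
Context d (T : measurableType d) (R : realType) (P : probability T R).

Lemma discrete_comp (V W : countType) (Y : T -> V) (h : V -> W) :
  discrete_rv Y -> discrete_rv (fun w => h (Y w)).
Proof. by move=> dY v; exact: (discrete_measurable dY (h @^-1` [set v])). Qed.

Lemma discrete_pair (V W : countType) (Y : T -> V) (Z : T -> W) :
  discrete_rv Y -> discrete_rv Z -> discrete_rv (fun w => (Y w, Z w)).
Proof.
move=> dY dZ [y z].
have -> : (fun w => (Y w, Z w)) @^-1` [set (y, z)] = Y @^-1` [set y] `&` Z @^-1` [set z].
  by apply/seteqP; split=> w /= [-> ->].
exact: measurableI.
Qed.

Lemma discrete_map (V : countType) (Z : nat -> T -> V) (r : seq nat) :
  (forall u, discrete_rv (Z u)) -> discrete_rv (fun w => [seq Z u w | u <- r]).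
Proof.
move=> dZ; elim: r => [|u r IH] v /=.
  have [->|v0] := eqVneq v [::].
    by rewrite (_ : _ @^-1` _ = setT) //; apply/seteqP.
  rewrite (_ : _ @^-1` _ = set0) //; apply/seteqP; split=> // w /= vE.
  by rewrite -vE eqxx in v0.
case: v => [|x v]; first by rewrite (_ : _ @^-1` _ = set0) //; apply/seteqP; split.
have -> : (fun w => Z u w :: [seq Z u0 w | u0 <- r]) @^-1` [set (x :: v)] =
    Z u @^-1` [set x] `&` (fun w => [seq Z u0 w | u0 <- r]) @^-1` [set v].
  by apply/seteqP; split=> w /= [-> ->].
by apply: measurableI; [exact: dZ|exact: IH].
Qed.

Lemma exists_atom (V : countType) (Y : T -> V) : discrete_rv Y ->
  exists v, (0 < P (Y @^-1` [set v]))%E.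
Proof.
move=> dY; apply: contrapT => h.
have h0 v : P (Y @^-1` [set v]) = 0%E.
  apply/eqP; rewrite eq_le measure_ge0 andbT leNgt; apply/negP => p0.
  by apply: h; exists v.
have : P setT = (0%:E * P setT)%E.
  by apply: (discrete_scale dY) => // v; rewrite setTI h0 mule0.
by rewrite probability_setT mul0e => /eqP; rewrite onee_eq0.
Qed.

End discrete_constructions.

(** * The law of the chain *)

Section switch_law.
Context (R : realType) (n : nat) (S : switch R n).
Local Notation P := (sw_prob S).
Local Notation X := (@sw_X R n S).
Local Notation p := (@sw_p R n S).

(** The Markov property is given conditionally on entire pasts, so it is
    summed over all pasts that end in x. *)
Lemma joint_law t x y :
  P (X t @^-1` [set x] `&` X t.+1 @^-1` [set y]) =
  ((p x y)%:E * P (X t @^-1` [set x]))%E.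
Proof.
have [[p0 p1] mk] := sw_markov S.
have dX := @sw_X_rv R n S.
(* the values of the chain up to time t, as one discrete random element *)
pose past w := [seq X u w | u <- iota 0 t.+1].
have dpast : discrete_rv past by exact: discrete_map.
have mx u z : measurable (X u @^-1` [set z]) by exact: dX.
apply: (discrete_scale dpast) => // [|v]; first exact: measurableI.
set A := X t @^-1` [set x]; set B := X t.+1 @^-1` [set y]; set H := past @^-1` _.
have [[w0 [Aw0 Hw0]]|h] := pselect (exists w, A w /\ H w); last first.
  have e0 : A `&` H = set0.
    by apply/seteqP; split=> // w [Aw Hw]; apply: h; exists w.
  by rewrite setIAC e0 set0I measure0 mule0.
have HE : H = [set w | forall u, (u <= t)%N -> X u w = X u w0].
  rewrite /H -Hw0; apply/seteqP; split=> w /=.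
    move=> E u ut; have := congr1 (fun s => nth (X u w) s u) E.
    have us : (u < size (iota 0 t.+1))%N by rewrite size_iota.
    by rewrite !(nth_map 0%N) // nth_iota.
  by move=> E; apply/eq_in_map => u; rewrite mem_iota => /andP[_ ut]; apply: E.
have AH : A `&` H = H.
  apply/seteqP; split=> [w []//|w Hw]; split => //.
  by move: Hw; rewrite HE => /(_ t (leqnn t)); rewrite /A /= => ->.
rewrite setIAC AH.
have mH : measurable H by exact: dpast.
have [PH0|PH0] := eqVneq (P H) 0%E.
  rewrite PH0 mule0; apply/eqP; rewrite eq_le measure_ge0 andbT -PH0.
  have mHB : measurable (H `&` B) by apply: measurableI => //; exact: mx.
  by apply: le_measure; [exact: mem_set|exact: mem_set|move=> w []].
have : cprob P B H = p (X t w0) y.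
  rewrite HE; apply: (mk t (fun u => X u w0) y); rewrite -HE.
  by rewrite lt0e PH0 measure_ge0.
rewrite Aw0 => <-.
have mHB : measurable (H `&` B) by apply: measurableI => //; exact: mx.
have PHE : P H = (fine (P H))%:E by rewrite fineK //; exact: fin_num_measure.
have PH0' : fine (P H) != 0 by apply: contra_neq PH0 => h; rewrite PHE h.
rewrite /cprob [B `&` H]setIC; move: PHE PH0'; set f := fine (P H) => -> f0.
by rewrite -EFinM divfK // fineK //; exact: fin_num_measure.
Qed.

(** Irreducibility speaks of transition probabilities; following a path of
    positive probability from an atom of X(0) shows that every state occurs at
    some time. *)
Lemma visit_pos x : irreducible p -> exists t, (0 < P (X t @^-1` [set x]))%E.
Proof.
move=> irr; have [[p0 p1] mk] := sw_markov S.
have [x0 Px0] := exists_atom P (@sw_X_rv R n S 0%N).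
have [j hj] := irr x0 x.
suff h i t z : (0 < nstep p i z x)%E -> (0 < P (X t @^-1` [set z]))%E ->
    exists t', (0 < P (X t' @^-1` [set x]))%E by exact: h hj Px0.
elim: i t z {hj j} => [|i IH] t z /=.
  rewrite lte_fin; case: eqP => [->|]; last by rewrite ltxx.
  by exists t.
move=> hs Pz; apply: contrapT => h.
suff : (\esum_(z0 in [set: sw_state S]) ((p z z0)%:E * nstep p i z0 x) = 0)%E.
  by move=> e0; rewrite e0 ltxx in hs.
apply: esum1 => y _; have [->|pzy] := eqVneq (p z y) 0; first by rewrite mul0e.
have Py : (0 < P (X t.+1 @^-1` [set y]))%E.
  apply: (@lt_le_trans _ _ (P (X t @^-1` [set z] `&` X t.+1 @^-1` [set y]))).
    by rewrite joint_law mule_gt0 // lte_fin lt_neqAle eq_sym pzy p0.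
  apply: le_measure; try apply: mem_set; try exact: sw_X_rv.
    by apply: measurableI; exact: sw_X_rv.
  by move=> w [].
have n0 : (0 <= nstep p i y x)%E.
  elim: i {IH hs h} y {pzy Py} => [|i IH] y /=; first by rewrite lee_fin ler0n.
  by apply: esum_ge0 => u _; rewrite mule_ge0 // lee_fin.
have [->|ny] := eqVneq (nstep p i y x) 0%E; first by rewrite mule0.
exfalso; apply: h; apply: (IH t.+1 y _ Py).
by rewrite lt0e ny n0.
Qed.

(** Properties that hold along all trajectories thereby become properties of
    the transition probabilities. *)
Lemma transition_witness x y : irreducible p -> 0 < p x y ->
  exists t w, X t w = x /\ X t.+1 w = y.
Proof.
move=> irr pxy; have [t Px] := visit_pos x irr; exists t.
have : (0 < P (X t @^-1` [set x] `&` X t.+1 @^-1` [set y]))%E.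
  by rewrite joint_law mule_gt0.
have [[w [wx wy]] _|h] := pselect (exists w, X t w = x /\ X t.+1 w = y).
  by exists w.
rewrite (_ : _ `&` _ = set0) ?measure0 ?ltxx //.
by apply/seteqP; split=> // w [wx wy]; apply: h; exists w.
Qed.

Lemma visit_witness x : irreducible p -> exists t w, X t w = x.
Proof.
move=> irr; have [t Px] := visit_pos x irr; exists t.
have [[w wx]|h] := pselect (exists w, X t w = x); first by exists w.
move: Px; rewrite (_ : _ @^-1` _ = set0) ?measure0 ?ltxx //.
by apply/seteqP; split=> // w wx; apply: h; exists w.
Qed.

End switch_law.

(** * The law of the arrivals *)

Section arrivals.
Context (R : realType) (n amax : nat) (lambda : 'M[R]_n) (S : switch R n).
Hypothesis arrivals : arrival_conditions S amax lambda.
Local Notation P := (sw_prob S).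
Local Notation a := (@sw_a R n S).

Lemma natm_surj (m : 'M[nat]_n) : (forall i j, (m i j <= amax)%N) ->
  exists b : 'M['I_amax.+1]_n, natm b = m.
Proof.
move=> mle; exists (\matrix_(i, j) inord (m i j)).
by apply/matrixP => i j; rewrite !mxE inordK // ltnS.
Qed.

Lemma natm_inj : injective (@natm n amax).
Proof.
move=> b b' /matrixP E; apply/matrixP => i j; apply: val_inj.
by have := E i j; rewrite !mxE.
Qed.

Lemma arrivals_natm t w : exists b : 'M['I_amax.+1]_n, natm b = a t w.
Proof. by apply: natm_surj => i j; exact: (arr_bounded arrivals). Qed.

(** Time 0 stands for all times, the law of the arrivals being the same in
    every slot. *)
Definition arrival_mass (b : 'M['I_amax.+1]_n) : R := fine (P (a 0%N @^-1` [set natm b])).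

Lemma arr_discrete i j t : discrete_rv (@arr R n S i j t).
Proof.
exact: (discrete_comp (fun m : 'M[nat]_n => m i j) (@sw_a_rv R n S t)).
Qed.

(** The joint law of the entries is the product of the marginal laws, and
    these do not depend on time. *)
Lemma arrivals_time_invariant t m : P (a t @^-1` [set m]) = P (a 0%N @^-1` [set m]).
Proof.
pose J : {fset 'I_n * 'I_n} := [fset ij in enum {: 'I_n * 'I_n}]%fset.
have hJ ij : ij \in J by rewrite inE mem_enum.
have h u : P (a u @^-1` [set m]) =
    (\prod_(ij <- J) P (arr ij.1 ij.2 u @^-1` [set m ij.1 ij.2]))%E.
  rewrite -(arr_indep_pairs arrivals).
    congr (P _); apply/seteqP; split=> w /=.
      by move=> E [i j] _ /=; rewrite /arr E.
    by move=> E; apply/matrixP => i j; exact: (E (i, j) (hJ _)).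
  move=> [i j] _ /=; apply: sub_sigma_algebra; exists u => //.
  by exists [set m i j] => //; rewrite setTI.
rewrite !h; apply: eq_bigr => ij _.
exact: (arr_ident arrivals).
Qed.

Lemma arrival_massE t b : P (a t @^-1` [set natm b]) = (arrival_mass b)%:E.
Proof.
rewrite arrivals_time_invariant fineK //; apply: fin_num_measure.
exact: sw_a_rv.
Qed.

Lemma arrival_mass_ge0 b : 0 <= arrival_mass b.
Proof. by rewrite -lee_fin -(arrival_massE 0%N) measure_ge0. Qed.

Lemma integral_arrivals t (phi : 'M[nat]_n -> R) : (forall m, 0 <= phi m) ->
  (\int[P]_w (phi (a t w))%:E = (\sum_b arrival_mass b * phi (natm b))%:E)%E.
Proof.
move=> phi0.
rewrite (integral_discrete_fin (@sw_a_rv R n S t)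
  (r := [seq natm b | b <- enum {: 'M['I_amax.+1]_n}])) //.
- rewrite big_map big_enum /= -sumEFin; apply: eq_bigr => b _.
  by rewrite setTI arrival_massE -EFinM mulrC.
- by rewrite map_inj_uniq ?enum_uniq //; exact: natm_inj.
- move=> m mr; rewrite setTI (_ : _ @^-1` _ = set0) ?measure0 //.
  apply/seteqP; split=> // w wm; move/negP: mr; apply.
  have [b bE] := arrivals_natm t w.
  by apply/mapP; exists b; rewrite ?mem_enum // bE.
Qed.

Let integral_one : (\int[P]_w 1%:E = 1)%E.
Proof. by rewrite (integral_cst P measurableT 1%:E) mul1e; exact: probability_setT. Qed.

Lemma arrival_mass_sum : \sum_b arrival_mass b = 1.
Proof.
have := @integral_arrivals 0%N (fun=> 1) (fun=> ler01).
rewrite integral_one => -[].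
by under eq_bigr do rewrite mulr1.
Qed.

Lemma arrival_mean i j : \sum_b arrival_mass b * (natm b i j)%:R = lambda i j.
Proof.
apply: EFin_inj; rewrite -(arr_mean arrivals i j 0%N).
rewrite expectation.unlock; symmetry.
by apply: (@integral_arrivals 0%N (fun m => (m i j)%:R)) => m.
Qed.

Definition arr_mass i j (u : nat) : R := fine (P (arr i j 0%N @^-1` [set u])).

Lemma arr_massE i j u : P (arr i j 0%N @^-1` [set u]) = (arr_mass i j u)%:E.
Proof. by rewrite fineK //; apply: fin_num_measure; exact: arr_discrete. Qed.

Lemma integral_arr i j (phi : nat -> R) : (forall m, 0 <= phi m) ->
  (\int[P]_w (phi (arr i j 0%N w))%:E =
   (\sum_(u <- iota 0 amax.+1) phi u * arr_mass i j u)%:E)%E.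
Proof.
move=> phi0.
rewrite (integral_discrete_fin (arr_discrete i j 0%N) (r := iota 0 amax.+1)) ?iota_uniq //.
- rewrite -sumEFin; apply: eq_bigr => u _.
  by rewrite setTI arr_massE -EFinM.
- move=> u ur; rewrite setTI (_ : _ @^-1` _ = set0) ?measure0 //.
  apply/seteqP; split=> // w wu; move/negP: ur; apply.
  by rewrite mem_iota /= ltnS -wu (arr_bounded arrivals).
Qed.

Lemma arr_mass_sum i j : \sum_(u <- iota 0 amax.+1) arr_mass i j u = 1.
Proof.
have := @integral_arr i j (fun=> 1) (fun=> ler01).
rewrite integral_one => -[].
by under eq_bigr do rewrite mul1r.
Qed.

Lemma arr_mass_mean i j :
  \sum_(u <- iota 0 amax.+1) u%:R * arr_mass i j u = lambda i j.
Proof.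
apply: EFin_inj; rewrite -(arr_mean arrivals i j 0%N).
rewrite expectation.unlock; symmetry.
by apply: (@integral_arr i j (fun m => m%:R)) => m.
Qed.

Definition arr_var i j : R := fine ('V_P[fun w => (arr i j 0%N w)%:R])%E.

Lemma arr_varE i j : ('V_P[fun w => (arr i j 0%N w)%:R])%E =
  (\sum_(u <- iota 0 amax.+1) (u%:R - lambda i j) ^+ 2 * arr_mass i j u)%:E.
Proof.
rewrite /variance covariance.unlock (arr_mean arrivals) /= expectation.unlock.
apply: (@integral_arr i j (fun u => (u%:R - lambda i j) ^+ 2)) => u.
exact: sqr_ge0.
Qed.

(** Equal pairs give the variance plus the squared mean, distinct pairs are
    independent. *)
Lemma arrival_moment2 i j i' j' :
  \sum_b arrival_mass b * ((natm b i j)%:R * (natm b i' j')%:R) =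
  lambda i j * lambda i' j' + (if (i == i') && (j == j') then arr_var i j else 0).
Proof.
apply: EFin_inj.
have ph0 (m : 'M[nat]_n) : 0 <= (m i j)%:R * (m i' j')%:R :> R by rewrite mulr_ge0.
transitivity (\int[P]_w ((a 0%N w i j)%:R * (a 0%N w i' j')%:R)%:E)%E.
  by symmetry; exact: (integral_arrivals 0%N ph0).
rewrite -[LHS]/(\int[P]_w ((arr i j 0%N w)%:R * (arr i' j' 0%N w)%:R)%:E)%E.
have [/andP[/eqP <- /eqP <-]|ne] := ifPn.
  have ph1 (u : nat) : 0 <= u%:R * u%:R :> R by rewrite mulr_ge0.
  rewrite (integral_arr i j ph1).
  congr (_)%:E; rewrite /arr_var arr_varE /=.
  set r := iota 0 amax.+1.
  have -> : \sum_(u <- r) (u%:R - lambda i j) ^+ 2 * arr_mass i j u =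
    \sum_(u <- r) u%:R * u%:R * arr_mass i j u
      - 2 * lambda i j * (\sum_(u <- r) u%:R * arr_mass i j u)
      + lambda i j ^+ 2 * (\sum_(u <- r) arr_mass i j u).
    rewrite !mulr_sumr -sumrB -big_split /=; apply: eq_bigr => u _; ring.
  by rewrite arr_mass_mean arr_mass_sum; ring.
pose Y (w : sw_sample S) := (arr i j 0%N w, arr i' j' 0%N w).
have dY : discrete_rv Y by apply: discrete_pair; exact: arr_discrete.
have joint u u' : P (Y @^-1` [set (u, u')]) = (arr_mass i j u * arr_mass i' j' u')%:E.
  pose J : {fset 'I_n * 'I_n} := [fset (i, j); (i', j')]%fset.
  pose A ij : set (sw_sample S) := if ij == (i, j) then arr i j 0%N @^-1` [set u]
     else arr i' j' 0%N @^-1` [set u'].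
  have ne' : (i', j') != (i, j).
    by apply: contra ne => /eqP[-> ->]; rewrite !eqxx.
  have := arr_indep_pairs arrivals (J := J) (A := A).
  rewrite (_ : \bigcap_(k in _) A k = Y @^-1` [set (u, u')]); last first.
    apply/seteqP; split=> w /=.
      move=> h; have := h (i, j); have := h (i', j').
      rewrite /A eqxx (negPf ne') /= !inE !eqxx orbT => /(_ isT) h1 /(_ isT) h2.
      by rewrite /Y h1 h2.
    move=> [wu wu'] k; rewrite /= !inE => /orP[|] /eqP ->.
      by rewrite /A eqxx.
    by rewrite /A (negPf ne').
  rewrite big_fsetU1 /=; last by rewrite inE eq_sym.
  rewrite big_seq_fset1 /A eqxx (negPf ne') !arr_massE -EFinM; apply.
  move=> k; rewrite !inE => /orP[|] /eqP ->; apply: sub_sigma_algebra; exists 0%N => //.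
    by rewrite eqxx; exists [set u] => //; rewrite setTI.
  by rewrite (negPf ne'); exists [set u'] => //; rewrite setTI.
pose r := [seq (u, u') | u <- iota 0 amax.+1, u' <- iota 0 amax.+1].
have ph2 (y : nat * nat) : 0 <= y.1%:R * y.2%:R :> R by rewrite mulr_ge0.
transitivity (\sum_(v <- r) (v.1%:R * v.2%:R : R)%:E * P (setT `&` Y @^-1` [set v]))%E.
  apply: (integral_discrete_fin dY measurableT _ ph2) => [|[u u'] ur].
    by rewrite allpairs_uniq ?iota_uniq // => -[? ?] [? ?].
  rewrite setTI (_ : _ @^-1` _ = set0) ?measure0 //.
  apply/seteqP; split=> // w [wu wu']; move/negP: ur; apply.
  apply/allpairsP; exists (u, u'); rewrite !mem_iota /= !ltnS -wu -wu'.
  by split=> //; exact: (arr_bounded arrivals).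
rewrite addr0 big_allpairs_dep /= -!arr_mass_mean mulr_suml -sumEFin.
apply: eq_bigr => u _; rewrite mulr_sumr -sumEFin; apply: eq_bigr => u' _.
by rewrite setTI joint -EFinM; congr (_)%:E; rewrite /=; ring.
Qed.

End arrivals.

(** * The transition kernel of the switch *)

Section kernel_of_switch.
Context (R : realType) (n amax : nat) (nu : 'M[R]_n) (e delta : R) (S : switch R n).
Local Notation P := (sw_prob S).
Local Notation E := (sw_state S).
Local Notation X := (@sw_X R n S).
Local Notation p := (@sw_p R n S).
Local Notation q := (@sw_q R n S).
Local Notation s := (@sw_s R n S).
Local Notation a := (@sw_a R n S).
Hypothesis arrivals : arrival_conditions S amax ((1 - e) *: nu).
Hypothesis A1 : condition_A1 S.
Hypothesis A2 : condition_A2 S.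
Hypothesis delta0 : 0 < delta.
Hypothesis max_prob : forall t, {ae P, forall w, delta <= cprob_given P
  [set w | frob_inner (natmx R (q t w)) (natmx R (s t w)) = max_weight R (q t w)]
  (@hist _ _ S t) w}.
Hypothesis memory : forall t w,
  frob_inner (natmx R (q t.+1 w)) (natmx R (s t.+1 w))
    >= frob_inner (natmx R (q t.+1 w)) (natmx R (s t w)).
Variable f : E -> 'M[nat]_n * 'M[nat]_n.
Hypothesis fE : forall t w, (q t w, s t w) = f (X t w).

Let irr : irreducible p. Proof. by case: A1. Qed.
Let mX t A : measurable (X t @^-1` A).
Proof. by apply: discrete_measurable; exact: sw_X_rv. Qed.

Lemma queue_of_state t w : q t w = (f (X t w)).1. Proof. by rewrite -fE. Qed.
Lemma schedule_of_state t w : s t w = (f (X t w)).2. Proof. by rewrite -fE. Qed.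

Lemma next_queueE t w : q t.+1 w = next_queue (q t w) (a t w) (s t w).
Proof. by apply/matrixP => i j; rewrite mxE sw_evolution. Qed.

(** X(t) is a function of the history up to s(t), which is independent of the
    arrivals in slot t. *)
Lemma causal_state t x A : P (X t @^-1` [set x] `&` a t @^-1` A) =
  (P (a t @^-1` A) * P (X t @^-1` [set x]))%E.
Proof.
rewrite setIC; apply: (arr_causal arrivals).
  by exists A => //; rewrite setTI.
by have [mh _ _] := A1; exact: mh.
Qed.

(** Given the state, the next queue is a function of the arrivals, which have
    finitely many values, and only finitely many states have a given queue. *)
Lemma successors_finite x : finite_set [set y | p x y != 0].
Proof.
have [g [gE gfin]] := A2; have [[p0 _] _] := sw_markov S.
pose B := (fun b : 'M['I_amax.+1]_n => next_queue (f x).1 (natm b) (f x).2) @` setT.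
have finB : finite_set B by apply: finite_image; exact: finite_finset.
apply: sub_finite_set (gfin _ finB) => y /= pxy.
have pxy0 : 0 < p x y by rewrite lt_neqAle eq_sym pxy p0.
have [t [w [wx wy]]] := transition_witness irr pxy0.
have [b bE] := arrivals_natm arrivals t w.
exists b => //.
by rewrite -wy -gE next_queueE bE queue_of_state schedule_of_state wx.
Qed.

Lemma finsupp_of_switch : exists k : finsupp_kernel R E, fk_p k = p.
Proof.
have [[p0 p1] _] := sw_markov S.
have fin x := cid (proj1 (finite_seqP _) (successors_finite x)).
have supp x y : p x y != 0 -> y \in undup (sval (fin x)).
  case: (fin x) => r /= rE pxy; rewrite mem_undup.
  by have : [set y | p x y != 0] y by []; rewrite rE.
have sum1 x : \sum_(y <- undup (sval (fin x))) p x y = 1.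
  apply: EFin_inj; rewrite -(p1 x) -sumEFin; apply/esym/esum_seq.
  - exact: undup_uniq.
  - by move=> y; rewrite lee_fin.
  - move=> y yr; congr EFin; apply/eqP; apply: contraNT yr; exact: supp.
by exists (FinsuppKernel (fun x => undup_uniq _) p0 supp sum1).
Qed.

Section with_kernel.
Variable k : finsupp_kernel R E.
Hypothesis kp : fk_p k = p.

Lemma integral_next_state t x (phi : E -> R) : (forall y, 0 <= phi y) ->
  (\int[P]_(w in X t @^-1` [set x]) (phi (X t.+1 w))%:E =
   (step k phi x)%:E * P (X t @^-1` [set x]))%E.
Proof.
move=> phi0.
rewrite (integral_discrete_fin (@sw_X_rv R n S t.+1) (mX t [set x]) (fk_uniq k x) phi0).
  rewrite /step -sumEFin ge0_sume_distrl.
    apply: eq_bigr => y _; rewrite joint_law -kp muleA; congr (_ * _)%E.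
    by rewrite -EFinM mulrC.
  by move=> y _; rewrite lee_fin mulr_ge0 // fk_ge0.
move=> y yx; rewrite joint_law -kp.
have [->|/fk_supp] := eqVneq (k x y) 0; first by rewrite mul0e.
by rewrite (negPf yx).
Qed.

Lemma integral_next_queue t x (psi : 'M[nat]_n -> R) : (forall m, 0 <= psi m) ->
  (\int[P]_(w in X t @^-1` [set x]) (psi (q t.+1 w))%:E =
   (\sum_b arrival_mass S b * psi (next_queue (f x).1 (@natm n amax b) (f x).2))%:E
     * P (X t @^-1` [set x]))%E.
Proof.
move=> psi0.
pose phi m := psi (next_queue (f x).1 m (f x).2).
have phi0 m : 0 <= phi m by exact: psi0.
transitivity (\int[P]_(w in X t @^-1` [set x]) (phi (a t w))%:E)%E.
  apply: eq_integral => w /set_mem /= wx.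
  by rewrite next_queueE queue_of_state schedule_of_state wx.
rewrite (integral_discrete_fin (r := [seq natm b | b <- enum {: 'M['I_amax.+1]_n}])
  (@sw_a_rv R n S t) (mX t [set x]) _ phi0).
- rewrite big_map big_enum /= -sumEFin ge0_sume_distrl.
    apply: eq_bigr => b _; rewrite causal_state (arrival_massE arrivals) muleA.
    by rewrite -EFinM mulrC.
  by move=> b _; rewrite lee_fin mulr_ge0 // (arrival_mass_ge0 arrivals).
- by rewrite map_inj_uniq ?enum_uniq //; exact: natm_inj.
- move=> m mr; rewrite (_ : _ `&` _ = set0) ?measure0 //.
  apply/seteqP; split=> // w [_ wm]; move/negP: mr; apply.
  have [b bE] := arrivals_natm arrivals t w.
  by apply/mapP; exists b; rewrite ?mem_enum // bE.
Qed.

(** For nonnegative psi both sides are the mean of psi (q(t+1)) on the event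
    X(t) = x, divided by the probability of that event, where t is a time at
    which x is visited. The general case is a difference of two such. *)
Lemma step_queue_law (psi : 'M[nat]_n -> R) x :
  step k (fun y => psi (f y).1) x =
  \sum_b arrival_mass S b * psi (next_queue (f x).1 (@natm n amax b) (f x).2).
Proof.
have [t Px] := visit_pos x irr.
have pos (g : 'M[nat]_n -> R) : (forall m, 0 <= g m) ->
    step k (fun y => g (f y).1) x =
    \sum_b arrival_mass S b * g (next_queue (f x).1 (@natm n amax b) (f x).2).
  move=> g0; apply: EFin_inj.
  have h := integral_next_state t x (fun y => g0 (f y).1).
  have h2 := integral_next_queue t x g0.
  have : ((step k (fun y => g (f y).1) x)%:E * P (X t @^-1` [set x]) =
    (\sum_b arrival_mass S b * g (next_queue (f x).1 (@natm n amax b) (f x).2))%:E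
     * P (X t @^-1` [set x]))%E.
    rewrite -h -h2; apply: eq_integral => w _.
    by rewrite queue_of_state.
  have Pfin : P (X t @^-1` [set x]) \is a fin_num by apply: fin_num_measure; exact: mX.
  rewrite -(fineK Pfin) -!EFinM => -[] /mulIf h3; congr (_%:E); apply: h3.
  by rewrite gt_eqF // fine_gt0 // Px ltey_eq Pfin.
pose gp m := Num.max (psi m) 0; pose gm m := Num.max (- psi m) 0.
have psiE m : psi m = gp m - gm m.
  by rewrite /gp /gm; case: (ltP (psi m) 0); case: (ltP (- psi m) 0); lra.
have -> : (fun y => psi (f y).1) = (fun y => gp (f y).1 - gm (f y).1).
  by apply/funext => y; exact: psiE.
rewrite (moB (step_markov k)) !pos.
- by rewrite -sumrB; apply: eq_bigr => b _; rewrite psiE mulrBr.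
- by move=> m; rewrite le_max lexx orbT.
- by move=> m; rewrite le_max lexx orbT.
Qed.

(** The history conditioned upon in slot t.+1 contains the one that determines
    the state at time t. *)
Lemma hist_tilde_of_hist t w w' : @hist R n S t.+1 w = @hist R n S t.+1 w' ->
  @hist_tilde R n S t w = @hist_tilde R n S t w'.
Proof.
move=> h.
have hq : [seq q u w | u <- iota 0 t.+2] = [seq q u w' | u <- iota 0 t.+2].
  exact: (congr1 fst h).
have hs : [seq s u w | u <- iota 0 t.+1] = [seq s u w' | u <- iota 0 t.+1].
  exact: (congr1 snd h).
rewrite /hist_tilde hs; congr (_, _).
apply/eq_in_map => u ut; move/eq_in_map: hq; apply.
by rewrite -[t.+2]addn1 iotaD mem_cat ut.
Qed.

(** The event X(t) = x is a disjoint union of events on which the history up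
    to q(t+1) is fixed; the conditional bound delta holds on each of them that
    has positive probability. *)
Lemma step_max_weight x :
  delta <= step k (fun y => (gap R (f y).1 (f y).2 == 0)%:R) x.
Proof.
have [t Px] := visit_pos x irr.
pose phi (y : E) : R := (gap R (f y).1 (f y).2 == 0)%:R.
have phi0 y : 0 <= phi y by exact: ler0n.
pose M := [set w |
  frob_inner (natmx R (q t.+1 w)) (natmx R (s t.+1 w)) = max_weight R (q t.+1 w)].
have ME : M = X t.+1 @^-1` [set y | gap R (f y).1 (f y).2 == 0].
  apply/seteqP; split=> w; rewrite /M /= -queue_of_state -schedule_of_state /gap.
    by move=> ->; rewrite subrr.
  by rewrite subr_eq0 => /eqP.
have mM : measurable M by rewrite ME; exact: mX.
have hI : (\int[P]_(w in X t @^-1` [set x]) (phi (X t.+1 w))%:E =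
    P (M `&` X t @^-1` [set x]))%E.
  rewrite -integral_indic //; apply: eq_integral => w _.
  rewrite indicE ME /phi; congr ((nat_of_bool _)%:R)%:E.
  by apply/idP/idP => [h|/set_mem //]; exact: mem_set.
rewrite integral_next_state // in hI.
have dh : discrete_rv (@hist R n S t.+1).
  by apply: discrete_pair; apply: discrete_map => u; [exact: sw_q_rv|exact: sw_s_rv].
have main : (delta%:E * P (X t @^-1` [set x]) <= P (M `&` X t @^-1` [set x]))%E.
  apply: (discrete_scale_le dh) => [||//|h]; first exact: measurableI.
  - exact: mX.
  - exact: ltW.
  set H := @hist R n S t.+1 @^-1` [set h]; set A := X t @^-1` [set x].
  have mH : measurable H by exact: dh.
  have mA : measurable A by exact: mX.
  have [[w0 [Aw0 Hw0]]|no] := pselect (exists w, A w /\ H w); last first.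
    rewrite (_ : A `&` H = set0) ?measure0 ?mule0 ?measure_ge0 //.
    by apply/seteqP; split=> // w [Aw Hw]; apply: no; exists w.
  have HA : H `<=` A.
    have [mh _ _] := A1; have [B _ BE] := mh t [set x].
    move=> w Hw; rewrite /A -BE; split=> //=.
    rewrite (@hist_tilde_of_hist t w w0); last by rewrite Hw Hw0.
    by move: Aw0; rewrite /A -BE => -[].
  have -> : A `&` H = H by apply/seteqP; split=> [w []//|w Hw]; split=> //; exact: HA.
  have -> : M `&` A `&` H = M `&` H.
    apply/seteqP; split=> [w [[Mw _] Hw]//|w [Mw Hw]]; split=> //; split=> //; exact: HA.
  have [PH0|PH0] := eqVneq (P H) 0%E; first by rewrite PH0 mule0 measure_ge0.
  have [N [mN PN hN]] := max_prob t.+1.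
  have [w [Hw Nw]] : exists w, H w /\ ~ N w.
    apply: contrapT => no; move/eqP: PH0; apply; apply/eqP.
    rewrite eq_le measure_ge0 andbT -PN; apply: le_measure; try exact: mem_set.
    by move=> w Hw; apply: contrapT => Nw; apply: no; exists w.
  have : delta <= cprob_given P M (@hist _ _ S t.+1) w.
    by apply: contrapT => h1; apply: Nw; exact: hN.
  have HE : @hist R n S t.+1 @^-1` [set @hist R n S t.+1 w] = H by rewrite Hw.
  rewrite /cprob_given HE /cprob.
  have PHf : P H \is a fin_num by exact: fin_num_measure.
  have PMH : P (M `&` H) \is a fin_num by apply: fin_num_measure; exact: measurableI.
  rewrite ler_pdivlMr; last by rewrite fine_gt0 // lt0e PH0 measure_ge0 ltey_eq PHf.
  by rewrite -lee_fin EFinM !fineK.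
rewrite -hI in main.
have Pfin : P (X t @^-1` [set x]) \is a fin_num by apply: fin_num_measure; exact: mX.
move: main; rewrite -(fineK Pfin) -!EFinM lee_fin ler_pM2r //.
by rewrite fine_gt0 // Px ltey_eq Pfin.
Qed.

Lemma expectation_iter t (phi : E -> R) : (forall y, 0 <= phi y) ->
  (\int[P]_w (phi (X t w))%:E = \int[P]_w (iter t (step k) phi (X 0%N w))%:E)%E.
Proof.
have mf t0 (g : E -> R) : measurable_fun [set: sw_sample S] (fun w => (g (X t0 w))%:E).
  by apply/measurable_EFinP; apply: discrete_measurable_fun; exact: sw_X_rv.
elim: t phi => [//|t IH] phi phi0.
have s0 y : 0 <= step k phi y by exact: (mo_ge0 (step_markov k)).
rewrite iterSr -IH //.
apply: (eq_integral_discrete (@sw_X_rv R n S t)) => //.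
- by move=> w; rewrite lee_fin.
- by move=> w; rewrite lee_fin.
move=> x; rewrite integral_next_state //.
rewrite -(integral_cst P (mX t [set x]) (step k phi x)%:E).
by apply: eq_integral => w /set_mem /= ->.
Qed.

End with_kernel.

(** Passes from the probability space to transition probabilities: statements
    about trajectories apply to states and transitions because all of these
    occur with positive probability. *)
Theorem kernel_of_switch :
  exists k : switch_kernel amax nu (\matrix_(i, j) arr_var S i j) e delta E,
  fk_p k = p /\ forall x, sk_q k x = (f x).1.
Proof.
have [k kp] := finsupp_of_switch.
have [g [gE gfin]] := A2.
have fperm x : is_perm_mx (f x).2.
  by have [t [w <-]] := visit_witness x irr; rewrite -schedule_of_state sw_s_perm.
have ffin (A : set 'M[nat]_n) : finite_set A -> finite_set ((fun x => (f x).1) @^-1` A).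
  move=> /gfin; apply: sub_finite_set => x /=.
  have [t [w <-]] := visit_witness x irr.
  by rewrite -queue_of_state gE.
have irrk : irreducible k by rewrite kp.
have aperk : aperiodic k by rewrite kp; case: A1.
have mean i j : \sum_b arrival_mass S b * (@natm n amax b i j)%:R = (1 - e) * nu i j.
  by rewrite (arrival_mean arrivals) mxE.
have mom i j i' j' :
    \sum_b arrival_mass S b * ((@natm n amax b i j)%:R * (@natm n amax b i' j')%:R) =
    ((1 - e) * nu i j) * ((1 - e) * nu i' j')
      + (if (i == i') && (j == j') then (\matrix_(i, j) arr_var S i j) i j else 0).
  by rewrite (arrival_moment2 arrivals) !mxE.
have mem x y : 0 < k x y ->
    frob_inner (natmx R (f y).1) (natmx R (f x).2) <=
    frob_inner (natmx R (f y).1) (natmx R (f y).2).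
  rewrite kp => kxy.
  have [t [w [<- <-]]] := transition_witness irr kxy.
  by rewrite -!queue_of_state -!schedule_of_state.
by exists (SwitchKernel irrk aperk fperm ffin (@arrival_mass_ge0 R n amax _ S arrivals)
  (arrival_mass_sum arrivals) mean mom (step_queue_law kp) mem (step_max_weight kp)).
Qed.

End kernel_of_switch.

(** * The steady state *)

(** A series of weighted Dirac measures. *)
Lemma probability_of_masses (R : realType) (w : nat -> R) :
  (forall k, 0 <= w k) -> (\sum_(0 <= k <oo) (w k)%:E = 1)%E ->
  exists P : probability nat R, forall f : nat -> \bar R, (forall k, (0 <= f k)%E) ->
    (\int[P]_k f k = \sum_(0 <= k <oo) ((w k)%:E * f k))%E.
Proof.
move=> w0 w1.
pose m k : {measure set nat -> \bar R} := mscale (NngNum (w0 k)) (@dirac _ nat k R).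
pose mu : {measure set nat -> \bar R} := mseries m 0.
have muT : mu setT = 1%E.
  rewrite -w1 /mu /= /mseries; apply: eq_eseriesr => k _.
  by rewrite /m /= /mscale /= diracT mule1.
pose Pm := Measure_isProbability.Build _ _ _ mu muT.
pose P : probability nat R := HB.pack_for (probability nat R) (Measure.sort mu) Pm.
exists P => f f0.
rewrite -[LHS]/(\int[mu]_k f k)%E.
rewrite ge0_integral_measure_series //.
apply: eq_eseriesr => k _.
by rewrite ge0_integral_mscale // integral_dirac // diracT mul1e.
Qed.

Section steady.
Context (R : realType) (n amax : nat) (nu v : 'M[R]_n) (e delta : R) (S : switch R n).
Local Notation P := (sw_prob S).
Local Notation E := (sw_state S).
Local Notation X := (@sw_X R n S).
Variable k : switch_kernel amax nu v e delta E.
Hypothesis kp : fk_p k = @sw_p R n S.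
Hypothesis qE : forall t w, sw_q t w = sk_q k (X t w).
Hypotheses (n0 : (0 < n)%N) (nuds : doubly_stochastic nu).
Hypotheses (nu0 : forall i j, 0 < nu i j).
Hypotheses (d0 : 0 < delta) (d1 : delta <= 1) (e0 : 0 < e).

Let x0 : E. Proof. by have [x _] := cid (exists_atom P (@sw_X_rv R n S 0%N)). Qed.

Let mX t (phi : E -> R) : measurable_fun [set: sw_sample S] (fun w => (phi (X t w))%:E).
Proof.
by apply/measurable_EFinP; apply: discrete_measurable_fun; exact: sw_X_rv.
Qed.

Let intX t (phi : E -> R) M : (forall x, `|phi x| <= M) ->
  P.-integrable [set: sw_sample S] (fun w => (phi (X t w))%:E).
Proof.
move=> bphi; apply: measurable_bounded_integrable => //.
- by rewrite (le_lt_trans (probability_le1 P measurableT)) // ltry.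
- by apply: discrete_measurable_fun; exact: sw_X_rv.
- exists M; split; first exact: num_real.
  by move=> y My w _ /=; apply: le_trans (bphi _) (ltW My).
Qed.

(** The expectation at time t is the mean over X(0) of the t-th iterate of
    phi, which converges boundedly at each point. Adding M makes the function
    nonnegative, as needed for the expression through iterates. *)
Lemma bounded_law_cvg (phi : E -> R) M l : (forall x, `|phi x| <= M) ->
  attracts k phi l ->
  ('E_P[fun w => phi (X t w)])%E @[t --> \oo] --> l%:E.
Proof.
move=> bphi hl.
have M0 : 0 <= M by apply: le_trans (bphi x0).
have bM (x : E) : `|M| <= M by rewrite ger0_norm.
pose psi x := 1 * phi x + 1 * M.
have hpsi : attracts k psi (1 * l + 1 * M).
  by apply: attracts_lin => //; exact: attracts_cst.
have psi0 x : 0 <= psi x.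
  by have := bphi x; rewrite /psi !mul1r ler_norml => /andP[h _]; rewrite -lerBlDr sub0r.
have psiM x : psi x <= 2 * M.
  have := bphi x; rewrite /psi !mul1r ler_norml => /andP[_ h].
  by rewrite mulr_natl mulr2n lerD2r.
have ppos t x : 0 <= iter t (step k) psi x.
  exact: (mo_ge0 (markov_op_iter t (step_markov k))).
have psiEx t : ('E_P[fun w => phi (X t w)] =
    \int[P]_w (iter t (step k) psi (X 0%N w))%:E - M%:E)%E.
  rewrite -(expectation_iter kp t psi0) expectation.unlock.
  have -> : (\int[P]_w (psi (X t w))%:E =
      \int[P]_w (phi (X t w))%:E + \int[P]_w (cst M%:E) w)%E.
    rewrite -integralD //; first last.
    - exact: (intX t (phi := fun=> M) bM).
    - exact: intX bphi.
    by apply: eq_integral => w _; rewrite /psi !mul1r.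
  rewrite integral_cst // [X in (_ * X)%E]probability_setT mule1 addeK //.
rewrite (_ : (fun t => _) = fun t =>
  (\int[P]_w (iter t (step k) psi (X 0%N w))%:E - M%:E)%E); last exact/funext.
rewrite (_ : l%:E = ((l + M)%:E - M%:E)%E); last by rewrite -EFinB addrK.
apply: cvgeB; [by []| |exact: cvg_cst].
have -> : (l + M)%:E = (\int[P]_w (cst (l + M)%:E w))%E.
  by rewrite integral_cst // [X in (_ * X)%E]probability_setT mule1.
have mt t := markov_op_iter t (step_markov k).
have iM t x : iter t (step k) psi x <= 2 * M.
  by rewrite -[leRHS](mo_cstx (mt t) _ x); apply: (mo_le (mt t)).
have hcv : {ae P, forall w, [set: sw_sample S] w ->
    (iter t (step k) psi (X 0%N w))%:E @[t --> \oo] --> cst (l + M)%:E w}.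
  apply: aeW => w _; apply: cvg_EFin; first by near=> t.
  by have := hpsi (X 0%N w); rewrite !mul1r.
have hg : {ae P, forall w, forall t, [set: sw_sample S] w ->
    (`|(iter t (step k) psi (X 0%N w))%:E| <= cst (2 * M)%:E w)%E}.
  by apply: aeW => w t _; rewrite abse_EFin lee_fin ger0_norm.
have ig : P.-integrable [set: sw_sample S] (cst (2 * M)%:E).
  apply: (intX 0 (phi := fun=> 2 * M) (M := 2 * M)) => x.
  by rewrite ger0_norm // mulr_ge0.
have [_ _ h] := dominated_convergence measurableT (fun t => mX 0 (iter t (step k) psi))
  (measurable_cst _) hcv ig hg.
exact: h.
Unshelve. all: by end_near. Qed.

Lemma equilibrium_poly (phi : E -> R) c r :
  (forall x, `|phi x| <= c * (1 + frob_norm (natmx R (sk_q k x))) ^+ r) ->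
  exists l, attracts k phi l.
Proof. exact: (equilibrium n0 nuds nu0 d0 d1 k x0 e0).2. Qed.

Lemma equilibrium_bounded (phi : E -> R) M : (forall x, `|phi x| <= M) ->
  exists l, attracts k phi l.
Proof.
move=> bphi; apply: (@equilibrium_poly phi M 0) => x.
by rewrite expr0 mulr1.
Qed.

Lemma steady_bounded qbar (h : 'M[nat]_n -> R) M l : steady_state S qbar ->
  (forall m, `|h m| <= M) -> attracts k (fun x => h (sk_q k x)) l ->
  ('E_(rm_prob qbar)[fun w => h (qbar w)] = l%:E)%E.
Proof.
move=> ss bh hl.
have h1 := ss h (ex_intro _ M bh).
have h2 := bounded_law_cvg (phi := fun x => h (sk_q k x)) (fun x => bh _) hl.
have E12 : (fun t => 'E_P[fun w => h (sw_q t w)])%E =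
    (fun t => 'E_P[fun w => h (sk_q k (X t w))])%E.
  by apply/funext => t; congr expectation; apply/funext => w; rewrite qE.
rewrite E12 in h1.
by rewrite -(cvg_lim _ h1) // (cvg_lim _ h2).
Qed.

(** A limit in distribution controls only bounded functions. Truncating h at N
    costs at most h^2 / N, whose equilibrium value is finite since h^2 also
    has polynomial growth, so the truncated expectations increase to l;
    monotone convergence identifies their limit on the side of the steady
    state. *)
Lemma steady_moment qbar (h : 'M[nat]_n -> R) c r : steady_state S qbar ->
  (forall m, 0 <= h m) ->
  (forall m, h m <= c * (1 + frob_norm (natmx R m)) ^+ r) ->
  exists l, attracts k (fun x => h (sk_q k x)) l /\
    ('E_(rm_prob qbar)[fun w => h (qbar w)] = l%:E)%E.
Proof.
move=> ss h0 hc.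
have [l hl] : exists l, attracts k (fun x => h (sk_q k x)) l.
  by apply: (@equilibrium_poly _ c r) => x; rewrite ger0_norm.
have [l2 hl2] : exists l2, attracts k (fun x => h (sk_q k x) ^+ 2) l2.
  apply: (@equilibrium_poly _ (c ^+ 2) (r * 2)%N) => x.
  rewrite normrX exprM -exprMn; apply: lerXn2r; rewrite ?nnegrE //.
    exact: le_trans (h0 _) (hc (sk_q k x)).
  by rewrite ger0_norm.
pose hN (N : nat) m := Num.min (h m) N%:R.
have hN0 N m : 0 <= hN N m by rewrite le_min h0 /=.
have hNb N m : `|hN N m| <= N%:R by rewrite ger0_norm // ge_min lexx orbT.
have /choice[lN hlN] : forall N, exists l, attracts k (fun x => hN N (sk_q k x)) l.
  by move=> N; apply: (@equilibrium_bounded _ N%:R).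
have EN N : ('E_(rm_prob qbar)[fun w => hN N (qbar w)] = (lN N)%:E)%E.
  exact: (steady_bounded ss (hNb N) (hlN N)).
have lNl N : lN N <= l.
  by refine (attracts_le x0 (hlN N) hl _) => x; rewrite ge_min lexx.
have l20 : 0 <= l2.
  apply: (attracts_le x0 (attracts_cst k (c := 0)) hl2) => x.
  exact: sqr_ge0.
have llN N : l <= 1 * lN N.+1 + N.+1%:R^-1 * l2.
  have a2 := attracts_lin (a := 1) (b := N.+1%:R^-1) (hlN N.+1) hl2.
  apply: (attracts_le x0 hl a2) => x; rewrite mul1r /hN.
  move: (h _) (h0 (sk_q k x)) => z z0.
  have NN : 0 < N.+1%:R :> R by rewrite ltr0n.
  have p : 0 <= N.+1%:R^-1 * z ^+ 2.
    by rewrite mulr_ge0 ?sqr_ge0 // invr_ge0 ltW.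
  have [zN|Nz] := leP z N.+1%:R; first by rewrite lerDl.
  apply: (@le_trans _ _ (N.+1%:R^-1 * z ^+ 2)); last by rewrite lerDr ltW.
  by rewrite ler_pdivlMl // expr2 ler_wpM2r // ltW.
have lNcvg : lN N.+1 @[N --> \oo] --> l.
  have s1 : l - l2 * N.+1%:R^-1 @[N --> \oo] --> l.
    rewrite -[X in _ --> X]subr0 -[X in _ - X](mulr0 l2).
    apply: cvgB; first exact: cvg_cst.
    by apply: cvgMl_tmp; exact: cvg_harmonic.
  apply: (squeeze_cvgr _ s1 (cvg_cst l)); near=> N; rewrite lNl andbT lerBlDr.
  by have := llN N; rewrite mul1r [l2 * _]mulrC.
exists l; split => //.
have dq := @rm_rv R n qbar.
have mh (g : 'M[nat]_n -> R) : measurable_fun [set: rm_sample qbar] (fun w => (g (qbar w))%:E).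
  by apply/measurable_EFinP; exact: discrete_measurable_fun.
have mono := @cvg_monotone_convergence _ _ R (rm_prob qbar) [set: rm_sample qbar]
  measurableT (fun N w => (hN N.+1 (qbar w))%:E) (fun N => mh (hN N.+1)).
have g0 N w : [set: rm_sample qbar] w -> (0 <= (hN N.+1 (qbar w))%:E)%E.
  by move=> _; rewrite lee_fin.
have nd w : [set: rm_sample qbar] w -> nondecreasing_seq (fun N => (hN N.+1 (qbar w))%:E).
  move=> _ N N' NN; rewrite lee_fin /hN le_min !ge_min lexx /= ler_nat ltnS NN.
  by rewrite orbT.
have {}mono := mono g0 nd.
have limE : (fun w => limn (fun N => (hN N.+1 (qbar w))%:E)) = (fun w => (h (qbar w))%:E).
  apply/funext => w; apply/cvg_lim => //.
  have [N0 hN0'] : exists N : nat, h (qbar w) < N%:R.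
    by exists (Num.truncn (h (qbar w))).+1; exact: truncnS_gt.
  apply: cvg_near_cst; near=> N; congr EFin; apply/min_idPl.
  apply: (le_trans (ltW hN0')); rewrite ler_nat.
  by apply: leqW; near: N; exists N0.
rewrite limE in mono.
rewrite expectation.unlock -(cvg_lim _ mono) //.
apply/cvg_lim => //.
have -> : (fun N => \int[rm_prob qbar]_w (hN N.+1 (qbar w))%:E)%E = (fun N => (lN N.+1)%:E).
  by apply/funext => N; rewrite -EN expectation.unlock.
by apply: cvg_EFin => //; near=> N.
Unshelve. all: by end_near. Qed.

Section existence.

Definition queue_ind m : E -> R := fun x => (sk_q k x == m)%:R.

(** Transports the law from matrices to natural numbers; numbers that encode
    no matrix carry no mass. *)
Definition matrix_at (j : nat) : 'M[nat]_n := odflt (const_mx 0%N) (choice.pickle_inv j).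

(** The limits of the point masses are the candidate law. No mass escapes:
    only finitely many queues have norm at most N, and the others have
    equilibrium mass at most 1 / N times the mean norm of the queue. *)
Lemma steady_state_exists : exists qbar, steady_state S qbar.
Proof.
have /choice[pi hpi] : forall m, exists l, attracts k (queue_ind m) l.
  move=> m; apply: (@equilibrium_bounded _ 1) => x.
  by rewrite /queue_ind ger0_norm //; case: (_ == _).
have pi0 m : 0 <= pi m.
  apply: (attracts_le x0 (attracts_cst k (c := 0)) (hpi m)) => x.
  by rewrite /queue_ind.
pose w j := if choice.pickle_inv j is Some m then pi m else 0.
have w0 j : 0 <= w j by rewrite /w; case: choice.pickle_inv.
have [lq hlq] : exists lq, attracts k (fun x => frob_norm (natmx R (sk_q k x))) lq.
  apply: (@equilibrium_poly _ 1 1%N) => x; rewrite expr1 mul1r.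
  by rewrite ger0_norm ?frob_norm_ge0 // lerDr.
have total_mass (h : 'M[nat]_n -> R) M l : (forall m, 0 <= h m) ->
    (forall m, h m <= M) -> attracts k (fun x => h (sk_q k x)) l ->
    (\sum_(0 <= j <oo) ((w j)%:E * (h (matrix_at j))%:E) = l%:E)%E.
  move=> h0 hM hl.
  pose g (K : nat) x := if (choice.pickle (sk_q k x) < K)%N then h (sk_q k x) else 0.
  pose Sm (K : nat) := \sum_(0 <= j < K) w j * h (matrix_at j).
  have gS K : attracts k (g K) (Sm K).
    elim: K => [|K IH].
      rewrite /Sm big_geq // (_ : g 0%N = fun=> 0); first exact: attracts_cst.
      by apply/funext => x; rewrite /g ltn0.
    rewrite /Sm big_nat_recr //= -/(Sm K).
    pose tm x := if choice.pickle (sk_q k x) == K then h (sk_q k x) else 0.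
    have -> : g K.+1 = fun x => 1 * g K x + 1 * tm x.
      apply/funext => x; rewrite /g /tm !mul1r ltnS leq_eqVlt.
      by case: ltngtP => //= _; rewrite ?addr0 ?add0r.
    rewrite -[Sm K]mul1r -[w K * _]mul1r; apply: attracts_lin => //.
    rewrite /w /matrix_at; case Em : (choice.pickle_inv K) => [m|] /=; last first.
      rewrite mul0r (_ : tm = fun=> 0); first exact: attracts_cst.
      apply/funext => x; rewrite /tm; case: eqP => // xK.
      by rewrite -xK choice.pickleK_inv in Em.
    have mK : choice.pickle m = K.
      by have := choice.pickle_invK (T := 'M[nat]_n) K; rewrite Em.
    rewrite (_ : tm = fun x => h m * queue_ind m x + 0 * queue_ind m x); last first.
      apply/funext => x; rewrite /tm /queue_ind mul0r addr0 -mK.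
      rewrite (inj_eq (pcan_inj choice.pickleK)).
      by case: eqP => [->|_]; rewrite ?mulr1 ?mulr0.
    rewrite (_ : pi m * h m = h m * pi m + 0 * pi m); last by ring.
    exact: attracts_lin.
  have Sl K : Sm K <= l.
    apply: (attracts_le x0 (gS K) hl) => x; rewrite /g.
    by case: ifP.
  have M0 : 0 <= M by exact: le_trans (h0 (const_mx 0%N)) (hM _).
  have lq0 : 0 <= lq.
    apply: (attracts_le x0 (attracts_cst k (c := 0)) hlq) => x.
    exact: frob_norm_ge0.
  have lS N : exists K0, forall K, (K0 <= K)%N -> l <= 1 * Sm K + M / N.+1%:R * lq.
    have /finite_seqP[r rE] := finite_bounded_natmx n (N.+1%:R : R).
    (* from this K on, the matrices not yet counted have norm above N.+1 *)
    exists (\max_(m <- r) choice.pickle m).+1 => K KK.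
    have a2 := attracts_lin (a := 1) (b := M / N.+1%:R) (gS K) hlq.
    apply: (attracts_le x0 hl a2) => x; rewrite mul1r /g.
    have NN : 0 < N.+1%:R :> R by rewrite ltr0n.
    have p : 0 <= M / N.+1%:R by rewrite divr_ge0.
    have f0 := frob_norm_ge0 (natmx R (sk_q k x)).
    case: ifPn => [_|]; first by rewrite lerDl mulr_ge0.
    rewrite -leqNgt add0r => Kx.
    have qN : N.+1%:R < frob_norm (natmx R (sk_q k x)).
      rewrite ltNge; apply/negP => qx.
      have qr : sk_q k x \in r.
        have : [set m | frob_norm (natmx R m) <= N.+1%:R] (sk_q k x) by [].
        by rewrite rE.
      have := leq_trans KK Kx; rewrite ltnNge.
      by rewrite (leq_bigmax_seq (F := fun m : 'M[nat]_n => choice.pickle m) (sk_q k x) qr).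
    apply: le_trans (hM _) _; rewrite mulrAC ler_pdivlMr //.
    by rewrite ler_wpM2l // ltW.
  have Scvg : Sm K @[K --> \oo] --> l.
    apply/cvgrPdist_le => eps eps0.
    pose N := Num.truncn (M * lq / eps).
    have [K0 hK0] := lS N.
    exists K0 => // K /= KK; rewrite ger0_norm ?subr_ge0 //.
    have := hK0 K KK; rewrite mul1r => h1.
    have h2 : M / N.+1%:R * lq <= eps.
      rewrite mulrAC ler_pdivrMr ?ltr0n // [eps * _]mulrC -ler_pdivrMr //.
      by apply: ltW; exact: truncnS_gt.
    by rewrite lerBlDl; apply: le_trans h1 _; rewrite lerD2l.
  have -> : (fun K => \sum_(0 <= j < K) ((w j)%:E * (h (matrix_at j))%:E))%E =
      (fun K => (Sm K)%:E).
    by apply/funext => K; rewrite /Sm -sumEFin; apply: eq_bigr => j _; rewrite EFinM.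
  by apply/cvg_lim => //; apply: cvg_EFin => //; near=> K.
have w1 : (\sum_(0 <= j <oo) (w j)%:E = 1)%E.
  rewrite -(total_mass (fun=> 1) 1 1) //; last exact: attracts_cst.
  by apply: eq_eseriesr => j _; rewrite mule1.
have [Q hQ] := probability_of_masses w0 w1.
have mat_rv : discrete_rv (T := nat) matrix_at by move=> m.
pose qbar : random_matrix R n := RandomMatrix Q mat_rv.
exists qbar => h [M hM].
have [l hl] : exists l, attracts k (fun x => h (sk_q k x)) l.
  by apply: (@equilibrium_bounded _ M).
have h1 := bounded_law_cvg (phi := fun x => h (sk_q k x)) (fun x => hM _) hl.
have M0 : 0 <= M by apply: le_trans (hM (const_mx 0%N)).
have El : ('E_(rm_prob qbar)[fun w => h (qbar w)] = l%:E)%E.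
  pose h' m := 1 * h m + 1 * M.
  have h'0 m : 0 <= h' m.
    by rewrite /h' !mul1r -lerBlDr sub0r; have := hM m; rewrite ler_norml => /andP[].
  have h'M m : h' m <= 2 * M.
    by rewrite /h' !mul1r mulr_natl mulr2n lerD2r; have := hM m; rewrite ler_norml => /andP[].
  have hl' : attracts k (fun x => h' (sk_q k x)) (1 * l + 1 * M).
    by apply: attracts_lin => //; exact: attracts_cst.
  have := hQ (fun j => (h' (matrix_at j))%:E) (fun j => h'0 _).
  rewrite (total_mass h' (2 * M) _ h'0 h'M hl') => IQ.
  have mh (g : nat -> R) : measurable_fun [set: nat] g by [].
  have ih (g : nat -> R) B : (forall j, `|g j| <= B) ->
      Q.-integrable [set: nat] (fun j => (g j)%:E).
    move=> gB; apply: measurable_bounded_integrable => //.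
      by rewrite (le_lt_trans (probability_le1 Q measurableT)) // ltry.
    exists B; split; first exact: num_real.
    by move=> y By j _ /=; apply: le_trans (gB _) (ltW By).
  rewrite expectation.unlock.
  have -> : (\int[rm_prob qbar]_w (h (qbar w))%:E =
     \int[Q]_j ((h' (matrix_at j))%:E - cst M%:E j))%E.
    by apply: eq_integral => j _; rewrite -EFinB /h' !mul1r addrK.
  rewrite integralB //; first last.
  - by apply: (ih (fun=> M) M) => j; rewrite ger0_norm.
  - by apply: (ih _ (2 * M)) => j; rewrite ger0_norm.
  rewrite IQ integral_cst // [X in (_ - _ * X)%E]probability_setT mule1.
  by rewrite -EFinB; congr EFin; ring.
rewrite El.
rewrite (_ : (fun t => _) = fun t => ('E_P[fun w => h (sk_q k (X t w))])%E) //.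
by apply/funext => t; congr expectation; apply/funext => w'; rewrite qE.
Unshelve. all: by end_near. Qed.

End existence.

End steady.

(** * The three conclusions *)

Lemma perp_cone_le_norm (R : realType) n (x : 'M[R]_n) : (0 < n)%N ->
  frob_norm (perp_cone x) <= frob_norm x.
Proof.
by move=> n0; have := perp_cone_le n0 x (coneK0 R n); rewrite subr0.
Qed.

Section final.
Context (R : realType) (n : nat) (n_gt0 : (0 < n)%N)
  (nu : 'M[R]_n) (nu_ds : doubly_stochastic nu)
  (nu_min_gt0 : forall i j, 0 < nu i j)
  (amax : nat) (sw : R -> switch R n)
  (arrivals : forall e : R, 0 < e < 1 ->
    arrival_conditions (sw e) amax ((1 - e) *: nu))
  (algorithm_Pi3 : class_Pi3 sw).

(** Replacing the reset probability by its minimum with 1 keeps it a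
    probability. *)
Lemma Pi3_kernels : exists delta : R, [/\ 0 < delta, delta <= 1 &
  forall e, 0 < e < 1 ->
    exists k : switch_kernel amax nu (\matrix_(i, j) arr_var (sw e) i j) e delta
                 (sw_state (sw e)),
    fk_p k = @sw_p R n (sw e) /\ forall t w, sw_q t w = sk_q k (@sw_X R n (sw e) t w)].
Proof.
have [A12 [delta delta0 hmax] hmem hf] := algorithm_Pi3.
exists (Num.min delta 1); split.
- by rewrite lt_min delta0 ltr01.
- by rewrite ge_min lexx orbT.
move=> e e01; have [A1 A2] := A12 e e01; have [f fE] := hf e e01.
have d0 : 0 < Num.min delta 1 by rewrite lt_min delta0 ltr01.
have hmax' : forall t, {ae sw_prob (sw e), forall w, Num.min delta 1 <=
    cprob_given (sw_prob (sw e)) [set w | frob_inner (natmx R (sw_q t w)) (natmx R (sw_s t w))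
       = max_weight R (sw_q t w)] (@hist _ _ (sw e) t) w}.
  move=> t; apply: filterS (hmax e e01 t) => w.
  by apply: le_trans; rewrite ge_min lexx.
have [k [kp kq]] := kernel_of_switch (arrivals e01) A1 A2 d0 hmax' (hmem e e01) fE.
exists k; split=> // t w; rewrite kq.
by rewrite -fE.
Qed.

Lemma sw_inhabited e : sw_state (sw e).
Proof. by have [x _] := cid (exists_atom (sw_prob (sw e)) (@sw_X_rv R n (sw e) 0%N)). Qed.

Lemma Pi3_stable e : 0 < e < 1 ->
  stable (sw e) /\ exists qbar, steady_state (sw e) qbar.
Proof.
move=> e01; have [delta [d0 d1 hk]] := Pi3_kernels.
have [k [kp kq]] := hk e e01; have /andP[e0 e1] := e01.
split.
  have [pr _] := equilibrium n_gt0 nu_ds nu_min_gt0 d0 d1 k (sw_inhabited e) e0.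
  by rewrite /stable -kp.
exact: (steady_state_exists kp kq n_gt0 nu_ds nu_min_gt0 d0 d1 e0).
Qed.

Lemma Pi3_collapse : achieves_SSC sw.
Proof.
have [delta [d0 d1 hk]] := Pi3_kernels.
split.
  move=> e e01; have [A12 _ _ _] := algorithm_Pi3; have [A1 A2] := A12 e e01.
  by split=> //; have [] := Pi3_stable e01.
have [c0 [c00 [C hC]]] := collapse_moments amax n_gt0 nu_ds nu_min_gt0 d0 d1.
exists c0 => //; exists C => e e01 ec qbar ss r r0.
have [k [kp kq]] := hk e e01; have /andP[e0 e1] := e01.
have h0 (m : 'M[nat]_n) : 0 <= frob_norm (perp_cone (natmx R m)) ^+ r.
  by rewrite exprn_ge0 // frob_norm_ge0.
have hc (m : 'M[nat]_n) : frob_norm (perp_cone (natmx R m)) ^+ r <=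
    1 * (1 + frob_norm (natmx R m)) ^+ r.
  rewrite mul1r; apply: lerXn2r; rewrite ?nnegrE ?addr_ge0 ?frob_norm_ge0 //.
  by apply: le_trans (perp_cone_le_norm _ n_gt0) _; rewrite lerDr.
have [l [hl ->]] := steady_moment kp kq n_gt0 nu_ds nu_min_gt0 d0 d1 e0 ss h0 hc.
by rewrite lee_fin; exact: (hC e _ _ k (sw_inhabited e) e0 ec r l r0 hl).
Qed.

(** The choice r = sqrt e makes every error term of order sqrt e. *)
Lemma Pi3_heavy_traffic_error : exists e0 C : R, [/\ 0 < e0, 0 <= C &
  forall e qbar, 0 < e < 1 -> e <= e0 -> steady_state (sw e) qbar ->
  exists l : R,
   ('E_(rm_prob qbar)[fun w => (\sum_i \sum_j (qbar w i j)%:R)%R] = l%:E)%E /\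
   `|e * l - (1 - (2 * n%:R)^-1) * \sum_i \sum_j arr_var (sw e) i j|
     <= C * Num.sqrt e].
Proof.
have [delta [d0 d1 hk]] := Pi3_kernels.
have [c0 [c00 [C hC]]] := collapse_moments amax n_gt0 nu_ds nu_min_gt0 d0 d1.
pose N : R := n%:R.
have N0 : 0 < N by rewrite ltr0n.
exists c0, (4 * N * `|C 2%N| + 4 * N * N * N + 4 * N * N + N); split => //.
  by rewrite !addr_ge0 ?mulr_ge0 // ltW.
move=> e qbar e01 ec ss.
have [k [kp kq]] := hk e e01; have /andP[e0 e1] := e01.
have hS0 (m : 'M[nat]_n) : 0 <= mx_total (natmx R m).
  by do 2 (apply: sumr_ge0 => ? _); exact: natmx_ge0.
have hSc (m : 'M[nat]_n) : mx_total (natmx R m) <= (N * N) * (1 + frob_norm (natmx R m)) ^+ 1.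
  apply: le_trans (ler_norm _) _; apply: le_trans (mx_total_le _) _.
  by rewrite mulrA expr1 ler_wpM2l ?mulr_ge0 ?(ltW N0) // lerDr.
have [l [hl El]] := steady_moment kp kq n_gt0 nu_ds nu_min_gt0 d0 d1 e0 ss hS0 hSc.
have hd0 (m : 'M[nat]_n) : 0 <= frob_norm (perp_cone (natmx R m)) ^+ 2 by exact: sqr_ge0.
have hdc (m : 'M[nat]_n) : frob_norm (perp_cone (natmx R m)) ^+ 2 <=
    1 * (1 + frob_norm (natmx R m)) ^+ 2.
  rewrite mul1r; apply: lerXn2r; rewrite ?nnegrE ?addr_ge0 ?frob_norm_ge0 //.
  by apply: le_trans (perp_cone_le_norm _ n_gt0) _; rewrite lerDr.
have [D [hD _]] := steady_moment kp kq n_gt0 nu_ds nu_min_gt0 d0 d1 e0 ss hd0 hdc.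
have DC : D <= C 2%N by exact: (hC e _ _ k (sw_inhabited e) e0 ec 2%N D isT hD).
exists l; split.
  rewrite -El; congr expectation; apply/funext => w.
  by apply: eq_bigr => i _; apply: eq_bigr => j _; rewrite natmxE.
pose r := Num.sqrt e.
have r0 : 0 < r by rewrite sqrtr_gt0.
have r1 : r <= 1 by rewrite -sqrtr1 ler_wsqrtr // ltW.
have er : e = r * r by rewrite -expr2 sqr_sqrtr // ltW.
have := heavy_traffic_bound n_gt0 nu_ds nu_min_gt0 d0 d1 (sw_inhabited e) e0 r0 hl hD.
have -> : mx_total (\matrix_(i, j) arr_var (sw e) i j) = \sum_i \sum_j arr_var (sw e) i j.
  by apply: eq_bigr => i _; apply: eq_bigr => j _; rewrite mxE.
set T := \sum_i _; rewrite -/N -/r.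
have -> : (4 * N * N / r + 3 * N) * (N * e) = 4 * N * N * N * r + 3 * N * N * e.
  by rewrite er; field; rewrite gt_eqF.
have -> : 2 - N^-1 = 2 * (1 - (2 * N)^-1) by field; rewrite gt_eqF.
set b := 1 - _.
have h1 : 4 * N * r * D <= 4 * N * `|C 2%N| * r.
  rewrite -!mulrA !ler_pM2l // mulrC ler_wpM2r ?(ltW r0) //.
  by apply: le_trans DC (ler_norm _).
have h2 : e <= r by rewrite er ler_piMl // ltW.
have h3 : e ^+ 2 <= r.
  by apply: le_trans h2; rewrite expr2 ler_piMl // ltW.
have h4 := ler_wpM2l (mulr_ge0 (mulr_ge0 (ler0n R 3) (ltW N0)) (ltW N0)) h2.
have h5 := ler_wpM2l (ltW N0) h3.
have h6 : 0 <= N * N * r by rewrite !mulr_ge0 // ltW.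
have h7 : 0 <= N * N * N * r by rewrite !mulr_ge0 // ltW.
have h8 : 0 <= N * `|C 2%N| * r by rewrite !mulr_ge0 // ltW.
have h9 : 0 <= N * e ^+ 2 by rewrite mulr_ge0 ?sqr_ge0 // ltW.
have h10 : 0 <= N * N * e by rewrite !mulr_ge0 // ltW.
rewrite !ler_norml => /andP[g1 g2]; apply/andP; split; lra.
Qed.

Lemma Pi3_heavy_traffic (sigmat : 'M[R]_n) (qbar : R -> random_matrix R n) :
  (forall i j t,
    ('V_(sw_prob (sw e))[fun w => (arr i j t w)%:R])%E @[e --> 0^'+]
      --> ((sigmat i j ^+ 2)%:E : \bar R)) ->
  (forall e : R, 0 < e < 1 -> steady_state (sw e) (qbar e)) ->
  (e%:E * 'E_(rm_prob (qbar e))[fun w =>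
     (\sum_i \sum_j (qbar e w i j)%:R)%R])%E @[e --> 0^'+]
    --> (((1 - (2 * n%:R)^-1) * frob_norm sigmat ^+ 2)%:E : \bar R).
Proof.
move=> var ss.
have [e0 [C [e00 C0 herr]]] := Pi3_heavy_traffic_error.
pose T e := \sum_i \sum_j arr_var (sw e) i j.
pose L e := fine ('E_(rm_prob (qbar e))[fun w => (\sum_i \sum_j (qbar e w i j)%:R)%R])%E.
have Tcvg : T e @[e --> 0^'+] --> frob_norm sigmat ^+ 2.
  rewrite frob_norm_sqr /frob_inner /T.
  apply: cvg_big => [|i _]; first exact: add_continuous.
  apply: cvg_big => [|j _]; first exact: add_continuous.
  by have /fine_cvgP[_] := var i j 0%N; rewrite expr2.
have sqrt0 : Num.sqrt e @[e --> 0^'+] --> (0 : R).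
  rewrite -[X in _ --> X](sqrtr0 R); apply: cvg_at_right_filter.
  exact: sqrt_continuous.
have small : \forall e \near 0^'+, [/\ 0 < e, e < 1 & e <= e0].
  near=> e; split.
  - by near: e; exact: nbhs_right_gt.
  - by near: e; exact: nbhs_right_lt.
  - by near: e; exact: nbhs_right_le.
pose b : R := 1 - (2 * n%:R)^-1.
have Lcvg : e * L e @[e --> 0^'+] --> b * frob_norm sigmat ^+ 2.
  have c1 : b * T e - C * Num.sqrt e @[e --> 0^'+] --> b * frob_norm sigmat ^+ 2.
    rewrite -[X in _ --> X]subr0 -[X in _ - X](mulr0 C).
    by apply: cvgB; apply: cvgMl_tmp.
  have c2 : b * T e + C * Num.sqrt e @[e --> 0^'+] --> b * frob_norm sigmat ^+ 2.
    rewrite -[X in _ --> X]addr0 -[X in _ + X](mulr0 C).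
    by apply: cvgD; apply: cvgMl_tmp.
  apply: (squeeze_cvgr _ c1 c2); near=> e.
  have [p0 p1 p2] : [/\ 0 < e, e < 1 & e <= e0] by near: e.
  have e01 : 0 < e < 1 by rewrite p0.
  have [l [El]] := herr e (qbar e) e01 p2 (ss e e01).
  rewrite /L El /= ler_norml -/b -/(T e) => /andP[h1 h2].
  by apply/andP; split; lra.
apply: cvg_EFin; last (apply: cvg_trans Lcvg; apply: near_eq_cvg); near=> e.
  have [p0 p1 p2] : [/\ 0 < e, e < 1 & e <= e0] by near: e.
  have e01 : 0 < e < 1 by rewrite p0.
  by have [l [-> _]] := herr e (qbar e) e01 p2 (ss e e01).
have [p0 p1 p2] : [/\ 0 < e, e < 1 & e <= e0] by near: e.
have e01 : 0 < e < 1 by rewrite p0.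
by have [l [El _]] := herr e (qbar e) e01 p2 (ss e e01); rewrite /L /= El.
Unshelve. all: by end_near. Qed.

End final.

Theorem theorem13 (R : realType) (n : nat) (n_gt0 : (0 < n)%N)
  (nu : 'M[R]_n) (nu_ds : doubly_stochastic nu)
  (nu_min_gt0 : forall i j, 0 < nu i j)
  (amax : nat) (sigmat : 'M[R]_n)
  (sw : R -> switch R n)
  (arrivals : forall e : R, 0 < e < 1 ->
    arrival_conditions (sw e) amax ((1 - e) *: nu))
  (variance_cvg : forall i j t,
    ('V_(sw_prob (sw e))[fun w => (arr i j t w)%:R])%E @[e --> 0^'+]
      --> ((sigmat i j ^+ 2)%:E : \bar R))
  (algorithm_Pi3 : class_Pi3 sw) :
  [/\ forall e : R, 0 < e < 1 ->
        stable (sw e) /\ exists qbar, steady_state (sw e) qbar,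
      achieves_SSC sw
    & forall qbar : R -> random_matrix R n,
        (forall e : R, 0 < e < 1 -> steady_state (sw e) (qbar e)) ->
        (e%:E * 'E_(rm_prob (qbar e))[fun w =>
           (\sum_i \sum_j (qbar e w i j)%:R)%R])%E @[e --> 0^'+]
          --> (((1 - (2 * n%:R)^-1) * frob_norm sigmat ^+ 2)%:E : \bar R)].
Proof.
split.
- exact: (Pi3_stable n_gt0 nu_ds nu_min_gt0 arrivals algorithm_Pi3).
- exact: (Pi3_collapse n_gt0 nu_ds nu_min_gt0 arrivals algorithm_Pi3).
- move=> qbar ss.
  exact: (Pi3_heavy_traffic n_gt0 nu_ds nu_min_gt0 arrivals algorithm_Pi3 variance_cvg ss).
Qed.
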